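(* Let $\mathfrak{F}:H^2(\mathbb{D})\to L^2(\mathbb{R},e^{-2(e^y-1)}\,dy)$ be the unitary isomorphism $\mathfrak{F}=WT^{-1}\mathcal{L}^{-1}\mathcal{U}$ defined in the context. Let $M$ be a closed subspace of $H^2(\mathbb{D})$ of finite codimension. Then $M$ is invariant under the Cesàro operator $\mathcal{C}$ if and only if there exist a finite set $\Lambda\subset\mathbb{C}_+$ (possibly empty) and integers $n_\lambda\ge0$ for $\lambda\in\Lambda$ such that $\mathfrak{F}M^\perp$ is the linear span in $L^2(\mathbb{R},e^{-2(e^y-1)}\,dy)$ of the finite set of functions (of $y\in\mathbb{R}$) $$\bigcup_{\lambda\in\Lambda}\{y^ke^{\lambda y}:\ k=0,1,2,\ldots,n_\lambda\}.$$
   Context: $\mathbb{D}$ is the open unit disc, $\mathbb{C}_+$ the open right half-plane, $\mathbb{R}_+=(0,\infty)$. $H^2(\mathbb{D})$ is the Hardy space with orthonormal basis $(z^n)_{n\ge0}$; $M^\perp$ is the orthogonal complement of $M$ in $H^2(\mathbb{D})$. The Cesàro operator is the bounded operator on $H^2(\mathbb{D})$ given, for $f(z)=\sum_{k\ge0} a_k z^k$, by $\mathcal{C}f(z)=\sum_{n=0}^\infty\big(\frac{1}{n+1}\sum_{k=0}^n a_k\big)z^n$. $H^2(\mathbb{C}_+)$ is the Hardy space of analytic $F$ on $\mathbb{C}_+$ with $\|F\|^2=\sup_{x>0}\int_{-\infty}^\infty|F(x+iy)|^2\,dy<\infty$. The maps composing $\mathfrak{F}$ are: (i) $\mathcal{U}:H^2(\mathbb{D})\to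 H^2(\mathbb{C}_+)$, $\mathcal{U}f(s)=\frac{\sqrt2}{1+s}\,f\big(\frac{s-1}{s+1}\big)$, an isomorphism (unitary up to a constant) that satisfies $\mathcal{U}C_{\varphi_t}\mathcal{U}^{-1}=e^tC_{\phi_t}$ for $t\ge0$, where $\varphi_t(z)=e^{-t}z+1-e^{-t}$ on $\mathbb{D}$, $\phi_t(s)=e^ts+(e^t-1)$ on $\mathbb{C}_+$, and $C_\psi g=g\circ\psi$; (ii) $\mathcal{L}:L^2(\mathbb{R}_+)\to H^2(\mathbb{C}_+)$, the Laplace transform $\mathcal{L}f(s)=\int_0^\infty f(x)e^{-sx}\,dx$, an isomorphism by the Paley–Wiener theorem, with $\|\mathcal{L}f\|^2=2\pi\|f\|^2$; (iii) $T:L^2(\mathbb{R})\to L^2(\mathbb{R}_+)$, $Th(x)=x^{-1/2}h(\log x)$, unitary with inverse $T^{-1}g(y)=e^{y/2}g(e^y)$; (iv) $W:L^2(\mathbb{R})\to L^2(\mathbb{R},e^{-2(e^y-1)}\,dy)$, $Wh(y)=e^{e^y-1}h(y)$, unitary. *)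

(* Defs.v *)
From HB Require Import structures.
From mathcomp Require Import all_boot all_order all_algebra.
From mathcomp Require Import all_classical all_reals all_analysis.
From mathcomp Require Import complex ring lra.

Set Implicit Arguments.
Unset Strict Implicit.
Unset Printing Implicit Defensive.

Import Order.TTheory GRing.Theory Num.Theory.
Import numFieldNormedType.Exports.
Import Normc.

Local Open Scope classical_set_scope.
Local Open Scope ring_scope.
Local Open Scope complex_scope.

Section linear_algebra.
Context (K : pzRingType) (V : lmodType K).

Definition linear_span (S : set V) : set V :=
  [set v | exists m (c : 'I_m -> K) (u : 'I_m -> V),
     (forall i, S (u i)) /\ v = \sum_(i < m) c i *: u i].

Definition finite_codim (M : set V) : Prop :=
  exists E : set V, finite_set E /\
    forall v, exists2 u, M u & linear_span E (v - u).

End linear_algebra.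

(* Complex analysis over [R[i]]; the topology used on [R[i]] is that of the
   normed module [R[i]^o], whose norm takes its values in the reals of [R[i]]. *)
Section complex_functions.
Context {R : realType}.
Local Notation Re := (@complex.Re R).
Local Notation Im := (@complex.Im R).
Implicit Types (z s : R[i]) (x y : R).

Definition cexp z : R[i] :=
  (expR (Re z))%:C * (cos (Im z) +i* sin (Im z)).

Definition right_half_plane : set R[i] := [set s | 0 < Re s].

Definition cseries (u : nat -> R[i]) : R[i] :=
  lim (series (u : nat -> R[i]^o) @ \oo).

Definition cintegral (D : set R) (f : R -> R[i]) : R[i] :=
  (\int[lebesgue_measure]_(x in D) Re (f x)) +i*
  (\int[lebesgue_measure]_(x in D) Im (f x)).

(* Complex-valued functions representing an element of L^2(D, w(x) dx). *)
Definition L2 (D : set R) (w : R -> R) : set (R -> R[i]^o) :=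
  [set f | [/\ measurable_fun D (fun x => Re (f x)),
               measurable_fun D (fun x => Im (f x)) &
     (\int[lebesgue_measure]_(x in D) (normc (f x) ^+ 2 * w x)%:E < +oo)%E]].

(* The subset of L^2(R, w(x) dx) formed by the classes of the elements of [S],
   seen as a set of functions.  Lebesgue-negligible sets are the negligible
   sets of w(x) dx when w > 0. *)
Definition L2_classes (w : R -> R) (S : set (R -> R[i]^o)) :
    set (R -> R[i]^o) :=
  [set h | L2 setT w h /\ exists2 g, S g & h = g %[ae lebesgue_measure]].

End complex_functions.

(* An element f of H^2(D) is represented by its sequence of Taylor coefficients,
   i.e. by its coordinates in the orthonormal basis (z^n); the associated
   function on the disc is [hardy_fun f]. *)
Section hardy_disc.
Context (R : realType).
Implicit Types (a b : nat -> R[i]^o).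

Definition sqsummable : {pred (nat -> R[i]^o)} :=
  mem [set a | cvgn (series (fun n => normc (a n) ^+ 2))].

Record hardy := Hardy { hcoef :> nat -> R[i]^o ; _ : hcoef \in sqsummable }.

HB.instance Definition _ := [isSub for hcoef].
HB.instance Definition _ := [Choice of hardy by <:].

Definition sqsum a : R := limn (series (fun n => normc (a n) ^+ 2)).

Lemma sqsummable_bounded a B :
  (forall n, series (fun n => normc (a n) ^+ 2) n <= B) -> a \in sqsummable.
Proof.
move=> aB; rewrite inE /=; apply: nondecreasing_is_cvgn.
  by apply: nondecreasing_series => n _ _; exact: sqr_ge0.
by exists B => _ [n _ <-]; exact: aB.
Qed.

Lemma series_le_sqsum a n : a \in sqsummable ->
  series (fun n => normc (a n) ^+ 2) n <= sqsum a.
Proof.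
rewrite inE /= => ca; apply: nondecreasing_cvgn_le => //.
by apply: nondecreasing_series => k _ _; exact: sqr_ge0.
Qed.

Lemma sqsum_le a B : a \in sqsummable ->
  (forall n, series (fun n => normc (a n) ^+ 2) n <= B) -> sqsum a <= B.
Proof.
by rewrite inE /= => ca aB; apply: limr_le => //; apply: nearW.
Qed.

Lemma sqsum_ge0 a : a \in sqsummable -> 0 <= sqsum a.
Proof.
by move=> /(series_le_sqsum 0); rewrite /series /= big_geq.
Qed.

Lemma sqsumZ c a : a \in sqsummable ->
  c *: a \in sqsummable /\ sqsum (c *: a) = normc c ^+ 2 * sqsum a.
Proof.
move=> sa; have := sa; rewrite inE /= => ca.
have E : series (fun n => normc ((c *: a) n) ^+ 2) =
    normc c ^+ 2 *: series (fun n => normc (a n) ^+ 2).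
  apply/funext => n; rewrite /series /= [RHS]mulr_sumr.
  by apply: eq_bigr => i _; rewrite normcM exprMn.
rewrite inE /= /sqsum E; split; first exact: is_cvgZl_tmp.
exact: limZl_tmp.
Qed.

Lemma sqr_normcD_le (z w : R[i]) (t : R) : 0 < t ->
  normc (z + w) ^+ 2 <= (1 + t) * normc z ^+ 2 + (1 + t^-1) * normc w ^+ 2.
Proof.
move=> t0; have zw := le_normcD z w.
have z0 : 0 <= normc (z + w) by case: (z + w) => ? ? /=; exact: sqrtr_ge0.
have h : normc (z + w) ^+ 2 <= (normc z + normc w) ^+ 2.
  by rewrite ler_sqr ?nnegrE // (le_trans z0).
apply: (le_trans h); rewrite -subr_ge0.
have -> : (1 + t) * normc z ^+ 2 + (1 + t^-1) * normc w ^+ 2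
    - (normc z + normc w) ^+ 2 = t^-1 * (t * normc z - normc w) ^+ 2.
  by field; rewrite gt_eqF.
by rewrite mulr_ge0 ?sqr_ge0 // invr_ge0 ltW.
Qed.

Lemma series_sqrD_le a b t n : 0 < t ->
    a \in sqsummable -> b \in sqsummable ->
  series (fun n => normc ((a + b) n) ^+ 2) n <=
  (1 + t) * sqsum a + (1 + t^-1) * sqsum b.
Proof.
move=> t0 sa sb.
have Ha := series_le_sqsum n sa; have Hb := series_le_sqsum n sb.
have t1 : 0 <= 1 + t by rewrite addr_ge0 // ltW.
have t2 : 0 <= 1 + t^-1 by rewrite addr_ge0 // invr_ge0 ltW.
apply: le_trans (lerD (ler_wpM2l t1 Ha) (ler_wpM2l t2 Hb)).
rewrite /series /= !mulr_sumr -big_split /=.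
by apply: ler_sum => i _; exact: sqr_normcD_le.
Qed.

Lemma sqsummableD a b : a \in sqsummable -> b \in sqsummable ->
  a + b \in sqsummable.
Proof.
move=> sa sb; apply: sqsummable_bounded => n.
exact: (@series_sqrD_le a b 1).
Qed.

Lemma sqsummable0 : (0 : nat -> R[i]^o) \in sqsummable.
Proof.
apply: (@sqsummable_bounded _ 0) => n; rewrite /series /=.
by rewrite big1 // => i _; rewrite expr0n addr0 sqrtr0 expr0n.
Qed.

Lemma sqsummable_submod_closed : GRing.submod_closed sqsummable.
Proof.
split=> [|c a b sa sb]; first exact: sqsummable0.
by apply: sqsummableD => //; case: (sqsumZ c sa).
Qed.

HB.instance Definition _ :=
  GRing.isSubmodClosed.Build _ _ sqsummable sqsummable_submod_closed.
HB.instance Definition _ := [SubChoice_isSubLmodule of hardy by <:].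

Definition hardy_norm (f : hardy) : R[i] := (Num.sqrt (sqsum f))%:C.

Lemma sqsum_eq0 (f : hardy) : sqsum f = 0 -> f = 0.
Proof.
move=> f0; apply/val_inj/funext => n /=; apply: eq0_normc.
apply/eqP; rewrite -sqrf_eq0 eq_le sqr_ge0 andbT -f0.
apply: le_trans (series_le_sqsum n.+1 (valP f)).
rewrite /series /= big_nat_recr //= lerDr.
by apply: sumr_ge0 => i _; exact: sqr_ge0.
Qed.

Lemma hardy_normD (f g : hardy) :
  hardy_norm (f + g) <= hardy_norm f + hardy_norm g.
Proof.
rewrite /hardy_norm -rmorphD lecR /=.
have [/sqsum_eq0 ->|f0] := eqVneq (sqsum f) 0; first by rewrite add0r lerDr sqrtr_ge0.
have [/sqsum_eq0 ->|g0] := eqVneq (sqsum g) 0; first by rewrite addr0 lerDl sqrtr_ge0.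
have sf := sqsum_ge0 (valP f); have sg := sqsum_ge0 (valP g).
set A := Num.sqrt (sqsum f); set B := Num.sqrt (sqsum g).
have A0 : 0 < A by rewrite sqrtr_gt0 lt_def f0.
have B0 : 0 < B by rewrite sqrtr_gt0 lt_def g0.
rewrite -(ger0_norm (ltW (addr_gt0 A0 B0))) -sqrtr_sqr; apply: ler_wsqrtr.
apply: sqsum_le => [|n]; first exact: (valP (f + g)).
have := @series_sqrD_le f g (B / A) n (divr_gt0 B0 A0) (valP f) (valP g).
rewrite -(sqr_sqrtr sf) -(sqr_sqrtr sg) -/A -/B.
suff -> : (1 + B / A) * A ^+ 2 + (1 + (B / A)^-1) * B ^+ 2 = (A + B) ^+ 2 by [].
by field; rewrite !gt_eqF.
Qed.

Lemma hardy_normZ (c : R[i]) (f : hardy) :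
  hardy_norm (c *: f) = `|c| * hardy_norm f.
Proof.
rewrite /hardy_norm; have [_ /= ->] := sqsumZ c (valP f).
have c0 : 0 <= normc c by case: c => ? ? /=; exact: sqrtr_ge0.
rewrite sqrtrM ?sqr_ge0 // sqrtr_sqr ger0_norm // rmorphM /=.
by congr (_ * _).
Qed.

Lemma hardy_norm0_eq0 (f : hardy) : hardy_norm f = 0 -> f = 0.
Proof.
move=> /complexI /eqP; rewrite sqrtr_eq0 => f0; apply: sqsum_eq0.
by apply/eqP; rewrite eq_le f0 sqsum_ge0 //; exact: valP.
Qed.

HB.instance Definition _ := Lmodule_isNormed.Build R[i] hardy
  hardy_normD hardy_normZ hardy_norm0_eq0.

Definition hardy_fun (f : hardy) (z : R[i]) : R[i] :=
  cseries (fun n => f n * z ^+ n).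

Definition hardy_dot (f g : hardy) : R[i] :=
  cseries (fun n => f n * (g n)^*).

Definition hardy_orth (M : set hardy) : set hardy :=
  [set f | forall g, M g -> hardy_dot f g = 0].

Definition cesaro_coef a : nat -> R[i]^o :=
  arithmetic_mean (a : nat -> R[i]).

Lemma cesaro_coefE a n : cesaro_coef a n = (\sum_(k < n.+1) a k) / n.+1%:R.
Proof. by rewrite /cesaro_coef /arithmetic_mean /series /= big_mkord mulrC. Qed.

(* Hardy's inequality *)
Lemma cesaro_sqsummable a : a \in sqsummable -> cesaro_coef a \in sqsummable.
Proof.
move=> sa; pose b n := normc (a n); pose A n := (\sum_(k < n.+1) b k) / n.+1%:R.
have A0 n : 0 <= A n.
  rewrite divr_ge0 // sumr_ge0 // => i _; rewrite /b.
  by case: (a i) => ? ? /=; exact: sqrtr_ge0.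
have AS n : b n.+1 = n.+2%:R * A n.+1 - n.+1%:R * A n.
  rewrite /A [X in X / n.+2%:R]big_ord_recr /=.
  by field; rewrite nat1r -natrD !pnatr_eq0.
have b0 : b 0%N = A 0%N by rewrite /A big_ord1 divr1.
have tel n : \sum_(0 <= k < n.+1) (A k ^+ 2 - 2 * A k * b k) <=
    - (n.+1%:R * A n ^+ 2).
  elim: n => [|n IH]; first by rewrite big_nat1 b0; lra.
  rewrite big_nat_recr //= AS; apply: le_trans (lerD IH (lexx _)) _.
  rewrite -subr_ge0.
  have -> : - (n.+2%:R * A n.+1 ^+ 2) - (- (n.+1%:R * A n ^+ 2) +
     (A n.+1 ^+ 2 - 2 * A n.+1 * (n.+2%:R * A n.+1 - n.+1%:R * A n)))
     = n.+1%:R * (A n.+1 - A n) ^+ 2.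
    by rewrite -[n.+2%:R]natr1; ring.
  by rewrite mulr_ge0 ?sqr_ge0.
have main n : \sum_(0 <= k < n) A k ^+ 2 <= 4 * sqsum a.
  case: n => [|n]; first by rewrite big_geq // mulr_ge0 // sqsum_ge0.
  have T := tel n.
  have T0 : 0 <= n.+1%:R * A n ^+ 2 by rewrite mulr_ge0 ?sqr_ge0.
  have S := series_le_sqsum n.+1 sa; rewrite /series /= in S.
  have Y : \sum_(0 <= k < n.+1) (A k ^+ 2) <=
      \sum_(0 <= k < n.+1)
        (2 * (A k ^+ 2 - 2 * A k * b k) + 4 * normc (a k) ^+ 2).
    apply: ler_sum => k _; rewrite -/(b k) -subr_ge0.
    have -> : 2 * (A k ^+ 2 - 2 * A k * b k) + 4 * b k ^+ 2 - A k ^+ 2 =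
      (A k - 2 * b k) ^+ 2 by ring.
    exact: sqr_ge0.
  move: Y; rewrite big_split /= -!mulr_sumr; lra.
apply: (@sqsummable_bounded _ (4 * sqsum a)) => n; apply: le_trans (main n).
rewrite /series /=; apply: ler_sum => k _.
have c0 (z : R[i]) : 0 <= normc z by case: z => ? ? /=; exact: sqrtr_ge0.
rewrite ler_sqr ?nnegrE // cesaro_coefE normcM normcV /A.
have -> : normc (k.+1%:R : R[i]) = k.+1%:R.
  have -> : (k.+1%:R : R[i]) = (k.+1%:R)%:C by rewrite rmorph_nat.
  by rewrite /= expr0n addr0 sqrtr_sqr ger0_norm.
rewrite ler_wpM2r ?invr_ge0 // /b.
elim/big_ind2: _ => [|x x' y y' h h'|//]; first by rewrite normc0.
exact: le_trans (le_normcD _ _) (lerD h h').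
Qed.

Definition cesaro_op (f : hardy) : hardy := Hardy (cesaro_sqsummable (valP f)).

End hardy_disc.


Section the_transform.
Context {R : realType}.

(* U : H^2(D) -> H^2(C_+) *)
Definition disc_to_half_plane (f : hardy R) (s : R[i]) : R[i] :=
  (Num.sqrt 2)%:C / (1 + s) * hardy_fun f ((s - 1) / (s + 1)).

Definition laplace (g : R -> R[i]) (s : R[i]) : R[i] :=
  cintegral `]0, +oo[ (fun x => g x * cexp (- s * x%:C)).

(* A representative of the class in L^2(0, +oo) with Laplace transform [F];
   by the Paley-Wiener theorem, it exists and is unique up to negligible sets
   when F is in H^2(C_+). *)
Definition laplace_inv (F : R[i] -> R[i]) : R -> R[i]^o :=
  xget 0 [set g | L2 `]0, +oo[ (cst 1) g /\
                  forall s, right_half_plane s -> laplace g s = F s].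

(* T^-1 : L^2(0, +oo) -> L^2(R) *)
Definition Tinv (g : R -> R[i]^o) : R -> R[i]^o :=
  fun y => (expR (y / 2))%:C * g (expR y).

Definition weight (y : R) : R := expR (- 2 * (expR y - 1)).

(* W : L^2(R) -> L^2(R, weight) *)
Definition Wmul (h : R -> R[i]^o) : R -> R[i]^o :=
  fun y => (expR (expR y - 1))%:C * h y.

Definition frakF (f : hardy R) : R -> R[i]^o :=
  Wmul (Tinv (laplace_inv (disc_to_half_plane f))).

Definition exp_monomial (l : R[i]) (k : nat) : R -> R[i]^o :=
  fun y => (y ^+ k)%:C * cexp (l * y%:C).

End the_transform.

(* Main.v *)
(* The adjoint of the Cesaro operator has an inverse, given on Taylor
   coefficients by [(D a)_n = (n + 1) (a_n - a_(n+1))], and [M] is invariant if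
   and only if its orthogonal complement [N], which is finite-dimensional, is
   invariant under [D].  The Laplace transform sends the functions
   [L_n(2x) e^(-x)], up to a common factor, to the images under U of the [z^n];
   hence the transform F of the theorem is given by expansion in these
   functions followed by the change of variable [x = e^y] and multiplication
   by weights, and integration by parts shows that it intertwines [D] with
   [d/dy + 1/2].  The square-summable eigenvectors of [D] have eigenvalues of
   real part [> 1/2], the eigenspaces are lines, and [y^k e^(l y)], [k = 0, 1, ...],
   is a Jordan chain of [d/dy + 1/2] for [l + 1/2]; so the finite-dimensional
   [D]-invariant subspaces are the spans of finitely many initial segments of
   such chains.  Paley-Wiener is not needed in general: existence of the inverse
   Laplace transform comes from the Riesz-Fischer theorem in the Laguerre
   basis, and its uniqueness from the fact that [h e^(-x)] is orthogonal to all
   [exp (- e^(n (a - x)))], which tend to the indicator of [x > a]. *)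

Require Import Defs.
From HB Require Import structures.
From mathcomp Require Import all_boot all_order all_algebra.
From mathcomp Require Import all_classical all_reals all_analysis.
From mathcomp Require Import measurable_realfun complex ring lra.
Import Order.TTheory GRing.Theory Num.Theory.
Import numFieldNormedType.Exports.
Import Normc.
Set Implicit Arguments.
Unset Strict Implicit.
Unset Printing Implicit Defensive.
Local Open Scope classical_set_scope.
Local Open Scope ring_scope.

(** * Complex sequences and the inner product of H^2 *)

(** On the disc [Dop] is f - (1 - z) f', the identity minus the generator of the semigroup of
    compositions with e^(-t) z + 1 - e^(-t). Through the transform this semigroup becomes v(y) ->
    e^(t/2) v(y - t), with generator 1/2 - d/dy; hence d/dy + 1/2. [Dop] does not preserve square
    summability, so it is treated as a linear map on all sequences. The Jordan argument takes place
    there, and square summability enters it only through the bound on the eigenvalues. The two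
    implications use [Dop] differently. If M is invariant, the adjoint of the Cesaro operator acts
    on the orthogonal complement by an invertible matrix, whose inverse describes [Dop]. Conversely,
    every element of the complement must be [Dop] of another one, which holds because 0 is not an
    eigenvalue. Completeness of the Laguerre functions is an outcome, not an input: only the kernel
    e^(-s x) is expanded, and its remainder is explicit; injectivity of the Laplace transform then
    shows that the Laguerre coordinates determine a function. *)

Section complex_facts.
Context {R : realType}.
Local Notation C := R[i].
Local Notation Re := (@complex.Re R).
Local Notation Im := (@complex.Im R).
Implicit Types z w : C.

Lemma cReD z w : Re (z + w) = Re z + Re w. Proof. by case: z; case: w. Qed.
Lemma cImD z w : Im (z + w) = Im z + Im w. Proof. by case: z; case: w. Qed.
Lemma cReN z : Re (- z) = - Re z. Proof. by case: z. Qed.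
Lemma cImN z : Im (- z) = - Im z. Proof. by case: z. Qed.
Lemma cReM z w : Re (z * w) = Re z * Re w - Im z * Im w.
Proof. by case: z; case: w. Qed.
Lemma cImM z w : Im (z * w) = Re z * Im w + Im z * Re w.
Proof. by case: z; case: w => a b c d /=. Qed.
Lemma cRe_conj z : Re (z^*) = Re z.
Proof. by case: z => a b /=; rewrite /Num.conj /=. Qed.
Lemma cIm_conj z : Im (z^*) = - Im z.
Proof. by case: z => a b /=; rewrite /Num.conj /=. Qed.
Lemma cRe_sum I (r : seq I) (P : pred I) (F : I -> C) :
  Re (\sum_(i <- r | P i) F i) = \sum_(i <- r | P i) Re (F i).
Proof. by apply: big_morph => // x y; exact: cReD. Qed.
Lemma cIm_sum I (r : seq I) (P : pred I) (F : I -> C) :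
  Im (\sum_(i <- r | P i) F i) = \sum_(i <- r | P i) Im (F i).
Proof. by apply: big_morph => // x y; exact: cImD. Qed.

Lemma complex_eq z w : Re z = Re w -> Im z = Im w -> z = w.
Proof. by case: z; case: w => a b c d /= -> ->. Qed.

Lemma normc_ge0 z : 0 <= normc z.
Proof. by case: z => a b /=; exact: sqrtr_ge0. Qed.

Lemma normc_sqr z : normc z ^+ 2 = Re z ^+ 2 + Im z ^+ 2.
Proof. by case: z => a b /=; rewrite sqr_sqrtr // addr_ge0 // sqr_ge0. Qed.

Lemma normr_normc z : `|z| = (normc z)%:C%C. Proof. by []. Qed.

Lemma normRe_le z : `|Re z| <= normc z.
Proof.
rewrite -(ler_sqr (normr_ge0 _) (normc_ge0 _)) ?nnegrE // normc_sqr real_normK ?num_real //.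
by rewrite lerDl sqr_ge0.
Qed.

Lemma normIm_le z : `|Im z| <= normc z.
Proof.
rewrite -(ler_sqr (normr_ge0 _) (normc_ge0 _)) normc_sqr real_normK ?num_real //.
by rewrite lerDr sqr_ge0.
Qed.

Lemma normc_le z : normc z <= `|Re z| + `|Im z|.
Proof.
rewrite -(ler_sqr (normc_ge0 _)) ?nnegrE ?addr_ge0 // normc_sqr sqrrD.
rewrite !real_normK ?num_real // -addrA [X in _ <= _ + X]addrC addrA lerDl.
by rewrite mulrn_wge0 // mulr_ge0.
Qed.

Lemma normcR (x : R) : normc x%:C%C = `|x|.
Proof. by rewrite /= expr0n addr0 sqrtr_sqr. Qed.

Lemma normc_conj z : normc z^* = normc z.
Proof.
apply/eqP; rewrite -(eqrXn2 (n := 2)) ?normc_ge0 //.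
by rewrite !normc_sqr cRe_conj cIm_conj sqrrN.
Qed.

Lemma cvg_complexP (u : nat -> C^o) (l : C) :
  (u @ \oo --> (l : C^o)) <->
  ((fun n => Re (u n)) @ \oo --> Re l /\ (fun n => Im (u n)) @ \oo --> Im l).
Proof.
split.
  move=> /cvgrPdist_lt h; split; apply/cvgrPdist_lt => e e0.
    have /h : 0 < e%:C%C by rewrite ltcR.
    apply: filterS => n; rewrite normr_normc ltcR; apply: le_lt_trans.
    by rewrite -cReN -cReD; exact: normRe_le.
  have /h : 0 < e%:C%C by rewrite ltcR.
  apply: filterS => n; rewrite normr_normc ltcR; apply: le_lt_trans.
  by rewrite -cImN -cImD; exact: normIm_le.
move=> [/cvgrPdist_lt h1 /cvgrPdist_lt h2]; apply/cvgrPdist_lt => e e0.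
(* Positivity in the partial order of [R[i]] forces [e] to be real. *)
have eR : e = (Re e)%:C%C by rewrite RRe_real // gtr0_real.
have e0' : 0 < Re e / 2 by rewrite divr_gt0 // -ltcR -eR.
have H1 := h1 _ e0'; have H2 := h2 _ e0'.
near=> n.
rewrite eR normr_normc ltcR; apply: le_lt_trans (normc_le _) _.
rewrite cReD cImD cReN cImN [ltRHS]splitr; apply: ltrD; [near: n; exact: H1|near: n; exact: H2].
Unshelve. all: by end_near. Qed.

Lemma cvg_complexD (u v : nat -> C^o) (l m : C) : u @ \oo --> (l : C^o) ->
  v @ \oo --> (m : C^o) -> (fun n => u n + v n) @ \oo --> (l + m : C^o).
Proof. by move=> h1 h2; exact: cvgD h1 h2. Qed.

Lemma cvg_complexZ (c : C) (u : nat -> C^o) (l : C) : u @ \oo --> (l : C^o) ->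
  (fun n => c * u n) @ \oo --> (c * l : C^o).
Proof. by move=> h1; apply: (@cvgZl_tmp _ C^o); exact: h1. Qed.

Lemma cvg_normc (u : nat -> C^o) (l : C) :
  (fun n => normc (u n - l)) @ \oo --> (0 : R) -> u @ \oo --> (l : C^o).
Proof.
move=> h; apply/cvg_complexP; split; apply/subr_cvg0/norm_cvg0P;
  (apply: squeeze_cvgr h; [|exact: cvg_cst]); near=> n => //=.
  by rewrite normr_ge0 /= -cReN -cReD normRe_le.
by rewrite normr_ge0 /= -cImN -cImD normIm_le.
Unshelve. all: by end_near. Qed.

Lemma cseriesP (u : nat -> C) (l : C) :
  (series (u : nat -> C^o) @ \oo --> (l : C^o)) -> cseries u = l.
Proof. by move=> h; apply: (@cvg_lim C^o) h; exact: norm_hausdorff. Qed.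

Lemma cvg_cseries_le (u : nat -> C) (v : nat -> R) :
  (forall n, normc (u n) <= v n) -> cvgn (series v) ->
  series (u : nat -> C^o) @ \oo --> (cseries u : C^o).
Proof.
move=> uv cv.
have v0 n : 0 <= v n by exact: le_trans (normc_ge0 _) (uv n).
have cR : cvgn (series (fun n => Re (u n))).
  apply/normed_cvg/(series_le_cvg (fun=> normr_ge0 _) v0 _ cv) => n /=.
  exact: le_trans (normRe_le _) (uv n).
have cI : cvgn (series (fun n => Im (u n))).
  apply/normed_cvg/(series_le_cvg (fun=> normr_ge0 _) v0 _ cv) => n /=.
  exact: le_trans (normIm_le _) (uv n).
have h : series (u : nat -> C^o) @ \oo --> ((limn (series (fun n => Re (u n))) +i* limn (series (fun n => Im (u n))))%C : C^o).
  apply/cvg_complexP; split => /=.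
    by under eq_fun do rewrite /series /= cRe_sum; exact: cR.
  by under eq_fun do rewrite /series /= cIm_sum; exact: cI.
by rewrite (cseriesP h).
Qed.

End complex_facts.

Section inner_product.
Context {R : realType}.
Local Notation C := R[i].
Local Notation H := (hardy R).
Local Notation Im := (@complex.Im R).
Implicit Types (f g : H).

Lemma cvg_dot_seq (a b : nat -> C^o) :
  a \in sqsummable (R := R) -> b \in sqsummable (R := R) ->
  cvgn (series (fun n => normc (a n) * normc (b n))).
Proof.
rewrite !inE /= => ca cb.
apply: (@series_le_cvg _ _ (fun n => normc (a n) ^+ 2 + normc (b n) ^+ 2)).
- by move=> n; rewrite mulr_ge0 ?normc_ge0.
- by move=> n; rewrite addr_ge0 ?sqr_ge0.
- move=> n; have := sqr_ge0 (normc (a n) - normc (b n)).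
  have := normc_ge0 (a n); have := normc_ge0 (b n); nra.
- rewrite (_ : series _ = series (fun n => normc (a n) ^+ 2) + series (fun n => normc (b n) ^+ 2)).
    exact: is_cvgD.
  by apply/funext => n; rewrite /series /= !fctE big_split.
Qed.

Lemma cvg_dot f g :
  series (fun n => f n * (g n)^* : C^o) @ \oo --> (hardy_dot f g : C^o).
Proof.
apply: (cvg_cseries_le (v := fun n => normc (f n) * normc (g n))) => [n|].
  by rewrite normcM normc_conj.
exact: cvg_dot_seq (valP f) (valP g).
Qed.

Lemma dotE f g l :
  series (fun n => f n * (g n)^* : C^o) @ \oo --> (l : C^o) -> hardy_dot f g = l.
Proof. exact: cseriesP. Qed.

Lemma hcoef_inj f g : hcoef f =1 hcoef g -> f = g.
Proof. by move=> /funext h; apply: val_inj. Qed.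

Lemma dotPl c f f' g :
  hardy_dot (c *: f + f') g = c * hardy_dot f g + hardy_dot f' g.
Proof.
apply: dotE.
have h1 := @cvg_dot f g; have h2 := @cvg_dot f' g.
have := cvg_complexD (cvg_complexZ (c:=c) h1) h2.
apply: cvg_trans; apply: near_eq_cvg; apply: nearW => n /=.
rewrite /series /= mulr_sumr -big_split /=.
by apply: eq_bigr => i _; rewrite mulrDl -mulrA.
Qed.

Lemma dot_conj f g : hardy_dot g f = (hardy_dot f g)^*.
Proof.
have /cvg_complexP [h1 h2] := @cvg_dot f g.
apply: dotE; apply/cvg_complexP; split.
- rewrite cRe_conj; apply: cvg_trans h1; apply: near_eq_cvg; apply: nearW => n /=.
  rewrite /series /= !cRe_sum; apply: eq_bigr => i _.
  by rewrite !cReM !cRe_conj !cIm_conj; ring.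
- rewrite cIm_conj.
  rewrite (_ : (fun _ => _) = - (fun n => Im (series (fun n0 => f n0 * (g n0)^* : C^o) n))); first exact: cvgN.
  apply/funext => n; rewrite !fctE /series /= !cIm_sum -sumrN; apply: eq_bigr => i _.
  by rewrite !cImM !cRe_conj !cIm_conj; ring.
Qed.

Lemma dotPr c f g g' :
  hardy_dot f (c *: g + g') = c^* * hardy_dot f g + hardy_dot f g'.
Proof.
by rewrite dot_conj dotPl (dot_conj g f) (dot_conj g' f) rmorphD rmorphM.
Qed.

Lemma dot0l g : hardy_dot 0 g = 0.
Proof. by have := dotPl (-1) 0 0 g; rewrite scaler0 addr0 mulN1r addNr. Qed.
Lemma dot0r g : hardy_dot g 0 = 0.
Proof. by rewrite dot_conj dot0l conjC0. Qed.
Lemma dotDl f f' g : hardy_dot (f + f') g = hardy_dot f g + hardy_dot f' g.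
Proof. by rewrite -[f]scale1r dotPl mul1r scale1r. Qed.
Lemma dotDr f g g' : hardy_dot f (g + g') = hardy_dot f g + hardy_dot f g'.
Proof. by rewrite -[g]scale1r dotPr conjC1 mul1r scale1r. Qed.
Lemma dotZl c f g : hardy_dot (c *: f) g = c * hardy_dot f g.
Proof. by rewrite -[c *: f]addr0 dotPl dot0l addr0. Qed.
Lemma dotZr c f g : hardy_dot f (c *: g) = c^* * hardy_dot f g.
Proof. by rewrite -[c *: g]addr0 dotPr dot0r addr0. Qed.

Lemma dot_suml I (r : seq I) (P : pred I) (F : I -> H) g :
  hardy_dot (\sum_(i <- r | P i) F i) g = \sum_(i <- r | P i) hardy_dot (F i) g.
Proof. by elim/big_rec2: _ => [|i x y _ IH]; rewrite ?dot0l // dotDl IH. Qed.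
Lemma dot_sumr I (r : seq I) (P : pred I) (F : I -> H) g :
  hardy_dot g (\sum_(i <- r | P i) F i) = \sum_(i <- r | P i) hardy_dot g (F i).
Proof. by elim/big_rec2: _ => [|i x y _ IH]; rewrite ?dot0r // dotDr IH. Qed.

Lemma dot_eq0 f : (forall g, hardy_dot f g = 0) -> f = 0.
Proof.
move=> /(_ f) ff; apply: sqsum_eq0.
have h := @cvg_dot f f; rewrite ff in h; have [+ _] := (cvg_complexP _ _).1 h.
move=> /(cvg_lim (@Rhausdorff R)) /= E; rewrite -[RHS]E /sqsum; congr (limn _).
apply/funext => n; rewrite /series /= cRe_sum; apply: eq_bigr => i _.
by rewrite normc_sqr cReM cRe_conj cIm_conj mulrN opprK !expr2.
Qed.

Lemma finsupp_sqsummable (a : nat -> C^o) N :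
  (forall n, (N <= n)%N -> a n = 0) -> a \in sqsummable (R := R).
Proof.
move=> aN; apply: (@sqsummable_bounded _ _ (series (fun n => normc (a n) ^+ 2) N)) => n.
have h k : 0 <= normc (a k) ^+ 2 by exact: sqr_ge0.
have [nN|Nn] := leqP n N.
  by apply: nondecreasing_series nN => k _ _; exact: h.
rewrite /series /= (big_cat_nat (n := N)) //=; last exact: ltnW.
rewrite [X in _ + X]big_nat_cond [X in _ + X]big1 ?addr0 // => i /andP[/andP[Ni _] _].
by rewrite aN // normc0 expr0n.
Qed.

Lemma monom_sqsummable n : (fun k => (k == n)%:R : C^o) \in sqsummable (R := R).
Proof.
apply: (@finsupp_sqsummable _ n.+1) => k nk.
by rewrite gtn_eqF.
Qed.

Definition hmonom n : H := Hardy (monom_sqsummable n).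

Lemma dot_monom f n : hardy_dot f (hmonom n) = f n.
Proof.
apply: dotE; apply: cvg_near_cst; exists n.+1 => // m /= nm.
rewrite /series /= (bigD1_seq n) ?mem_index_iota ?iota_uniq //=.
rewrite eqxx conjC1 mulr1 big1 ?addr0 // => i /negPf ->.
by rewrite conjC0 mulr0.
Qed.

End inner_product.

(** * Spans and root subspaces of a linear map *)

Section spans.
Context {K : pzRingType} {V : lmodType K}.
Implicit Types (S : set V) (P : set V).

Definition lin_closed P := P 0 /\ forall a x y, P x -> P y -> P (a *: x + y).

Lemma lin_closedD P x y : lin_closed P -> P x -> P y -> P (x + y).
Proof. by move=> [_ h] Px Py; rewrite -[x]scale1r; exact: h. Qed.
Lemma lin_closedZ P a x : lin_closed P -> P x -> P (a *: x).
Proof. by move=> [h0 h] Px; rewrite -[_ *: _]addr0; exact: h. Qed.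
Lemma lin_closedB P x y : lin_closed P -> P x -> P y -> P (x - y).
Proof. by move=> sP Px Py; apply: lin_closedD => //; rewrite -scaleN1r; exact: lin_closedZ. Qed.
Lemma lin_closed_sum P I (r : seq I) (Q : pred I) (F : I -> V) :
  lin_closed P -> (forall i, Q i -> P (F i)) -> P (\sum_(i <- r | Q i) F i).
Proof.
move=> sP h; elim/big_ind: _ => //; first by case: sP.
by move=> x y; exact: lin_closedD.
Qed.

Lemma span_lin_closed S : lin_closed (linear_span S).
Proof.
split=> [|a x y].
  by exists 0%N, (fun=> 0), (fun=> 0); split=> [[]//|]; rewrite big_ord0.
move=> [m [c [u [Su ->]]]] [m' [c' [u' [Su' ->]]]].
exists (m + m')%N, (fun i : 'I_(m + m') => match fintype.split i with inl j => a * c j | inr j => c' j end),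
  (fun i : 'I_(m + m') => match fintype.split i with inl j => u j | inr j => u' j end).
split=> [i|]; first by case: (fintype.split i).
rewrite big_split_ord /= scaler_sumr; congr (_ + _); apply: eq_bigr => i _.
  by rewrite (unsplitK (inl i)) scalerA.
by rewrite (unsplitK (inr i)).
Qed.

Lemma mem_linear_span S : S `<=` linear_span S.
Proof.
move=> v Sv; exists 1%N, (fun=> 1), (fun=> v); split=> //.
by rewrite big_ord1 scale1r.
Qed.

Lemma span_sub S P : lin_closed P -> S `<=` P -> linear_span S `<=` P.
Proof.
move=> sP SP _ [m [c [u [Su ->]]]]; apply: lin_closed_sum => // i _.
by apply: lin_closedZ => //; exact: SP.
Qed.

Lemma span_mono S S' : S `<=` linear_span S' -> linear_span S `<=` linear_span S'.
Proof. exact: span_sub (span_lin_closed _). Qed.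

Lemma spanP d (u : 'I_d -> V) v :
  linear_span (range u) v <-> exists c, v = \sum_i c i *: u i.
Proof.
split; last first.
  move=> [c ->]; apply: lin_closed_sum => [|i _]; first exact: span_lin_closed.
  by apply: lin_closedZ (span_lin_closed _) _; apply: mem_linear_span; exists i.
move: v; apply: (@span_sub _ [set v | exists c, v = \sum_i c i *: u i]).
  split=> [|a _ _ [c ->] [c' ->]] /=.
    by exists (fun=> 0); rewrite big1 // => i _; rewrite scale0r.
  exists (fun i => a * c i + c' i).
  by rewrite scaler_sumr -big_split /=; apply: eq_bigr => i _; rewrite scalerDl scalerA.
move=> _ [i _ <-] /=; exists (fun j => (j == i)%:R).
rewrite (bigD1 i) //= eqxx scale1r big1 ?addr0 // => j /negPf ->.
by rewrite scale0r.
Qed.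

End spans.

Section jordan.
Context {K : numClosedFieldType} {V : lmodType K} (T : {linear V -> V}).
Context (A : set K) (e : K -> nat -> V).
Hypothesis eig1 : forall c x y, T x = c *: x -> T y = c *: y -> x <> 0 ->
  exists a, y = a *: x.
Hypothesis e0 : forall c, A c -> e c 0 <> 0.
Hypothesis eT : forall c k, A c -> T (e c k) = c *: e c k + k%:R *: e c k.-1.

Definition chains (L : set K) (n : K -> nat) : set V :=
  \bigcup_(l in L) [set e l k | k in [set k | (k <= n l)%N]].

(** On the chain of [l], the map [T - c] is triangular with the nonzero diagonal entry [l - c], so
    the equation is solved by recursion along the chain, without leaving its first [k + 1]
    members. *)
Lemma chains_surj c l k : A l -> l != c ->
  exists2 v, linear_span [set e l j | j in [set j | (j <= k)%N]] v & T v - c *: v = e l k.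
Proof.
move=> Al lc; have lc0 : l - c != 0 by rewrite subr_eq0.
elim: k => [|k [v sv Tv]].
  exists ((l - c)^-1 *: e l 0%N).
    by apply: lin_closedZ (span_lin_closed _) _; apply: mem_linear_span; exists 0%N.
  rewrite linearZ /= eT // scale0r addr0 !scalerA -scalerBl.
  by rewrite [c / _]mulrC -mulrBr mulVf // scale1r.
exists ((l - c)^-1 *: (e l k.+1 - k.+1%:R *: v)).
  apply: lin_closedZ (span_lin_closed _) _; apply: lin_closedB (span_lin_closed _) _ _.
    by apply: mem_linear_span; exists k.+1 => /=.
  apply: lin_closedZ (span_lin_closed _) _; move: sv; apply: span_mono => _ [j /= jk <-].
  by apply: mem_linear_span; exists j => //=; exact: leqW.
rewrite linearZ /= scalerA mulrC -scalerA -scalerBr.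
rewrite [X in _ *: X](_ : _ = (l - c) *: e l k.+1); first by rewrite scalerA mulVf // scale1r.
rewrite linearB linearZ /= eT //= -[T v](subrK (c *: v)) Tv !scalerDr scalerN !scalerA.
by rewrite [c * _]mulrC opprD addrA addrK opprB addrA subrK scalerBl.
Qed.

Lemma chains_up c k : A c -> T (e c k.+1) - c *: e c k.+1 = k.+1%:R *: e c k.
Proof. by move=> Ac; rewrite eT //= addrC addKr. Qed.

(** Induction on the number of generators. An eigenvector [x] for [c] is found in the span; [T - c]
    kills it, so the image of the span under [T - c] has one generator fewer and is a span of chains
    by induction. The span is then recovered as a preimage under [T - c]: images of chains lift to
    chains, and lifts are unique up to the kernel, which is at once the line of [x] and the line of
    [e c 0]. *)
Lemma jordan d (u : 'I_d -> V) :
  (forall i, linear_span (range u) (T (u i))) ->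
  (forall c x, linear_span (range u) x -> x <> 0 -> T x = c *: x -> A c) ->
  exists L n, [/\ finite_set L, L `<=` A & linear_span (range u) = linear_span (chains L n)].
Proof.
elim: d u => [|d IH] u uT uA.
  exists set0, (fun=> 0%N); split => //; apply/seteqP; split; apply: span_mono.
    by move=> y [j]; case: j.
  by move=> x [].
have /choice[B TB] : forall i, exists b, T (u i) = \sum_j b j *: u j.
  by move=> i; exact/spanP.
(* A left eigenvector, because the coordinates of [T x] are the row of coordinates of [x] times the
   matrix; it exists as the field is closed and the matrix is not empty. *)
have [c [v vB v0]] : exists c, exists2 v : 'rV[K]_d.+1, v *m (\matrix_(i, j) B i j) = c *: v & v != 0.
  have /closed_rootP[c] : size (char_poly (\matrix_(i, j) B i j)) != 1%N.
    by rewrite size_char_poly.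
  by rewrite -eigenvalue_root_char => /eigenvalueP h; exists c.
pose x := \sum_i v 0 i *: u i.
have Nx : linear_span (range u) x by apply/spanP; exists (v 0).
have Tx : T x = c *: x.
  rewrite linear_sum /=.
  under eq_bigr do rewrite linearZ /= TB scaler_sumr.
  rewrite exchange_big /= scaler_sumr; apply: eq_bigr => j _.
  under eq_bigr do rewrite scalerA.
  rewrite -scaler_suml scalerA; congr (_ *: _).
  move/rowP/(_ j): vB; rewrite !mxE => <-.
  by apply: eq_bigr => i _; rewrite mxE.
have [i0 vi0] : exists i, v 0 i != 0.
  apply/existsP; apply: contra_neqT v0 => /existsPn h; apply/rowP => i.
  by have := h i; rewrite negbK mxE => /eqP.
(* Since [v 0 i0] is nonzero, [u i0] can be exchanged for [x] among the generators. *)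
have ux : u i0 = (v 0 i0)^-1 *: x - \sum_j ((v 0 i0)^-1 * v 0 (lift i0 j)) *: u (lift i0 j).
  rewrite /x (bigD1_ord i0) //= scalerDr scalerA mulVf // scale1r scaler_sumr.
  by under [X in _ = _ + X - _]eq_bigr do rewrite scalerA; rewrite addrK.
have subu : linear_span (range (u \o lift i0)) `<=` linear_span (range u).
  by apply: span_mono => _ [j _ <-]; apply: mem_linear_span; exists (lift i0 j).
have decomp z : linear_span (range u) z ->
    exists a, linear_span (range (u \o lift i0)) (z - a *: x).
  move: z; apply: (@span_sub _ _ _ [set z | exists a, linear_span (range (u \o lift i0)) (z - a *: x)]).
    split=> [|b y z [a ya] [a' za']] /=.
      by exists 0; rewrite scale0r subr0; case: (span_lin_closed (range (u \o lift i0))).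
    exists (b * a + a'); rewrite scalerDl -scalerA opprD addrACA -scalerBr.
    by case: (span_lin_closed (range (u \o lift i0))) => _; apply.
  move=> _ [i _ <-] /=; case: (unliftP i0 i) => [j ->|->].
    by exists 0; rewrite scale0r subr0; apply: mem_linear_span; exists j.
  exists (v 0 i0)^-1; rewrite ux addrC addKr -scaleN1r.
  apply: lin_closedZ (span_lin_closed _) _; apply: lin_closed_sum (span_lin_closed _) _ => j _.
  by apply: lin_closedZ (span_lin_closed _) _; apply: mem_linear_span; exists j.
(* The generators may be dependent and give [x = 0]; then [u i0] is redundant and the induction
   hypothesis applies directly. *)
have [x0|/eqP x0] := eqVneq x 0.
  have E : linear_span (range u) = linear_span (range (u \o lift i0)).
    by apply/seteqP; split=> // z /decomp[a]; rewrite x0 scaler0 subr0.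
  rewrite E; apply: IH => [i /=|a y]; first by rewrite -E.
  by rewrite -E; exact: uA.
have Ac : A c by exact: uA Nx x0 Tx.
have Te0 : T (e c 0%N) = c *: e c 0%N by rewrite eT // scale0r addr0.
have kerx y : T y = c *: y -> exists a, y = a *: x by move=> Ty; exact: (eig1 Tx Ty).
have kere y : T y = c *: y -> exists a, y = a *: e c 0%N.
  by move=> Ty; exact: (eig1 Te0 Ty (e0 Ac)).
have diffker y z : T z - c *: z = T y - c *: y -> T (z - y) = c *: (z - y).
  move=> h; rewrite linearB scalerBr -[T z](subrK (c *: z)) h.
  by rewrite addrAC [T y - _]addrC addrK addrC.
(* As [x] is killed, these [d] vectors generate the whole image of the span under [T - c]. *)
pose u' j := T (u (lift i0 j)) - c *: u (lift i0 j).
have NT z : linear_span (range u) z -> linear_span (range u) (T z).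
  move: z; apply: (@span_sub _ _ _ [set z | linear_span (range u) (T z)]).
    split=> [|b y z] /=; first by rewrite linear0; case: (span_lin_closed (range u)).
    by rewrite linearP => ? ?; case: (span_lin_closed (range u)) => _; apply.
  by move=> _ [i _ <-] /=; exact: uT.
have u'1 z : linear_span (range u) z -> linear_span (range u') (T z - c *: z).
  move=> /decomp[a]; rewrite -{2 3}[z](subrK (a *: x)); move: (z - _) => y Ny.
  rewrite linearD linearZ /= Tx scalerDr !scalerA [a * c]mulrC opprD addrACA subrr addr0.
  move: y Ny; apply: (@span_sub _ _ _ [set z | linear_span (range u') (T z - c *: z)]).
    split=> [|b y y'] /=; first by rewrite linear0 scaler0 subr0; case: (span_lin_closed (range u')).
    move=> h1 h2; rewrite linearP scalerDr opprD addrACA scalerA mulrC -scalerA -scalerBr.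
    by case: (span_lin_closed (range u')) => _; apply.
  by move=> _ [j _ <-] /=; apply: mem_linear_span; exists j.
have u'2 w : linear_span (range u') w -> exists2 z, linear_span (range u) z & w = T z - c *: z.
  move=> /spanP[a ->]; exists (\sum_j a j *: u (lift i0 j)).
    by apply: subu; apply/spanP; exists a.
  rewrite linear_sum scaler_sumr -sumrB; apply: eq_bigr => j _.
  by rewrite linearZ /= scalerBr !scalerA mulrC.
have [L [n [fL LA E]]] : exists L n, [/\ finite_set L, L `<=` A &
    linear_span (range u') = linear_span (chains L n)].
  apply: IH => [j|b y].
    rewrite /u' linearB linearZ /=; apply: u'1; exact: uT.
  move=> /u'2[z Nz ->]; apply: uA.
  apply: lin_closedB (span_lin_closed _) (NT _ Nz) _.
  exact: lin_closedZ (span_lin_closed _) Nz.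
(* Taking preimages under [T - c] lengthens the chain at [c] by one. If [c] was absent from [L],
   only the kernel vector [e c 0] is added, hence the index 0. *)
pose n' l := if l == c then (if c \in L then (n c).+1 else 0%N) else n l.
exists (c |` L), n'; split.
- by rewrite finite_setU; split.
- by move=> y [->|/LA].
have Ne0 : linear_span (chains (c |` L) n') (e c 0%N).
  by apply: mem_linear_span; exists c; [left|exists 0%N].
apply/seteqP; split=> z.
  move=> Nz; have := u'1 _ Nz; rewrite E => h.
  have [y Ny Ty] : exists2 y, linear_span (chains (c |` L) n') y & T z - c *: z = T y - c *: y.
    move: h; move: (T z - _) => w; move: w.
    apply: (@span_sub _ _ _ [set w | exists2 y, linear_span (chains (c |` L) n') y & w = T y - c *: y]).
      split=> [|b w w' [y Ny ->] [y' Ny' ->]] /=.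
        exists 0; first by case: (span_lin_closed (chains (c |` L) n')).
        by rewrite linear0 scaler0 subr0.
      exists (b *: y + y'); first by case: (span_lin_closed (chains (c |` L) n')) => _; apply.
      by rewrite linearP [c *: (_ + _)]scalerDr opprD addrACA scalerA [c * b]mulrC -scalerA -scalerBr.
    move=> _ [l Ll [k /= kn <-]]; have [lc|lc] := eqVneq l c.
      rewrite lc in Ll kn *; exists (k.+1%:R^-1 *: e c k.+1).
        apply: lin_closedZ (span_lin_closed _) _; apply: mem_linear_span; exists c; first by left.
        by exists k.+1 => //=; rewrite /n' eqxx mem_set.
      rewrite linearZ /= scalerA mulrC -scalerA -scalerBr chains_up // scalerA mulVf ?scale1r //.
    have [y sy <-] := @chains_surj c l k (LA _ Ll) lc; exists y => //.
    move: sy; apply: span_mono => _ [j /= jk <-]; apply: mem_linear_span; exists l; first by right.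
    by exists j => //=; rewrite /n' (negPf lc) (leq_trans jk).
  have [a za] : exists a, z - y = a *: e c 0%N.
    exact/kere/diffker.
  by rewrite -[z](subrK y) za; apply: lin_closedD (span_lin_closed _) _ Ny; exact: lin_closedZ (span_lin_closed _) _.
move: z; apply: span_sub (span_lin_closed _) _ => _ [l Ll [k /= kn <-]].
(* [T - c] maps the new chains into the old ones: at [c] it lowers the index by one, elsewhere it
   stays in the initial segment. The vector [e l k.-1] is harmless at [k = 0], where its coefficient
   vanishes. *)
have : linear_span (range u') (T (e l k) - c *: e l k).
  rewrite E; move: Ll kn; rewrite /n'; have [-> _|lc [/eqP|Ll kn]] := eqVneq l c; last first.
  - rewrite (eT _ (LA _ Ll)) addrAC -scalerBl; apply: lin_closedD (span_lin_closed _) _ _;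
      apply: lin_closedZ (span_lin_closed _) _; apply: mem_linear_span; exists l => //; [by exists k|exists k.-1 => //=].
    exact: leq_trans (leq_pred _) kn.
  - by move=> lc'; rewrite lc' in lc.
  case: k => [_|k].
    by rewrite Te0 subrr; case: (span_lin_closed (chains L n)).
  case: ifPn => // cL; rewrite ltnS => kn; rewrite chains_up //.
  apply: lin_closedZ (span_lin_closed _) _; apply: mem_linear_span; exists c; first exact: set_mem.
  by exists k.
move=> /u'2[z Nz Tz].
have [a ea] : exists a, e l k - z = a *: x.
  exact/kerx/diffker.
rewrite -[e l k](subrK z) ea; apply: lin_closedD (span_lin_closed _) _ Nz.
exact: lin_closedZ (span_lin_closed _) Nx.
Qed.

End jordan.

(** [P] embeds [S] in a space of dimension [d], which bounds the size of families with independent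
    images. A family of maximal size spans: if [P x] were outside the row space, adjoining [x] would
    give a larger one. *)
Lemma subspace_basis (K : fieldType) (V : lmodType K) d (P : V -> 'rV[K]_d) (S : set V) :
  (forall a x y, P (a *: x + y) = a *: P x + P y) -> lin_closed S ->
  (forall x, S x -> P x = 0 -> x = 0) ->
  exists r (u : 'I_r -> V), [/\ row_free (\matrix_i P (u i)), forall i, S (u i) &
    S = linear_span (range u)].
Proof.
move=> Plin sS Pinj.
have P0 : P 0 = 0 by have := Plin (-1) 0 0; rewrite scaler0 addr0 scaleN1r addNr.
have Psum r (c : 'I_r -> K) (w : 'I_r -> V) : P (\sum_i c i *: w i) = \sum_i c i *: P (w i).
  elim/big_rec2: _ => [|i y1 y2 _ E]; first exact: P0.
  by rewrite Plin E.
pose Q r := `[< exists u : 'I_r -> V, row_free (\matrix_i P (u i)) /\ forall i, S (u i) >].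
have Q0 : exists r, Q r.
  exists 0%N; apply/asboolP; exists (fun=> 0); split; last by case.
  by apply: inj_row_free => v _; apply/rowP => -[].
have Qd r : Q r -> (r <= d)%N.
  by move=> /asboolP[u [+ _]]; rewrite /row_free => /eqP <-; exact: rank_leq_col.
have [r /asboolP[u [ufree Su]] rmax] := ex_maxnP Q0 Qd.
exists r, u; split=> //; apply/seteqP; split; last first.
  by apply: (span_sub sS) => y [j _ <-].
move=> x Sx; set A := \matrix_i P (u i).
have [/submxP[D PD]|xA] := boolP (P x <= A)%MS.
  apply/spanP; exists (D 0); apply/eqP; rewrite -subr_eq0; apply/eqP; apply: Pinj.
    apply: (lin_closedB sS) => //; apply: (@lin_closed_sum K V S) => // j _.
    exact: lin_closedZ.
  rewrite -scaleN1r addrC Plin Psum PD mulmx_sum_row scaleN1r addrC.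
  by apply/eqP; rewrite subr_eq0; apply/eqP; apply: eq_bigr => j _; rewrite rowK.
have : Q (1 + r)%N.
  apply/asboolP; exists (fun i : 'I_(1 + r) => match fintype.split i with inl _ => x | inr j => u j end).
  split; last by move=> j; case: splitP.
  rewrite [X in row_free X](_ : _ = col_mx (P x) A); last first.
    apply/row_matrixP => i; rewrite rowK.
    case: splitP => j ij.
      have -> : i = lshift r j by exact: val_inj.
      by rewrite rowKu row_id.
    have -> : i = rshift 1 j by exact: val_inj.
    by rewrite rowKd rowK.
  apply: inj_row_free => v; rewrite -[v]hsubmxK mul_row_col => E.
  have [l0|l0] := eqVneq (lsubmx v) 0; last first.
    case/negP: xA; apply/submxP; exists (- ((lsubmx v) 0 0)^-1 *: rsubmx v).
    have l00 : lsubmx v 0 0 != 0.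
      by apply: contra_neq l0 => h; apply/rowP => j; rewrite ord1 h mxE.
    move/eqP: E; rewrite addr_eq0 => /eqP E.
    rewrite -scalemxAl scaleNr -scalerN -E [lsubmx v]mx11_scalar mul_scalar_mx scalerA.
    by rewrite mxE eqxx mulr1n mulVf // scale1r.
  rewrite l0 mul0mx add0r in E.
  have -> : rsubmx v = 0 by apply: (row_free_inj ufree); rewrite E mul0mx.
  by rewrite l0 row_mx0.
by move/rmax; rewrite add1n ltnn.
Qed.

(** * The adjoint of the Cesaro operator *)

Section difference_operator.
Context {R : realType}.
Local Notation C := R[i].
Local Notation H := (hardy R).
Implicit Types (a b : nat -> C^o) (f g : H).

(* In coordinates, the inverse of the adjoint of the Cesaro operator. *)
Definition Dop a : nat -> C^o := fun n => n.+1%:R * (a n - a n.+1).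

Lemma Dop_linear : linear Dop.
Proof.
move=> c a b; apply/funext => n; rewrite /Dop !fctE /GRing.scale /=; ring.
Qed.

HB.instance Definition _ := GRing.isLinear.Build C _ _ _ Dop Dop_linear.

(** The eigenvalue equation is the recurrence a_(n+1) = a_n (1 - c / (n+1)), so an eigenvector is
    determined by its term of index 0, which is nonzero unless the sequence is zero. *)
Lemma Dop_eig1 (c : C) a b : Dop a = c *: a -> Dop b = c *: b -> a <> 0 ->
  exists x : C, b = x *: a.
Proof.
have rec (a' : nat -> C^o) : Dop a' = c *: a' -> forall n, a' n.+1 = a' n * (1 - c / n.+1%:R).
  move=> /funeqP E n; have := E n; rewrite /Dop /= !fctE /GRing.scale /= => h.
  have n0 : n.+1%:R != 0 :> C by rewrite pnatr_eq0.
  apply: (mulfI n0); rewrite mulrBr in h.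
  rewrite mulrCA mulrBr mulr1 mulrCA mulfV // mulr1 mulrBr [a' n * n.+1%:R]mulrC [a' n * c]mulrC -h.
  by rewrite opprB addrC subrK.
move=> /rec Da /rec Db a0.
have a00 : a 0%N != 0.
  apply: contra_notN a0 => /eqP h; apply/funext => n; elim: n => [|n IH]; rewrite ?h // Da IH.
  by rewrite mul0r.
exists (b 0%N / a 0%N); apply/funext => n; rewrite /= !fctE /GRing.scale /=.
elim: n => [|n IH]; first by rewrite divfK.
by rewrite Da Db IH mulrA.
Qed.

Lemma hcoefDE f g n : (f + g) n = f n + g n :> C. Proof. by []. Qed.
Lemma hcoefZE (c : C) f n : (c *: f) n = c * f n :> C. Proof. by []. Qed.
Lemma hcoefBE f g n : (f - g) n = f n - g n :> C. Proof. by []. Qed.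

Lemma cesaro_opE f n : cesaro_op f n = (\sum_(k < n.+1) f k) / n.+1%:R :> C.
Proof. exact: cesaro_coefE. Qed.

Lemma cesaro_linear (c : C) f g :
  cesaro_op (c *: f + g) = c *: cesaro_op f + cesaro_op g.
Proof.
apply: hcoef_inj => n; rewrite hcoefDE hcoefZE !cesaro_opE.
under eq_bigr do rewrite hcoefDE hcoefZE.
by rewrite big_split /= -mulr_sumr mulrDl mulrA.
Qed.

Lemma cesaro_sum d (c : 'I_d -> C) (h : 'I_d -> H) :
  cesaro_op (\sum_i c i *: h i) = \sum_i c i *: cesaro_op (h i).
Proof.
elim/big_rec2: _ => [|i y1 y2 _ <-]; last by rewrite cesaro_linear.
have := cesaro_linear (-1) 0 0.
by rewrite scaler0 addr0 scaleN1r addNr.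
Qed.

(** Paired with u, this says that the coordinates w of the adjoint of the Cesaro operator at u
    satisfy w_n - w_(n+1) = u_n / (n+1), that is, [Dop] sends w back to u. *)
Lemma cesaro_monomB n :
  cesaro_op (hmonom n - hmonom n.+1) = (n.+1%:R^-1 : C) *: hmonom n.
Proof.
apply: hcoef_inj => k; rewrite hcoefZE cesaro_opE.
have E j : (hmonom n - hmonom n.+1 : H) j = (j == n)%:R - (j == n.+1)%:R :> C by [].
rewrite (eq_bigr _ (fun (j : 'I_k.+1) _ => E j)) /=.
rewrite sumrB.
have S m : \sum_(i < k.+1) ((nat_of_ord i == m)%:R : C) = (m <= k)%:R.
  have [mk|km] := leqP m k.
    rewrite (bigD1 (inord m)) //= inordK // eqxx big1 ?addr0 // => j.
    move=> jm; have [jE|//] := eqVneq (nat_of_ord j) m.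
    by case/eqP: jm; apply: val_inj; rewrite /= inordK -?jE.
  by rewrite big1 // => j _; case: eqP => // jm; move: (ltn_ord j); rewrite jm ltnS leqNgt km.
rewrite !S; have [->|kn] := eqVneq k n.
  by rewrite leqnn ltnn subr0 mul1r mulr1.
by rewrite ltn_neqAle eq_sym kn /= subrr mul0r mulr0.
Qed.

(** Summation by parts leaves the boundary term [P m * v m], which converges to the difference [L]
    of the two sides. As P_(n+1) is (n+1) times the n-th coefficient of [cesaro_op f], a nonzero [L]
    would bound 1 / (n+1) by a multiple of the products |(Cf)_n| |g_(n+1)|. These are summable,
    against the divergence of the harmonic series. *)
Lemma dot_cesaro_Dop f g h : hcoef h = Dop g ->
  hardy_dot (cesaro_op f) h = hardy_dot f g.
Proof.
move=> hD; pose v n := (g n)^*; pose P m := \sum_(k < m) f k.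
have abel m : series (fun n => cesaro_op f n * (h n)^* : C^o) m =
    series (fun n => f n * (g n)^* : C^o) m - P m * v m.
  elim: m => [|m IH]; first by rewrite /series /= !big_geq // /P big_ord0 mul0r subr0.
  rewrite [LHS]seriesSr [X in X - _]seriesSr IH hD /Dop /= cesaro_coefE.
  rewrite rmorphM rmorphB /= conjC_nat -/(v m) -/(v m.+1) -/(P m.+1).
  rewrite [P m.+1 / _ * _]mulrA divfK ?pnatr_eq0 //.
  rewrite /P big_ord_recr /=; ring.
set L := hardy_dot f g - hardy_dot (cesaro_op f) h.
suff L0 : L = 0 by apply/esym/eqP; rewrite -subr_eq0 -/L L0.
have cL : (fun m => P m * v m) @ \oo --> (L : C^o).
  have := cvg_complexD (@cvg_dot _ f g) (cvg_complexZ (c:=-1) (@cvg_dot _ (cesaro_op f) h)).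
  rewrite mulN1r; apply: cvg_trans; apply: near_eq_cvg; apply: nearW => m.
  by rewrite abel mulN1r opprB addrC subrK.
apply/eqP/negPn/negP => L0; pose l := normc L / 2.
have l0 : 0 < l.
  rewrite divr_gt0 // lt_def normc_ge0 andbT.
  by apply: contra_neq L0; exact: eq0_normc.
have [m0 _ hm0] : \forall m \near \oo, l <= normc (P m * v m).
  have /cvgrPdist_lt/(_ l%:C%C) := cL; rewrite ltcR => /(_ l0).
  apply: filterS => m; rewrite normr_normc ltcR => h1.
  have := le_normcD (L - P m * v m) (P m * v m); rewrite subrK.
  move: h1; rewrite /l; lra.
pose t k := normc (cesaro_op f k) * normc (g k.+1).
have ct : cvgn (series t).
  have sv : (fun k => g k.+1) \in sqsummable (R := R).
    apply: (@sqsummable_bounded _ _ (sqsum g)) => n.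
    apply: le_trans (series_le_sqsum n.+1 (valP g)).
    by rewrite /series /= big_nat_recl //= lerDr sqr_ge0.
  exact: cvg_dot_seq (valP (cesaro_op f)) sv.
(* The lower bound on the boundary term holds only from [m0] on; this finite indicator dominates the
   earlier harmonic terms, each at most 1. *)
have ci : cvgn (series (fun k => (k < m0)%:R : R)).
  apply/cvg_ex; exists (series (fun k => (k < m0)%:R : R) m0).
  apply: cvg_near_cst; exists m0 => // n /= mn.
  rewrite /series /= (big_cat_nat (n := m0)) //= [X in _ + X]big_nat_cond [X in _ + X]big1 ?addr0 //.
  by move=> i /andP[/andP[mi _] _]; rewrite ltnNge mi.
have ctz : cvgn (series (l^-1 *: t)).
  by rewrite seriesZ; exact: is_cvgZl_tmp.
apply: (@dvg_harmonic R).
apply: (@series_le_cvg _ _ (fun k => l^-1 * t k + (k < m0)%:R)).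
- by move=> n; rewrite invr_ge0.
- by move=> n; rewrite addr_ge0 // !mulr_ge0 ?normc_ge0 // invr_ge0 ltW.
- move=> n; rewrite /harmonic /=; have [nm|mn] := ltnP n m0.
    rewrite -[leLHS]add0r lerD //; first by rewrite !mulr_ge0 ?normc_ge0 // invr_ge0 ltW.
    by rewrite invf_le1 // ler1n.
  rewrite addr0; have h1 : l <= n.+1%:R * t n.
    apply: le_trans (hm0 n.+1 (leqW mn)) _.
    have -> : P n.+1 = n.+1%:R * cesaro_op f n :> C.
      by rewrite cesaro_opE mulrC divfK // pnatr_eq0.
    have -> : n.+1%:R = (n.+1%:R : R)%:C%C by rewrite rmorph_nat.
    by rewrite 2!normcM normcR normc_conj ger0_norm // -mulrA.
  by rewrite -(ler_pM2l l0) mulrA mulfV ?gt_eqF // mul1r ler_pdivrMr // mulrC.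
- rewrite (_ : series _ = series (l^-1 *: t) + series (fun k => (k < m0)%:R : R)); first exact: is_cvgD.
  by apply/funext => n; rewrite /series /= !fctE big_split.
Qed.

End difference_operator.

(** * Closed subspaces of finite codimension *)

Section closed_subspaces.
Context {R : realType}.
Local Notation C := R[i].
Local Notation H := (hardy R).
Local Notation Re := (@complex.Re R).
Local Notation Im := (@complex.Im R).
Implicit Types (f g : H) (K : set H).

Definition hnorm f : R := Num.sqrt (sqsum f).

Lemma hnormE f : `|f| = (hnorm f)%:C%C. Proof. by []. Qed.
Lemma hnorm_ge0 f : 0 <= hnorm f. Proof. exact: sqrtr_ge0. Qed.
Lemma hnormD f g : hnorm (f + g) <= hnorm f + hnorm g.
Proof. by rewrite -lecR rmorphD; exact: hardy_normD. Qed.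
Lemma hnormZ c f : hnorm (c *: f) = normc c * hnorm f.
Proof. by apply: complexI; rewrite rmorphM; exact: hardy_normZ. Qed.
Lemma hnormN f : hnorm (- f) = hnorm f.
Proof. by rewrite -scaleN1r hnormZ normcN normc1 mul1r. Qed.

(** Positive distance from [f] to [K]: the quantitative form of lying outside a closed set, whose
    constant yields bounds on linear functionals. *)
Definition far K f := exists2 d : R, 0 < d & forall k, K k -> d <= hnorm (f - k).

Lemma closed_far K f : closed K -> ~ K f -> far K f.
Proof.
move=> /closed_openC oK nKf.
have /nbhs_ballP[e e0 he] : nbhs f (~` K) by exact: open_nbhs_nbhs.
have eR : e = (Re e)%:C%C by rewrite RRe_real // gtr0_real.
exists (Re e); first by rewrite -ltcR -eR.
move=> k Kk; rewrite leNgt; apply/negP => h; apply: (he k) => //.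
by rewrite -ball_normE /ball_ /= hnormE eR ltcR.
Qed.

(** Rescaling by [c] shows that the coordinate along [g] is a bounded functional on [K] plus the
    line of [g], with bound [1 / d]. *)
Lemma dist_line K g (d : R) : lin_closed K -> (forall k, K k -> d <= hnorm (g - k)) ->
  forall k c, K k -> normc c * d <= hnorm (k + c *: g).
Proof.
move=> sK dg k c Kk; have [->|c0] := eqVneq c 0.
  by rewrite normc0 mul0r hnorm_ge0.
have -> : k + c *: g = c *: (g - (- c^-1) *: k).
  by rewrite scaleNr opprK scalerDr scalerA mulfV // scale1r addrC.
rewrite hnormZ ler_wpM2l ?normc_ge0 //; apply: dg; exact: lin_closedZ.
Qed.

(** Every [r n - A / (n+1)] lies below every [r k + A / (k+1)], so the supremum of the former is a
    limit with an explicit rate. *)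
Lemma slow_cauchy (r : nat -> R) (A : R) :
  (forall n k, `|r n - r k| <= A * (n.+1%:R^-1 + k.+1%:R^-1)) ->
  exists l, forall n, `|r n - l| <= A * n.+1%:R^-1.
Proof.
move=> h; pose E := [set r n - A * n.+1%:R^-1 | n in [set: nat]].
have ub k : ubound E (r k + A * k.+1%:R^-1).
  move=> _ [n _ <-]; have := h n k; rewrite ler_norml mulrDr => /andP[_].
  by move: (A * n.+1%:R^-1) (A * k.+1%:R^-1) => x y; lra.
have hE : has_sup E.
  by split; [exists (r 0%N - A * 1%:R^-1); exists 0%N|exists (r 0%N + A * 1%:R^-1); exact: ub].
exists (sup E) => n.
have h1 : r n - A * n.+1%:R^-1 <= sup E by apply: sup_upper_bound => //; exists n.
have h2 : sup E <= r n + A * n.+1%:R^-1 by apply: ge_sup; [case: hE|exact: ub].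
move: h1 h2; rewrite ler_norml; move: (A * n.+1%:R^-1) => x; lra.
Qed.

Definition addline K g : set H := [set f | exists c, K (f - c *: g)].

Lemma addline_lin_closed K g : lin_closed K -> lin_closed (addline K g).
Proof.
move=> sK; split; first by exists 0; rewrite scale0r subr0; case: sK.
move=> a x y [c Kx] [c' Ky]; exists (a * c + c').
rewrite scalerDl -scalerA opprD addrACA -scalerBr.
by case: sK => _; apply.
Qed.

Lemma sub_addline K g f : K f -> addline K g f.
Proof. by exists 0; rewrite scale0r subr0. Qed.

Lemma addline_mem K g : lin_closed K -> addline K g g.
Proof. by move=> [K0 _]; exists 1; rewrite scale1r subrr. Qed.

(** A closed subspace stays closed when a line is added. If [f] were not far, it would be
    approximated within 1 / (n+1) by elements k_n + c_n g. By [dist_line] the c_n are Cauchy; with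
    limit c, the vectors k_n approach [f - c *: g], which is outside [K] and hence far from it. *)
Lemma addline_far K g f : lin_closed K -> (forall f, ~ K f -> far K f) ->
  ~ addline K g f -> far (addline K g) f.
Proof.
move=> sK fK nf; have [Kg|nKg] := pselect (K g).
  have E : addline K g = K.
    apply/seteqP; split=> [x [c Kx]|]; last exact: sub_addline.
    rewrite -[x](subrK (c *: g)); apply: lin_closedD => //; exact: lin_closedZ.
  by rewrite E in nf *; exact: fK.
have [d d0 dg] := fK _ nKg; apply: contrapT => nfar.
have approx (n : nat) : exists kc : H * C, K kc.1 /\ hnorm (f - (kc.1 + kc.2 *: g)) <= n.+1%:R^-1.
  apply: contrapT => h; apply: nfar; exists n.+1%:R^-1; first by rewrite invr_gt0.
  move=> x [c Kx]; apply: ltW; rewrite ltNge; apply/negP => hx; apply: h.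
  by exists (x - c *: g, c); rewrite /= subrK.
have [kc hkc] := choice approx.
have cauchy n m : normc ((kc n).2 - (kc m).2) <= d^-1 * (n.+1%:R^-1 + m.+1%:R^-1).
  rewrite -(ler_pM2l d0) mulrA mulfV ?gt_eqF // mul1r mulrC.
  have [Kn hn] := hkc n; have [Km hm] := hkc m.
  apply: le_trans (dist_line sK dg ((kc n).2 - (kc m).2) (lin_closedB sK Kn Km)) _.
  apply: le_trans (_ : hnorm (- (f - ((kc n).1 + (kc n).2 *: g)) + (f - ((kc m).1 + (kc m).2 *: g))) <= _).
    move: ((kc n).1) ((kc n).2) ((kc m).1) ((kc m).2) => k1 c1 k2 c2.
    have -> : k1 - k2 + (c1 - c2) *: g = (k1 + c1 *: g) - (k2 + c2 *: g).
      by rewrite scalerBl addrACA opprD.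
    by rewrite [- (f - _)]opprB [X in _ <= hnorm X]addrA subrK.
  by apply: le_trans (hnormD _ _) _; rewrite hnormN lerD.
have [x hx] : exists l, forall n, `|Re (kc n).2 - l| <= d^-1 * n.+1%:R^-1.
  apply: slow_cauchy => n m; rewrite -cReN -cReD; exact: le_trans (normRe_le _) (cauchy n m).
have [y hy] : exists l, forall n, `|Im (kc n).2 - l| <= d^-1 * n.+1%:R^-1.
  apply: slow_cauchy => n m; rewrite -cImN -cImD; exact: le_trans (normIm_le _) (cauchy n m).
pose c := (x +i* y)%C.
have : ~ K (f - c *: g) by move=> Kf; apply: nf; exists c.
move=> /fK[e e0 he].
pose B := 1 + (d^-1 + d^-1) * hnorm g.
have B0 : 0 < B by rewrite ltr_pwDl // mulr_ge0 ?hnorm_ge0 // addr_ge0 // invr_ge0 ltW.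
have bd n : e <= B * n.+1%:R^-1.
  have [Kn hn] := hkc n; apply: le_trans (he _ Kn) _.
  have -> : f - c *: g - (kc n).1 = (f - ((kc n).1 + (kc n).2 *: g)) + ((kc n).2 - c) *: g.
    by rewrite opprD scalerBl !addrA subrK addrAC.
  apply: le_trans (hnormD _ _) _; rewrite /B mulrDl mul1r; apply: lerD => //.
  rewrite hnormZ mulrAC ler_wpM2r ?hnorm_ge0 // mulrDl.
  by apply: le_trans (normc_le _) _; rewrite cReD cImD cReN cImN lerD ?hx ?hy.
(* At this index [B / (n+1)] is smaller than [e]. *)
have := bd (Num.truncn (B / e)); rewrite ler_pdivlMr // leNgt => /negP; apply.
rewrite -ltr_pdivrMl // mulrC; have := truncnS_gt (B / e); rewrite ?divr_ge0 ?(ltW B0) ?(ltW e0) //; exact.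
Qed.

Lemma trunc_cvg f (e : R) : 0 < e ->
  \forall m \near \oo, hnorm (f - \sum_(n < m) (f n : C) *: hmonom n) <= e.
Proof.
move=> e0; have := valP f; rewrite inE /= => /cvgrPdist_lt/(_ (e ^+ 2)).
rewrite exprn_gt0 // => /(_ isT); apply: filterS => m hm.
rewrite -(ger0_norm (ltW e0)) -sqrtr_sqr; apply: ler_wsqrtr.
set X := f - _.
have E k : \val X k = (if (k < m)%N then 0 else f k) :> C.
  rewrite -[LHS]/(hcoef (f - \sum_(n < m) (f n : C) *: hmonom n) k) hcoefBE.
  have -> : (\sum_(n < m) (f n : C) *: hmonom n) k = \sum_(n < m) (f n * (k == n)%:R) :> C.
    elim/big_rec2: _ => // i y1 y2 _ <-; by rewrite hcoefDE hcoefZE.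
  case: ifPn => [km|]; last first.
    rewrite -leqNgt => mk; rewrite big1 ?subr0 // => i _.
    by rewrite gtn_eqF ?mulr0 // (leq_trans (ltn_ord i)).
  rewrite (bigD1 (Ordinal km)) //= eqxx mulr1 big1 ?addr0 ?subrr // => i ik.
  rewrite eq_sym; case: eqP => [ki|_]; last by rewrite mulr0.
  by case/eqP: ik; exact: val_inj.
suff : sqsum (\val X) <= e ^+ 2 by [].
have sX := valP X; move: (\val X) E sX => Y E sX; apply: (sqsum_le sX) => n.
have [nm|mn] := leqP n m.
  rewrite /series /= big_nat_cond big1 ?sqr_ge0 // => i /andP[/andP[_ im] _].
  by rewrite E (leq_trans im) // normc0 expr0n.
rewrite /series /= (big_cat_nat (n := m)) //=; last exact: ltnW.
rewrite big_nat_cond big1 ?add0r; last first.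
  by move=> i /andP[/andP[_ im] _]; rewrite E im normc0 expr0n.
have hs := series_le_sqsum n (valP f).
have : series (fun n => normc (f n) ^+ 2) n = series (fun n => normc (f n) ^+ 2) m + \sum_(m <= i < n) normc (f i) ^+ 2.
  by rewrite /series /= (big_cat_nat (n := m)) //=; exact: ltnW.
rewrite (_ : \sum_(m <= k < n) _ = \sum_(m <= i < n) normc (f i) ^+ 2); last first.
  by apply: eq_big_nat => i /andP[mi _]; rewrite E ltnNge mi.
move: hm; rewrite ltr_norml => /andP[_ h1] h2; move: h1 hs; rewrite /sqsum h2 /=; lra.
Qed.

(** Riesz representation of the functional [phi] that reads the coordinate along [g] modulo [K]: it
    is bounded since [g] is far from [K], it vanishes on [K], and it is 1 at [g]. *)
Lemma hyperplane_orth K g : lin_closed K -> far K g -> (forall f, addline K g f) ->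
  exists u, (forall k, K k -> hardy_dot k u = 0) /\ hardy_dot g u <> 0.
Proof.
move=> sK [d d0 dg] cov.
have [phi hphi] := choice cov.
have nKg : ~ K g.
  by move=> Kg; have := dg _ Kg; rewrite subrr /hnorm /sqsum leNgt (_ : Num.sqrt _ = 0) ?d0 //; have /complexI := normr0 H.
have uniq c c' f : K (f - c *: g) -> K (f - c' *: g) -> c = c'.
  move=> h h'; apply/eqP; rewrite -subr_eq0; apply/negPn/negP => cc; apply: nKg.
  have := lin_closedZ (c - c')^-1 sK (lin_closedB sK h' h).
  have -> : f - c' *: g - (f - c *: g) = (c - c') *: g.
    by rewrite opprB addrC addrA subrK scalerBl.
  by rewrite scalerA mulVf // scale1r.
have philin c f f' : phi (c *: f + f') = c * phi f + phi f'.
  apply: (uniq _ _ _ (hphi _)); rewrite scalerDl -scalerA opprD addrACA -scalerBr.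
  by case: sK => _; apply.
have phi0 : phi 0 = 0 by have := philin (-1) 0 0; rewrite scaler0 addr0 mulN1r addNr.
have phisum m (c : 'I_m -> C) (w : 'I_m -> H) : phi (\sum_i c i *: w i) = \sum_i c i * phi (w i).
  by elim/big_rec2: _ => [|i y1 y2 _ E]; rewrite ?phi0 // philin E.
have phib f : normc (phi f) * d <= hnorm f.
  have := dist_line sK dg (phi f) (hphi f); by rewrite subrK.
pose a n : C^o := (phi (hmonom n))^*.
have sa : a \in sqsummable (R := R).
  (* Test [phi] on the truncation [X] of the candidate vector. With [S] the partial sum of squares,
     [phi X] is [S] and the norm of [X] is at most the root of [S], so [S * d] is at most the root
     of [S], whence [S <= d^-2]. *)
  apply: (@sqsummable_bounded _ _ (d^-1 ^+ 2)) => m.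
  set S := series _ m.
  have S0 : 0 <= S by apply: sumr_ge0 => i _; exact: sqr_ge0.
  pose X := \sum_(n < m) (a n : C) *: hmonom n.
  have XE k : \val X k = (if (k < m)%N then a k else 0) :> C.
    have -> : \val X k = \sum_(n < m) (a n * (k == n)%:R) :> C.
      rewrite -[LHS]/(hcoef X k) /X; elim/big_rec2: _ => // i y1 y2 _ <-; by rewrite hcoefDE hcoefZE.
    case: ifPn => [km|]; last first.
      rewrite -leqNgt => mk; rewrite big1 // => i _.
      by rewrite gtn_eqF ?mulr0 // (leq_trans (ltn_ord i)).
    rewrite (bigD1 (Ordinal km)) //= eqxx mulr1 big1 ?addr0 // => i ik.
    rewrite eq_sym; case: eqP => [ki|_]; last by rewrite mulr0.
    by case/eqP: ik; exact: val_inj.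
  have nX : hnorm X <= Num.sqrt S.
    apply: ler_wsqrtr; apply: (sqsum_le (valP X)) => n.
    apply: (@le_trans _ _ (series (fun k => normc (\val X k) ^+ 2) (maxn n m))).
      by apply: nondecreasing_series (leq_maxl _ _) => k _ _; exact: sqr_ge0.
    rewrite /series /= (big_cat_nat (n := m)) ?leq_maxr //= [X in _ + X]big_nat_cond [X in _ + X]big1 ?addr0.
      by rewrite /S /series /=; apply: ler_sum_nat => i /andP[_ im]; rewrite XE im.
    by move=> i /andP[/andP[mi _] _]; rewrite XE ltnNge mi normc0 expr0n.
  have pX : phi X = S%:C%C.
    rewrite phisum /S /series /= big_mkord rmorph_sum /=; apply: eq_bigr => i _.
    rewrite rmorphXn /= -normr_normc sqr_normc; congr (_ * _).
    by apply: complex_eq; rewrite ?cRe_conj ?cIm_conj /a; case: (phi _) => x y; rewrite /Num.conj /= ?opprK.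
  have := phib X; rewrite pX normcR ger0_norm // => h.
  have : S * d <= Num.sqrt S by exact: le_trans h nX.
  have [->|Sn0] := eqVneq S 0; first by rewrite sqr_ge0.
  have sS0 : 0 < Num.sqrt S by rewrite sqrtr_gt0 lt_def Sn0.
  set y := Num.sqrt S in sS0 *; have -> : S = y * y by rewrite -expr2 sqr_sqrtr.
  rewrite -mulrA -{3}[y]mulr1 ler_pM2l // => h2.
  have h3 : y <= d^-1 by rewrite -div1r ler_pdivlMr.
  by rewrite -expr2 ler_sqr // ?nnegrE ?invr_ge0 ltW.
pose u : H := Hardy sa.
have phiE f : hardy_dot f u = phi f.
  apply: dotE; apply: cvg_normc; apply/cvgrPdist_lt => e e0.
  have ed0 : 0 < e * d / 2 by rewrite !mulr_gt0.
  have := trunc_cvg f ed0; apply: filterS => m hm.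
  rewrite sub0r normrN ger0_norm ?normc_ge0 //.
  have -> : series (fun n => f n * (u n)^* : C^o) m = phi (\sum_(n < m) (f n : C) *: hmonom n) :> C.
    rewrite phisum /series /= big_mkord; apply: eq_bigr => i _.
    by rewrite /a conjCK.
  set X := \sum_(n < m) _ in hm *.
  have -> : phi X - phi f = - phi (f - X).
    by have := philin (-1) X f; rewrite scaleN1r mulN1r [- X + f]addrC => ->; rewrite opprD opprK.
  rewrite normcN; have := phib (f - X) => h.
  by rewrite -(ltr_pM2r d0); apply: le_lt_trans h _; apply: le_lt_trans hm _; rewrite ltr_pdivrMr // ltr_pMr ?mulr_gt0 // ltr1n.
exists u; split=> [k Kk|].
  by rewrite phiE; apply: (uniq _ _ k (hphi k)); rewrite scale0r subr0.
rewrite phiE; have -> : phi g = 1.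
  by apply: (uniq _ _ g (hphi g)); rewrite scale1r subrr; case: sK.
by apply/eqP; rewrite oner_eq0.
Qed.

Lemma separation (M : set H) g : lin_closed M -> closed M -> finite_codim M -> ~ M g ->
  exists u, hardy_orth M u /\ hardy_dot g u <> 0.
Proof.
move=> sM cM [E [/finite_seqP[s ->] codim]] nMg.
have farM f : ~ M f -> far M f by exact: closed_far.
have cov (P : set H) : lin_closed P -> M `<=` P -> (forall x, x \in s -> P x) -> P g ->
    forall f, P f.
  move=> sP MP Ps _ f; have [k Mk hk] := codim f.
  rewrite -[f](subrK k); apply: lin_closedD => //; last exact: MP.
  by move: hk; apply: span_sub => // x; exact: Ps.
suff [u [h1 h2]] : exists u, (forall k, M k -> hardy_dot k u = 0) /\ hardy_dot g u <> 0.
  by exists u; split=> // k Mk; rewrite dot_conj h1 // conjC0.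
clear codim cM; elim: s M sM nMg farM cov => [|e s IH] K sK nKg farK cov.
  apply: (hyperplane_orth sK (farK _ nKg)) => f.
  apply: (cov (addline K g)) => //; [exact: addline_lin_closed|by move=> ? ?; exact: sub_addline|exact: addline_mem].
have [[c Kc]|nKe] := pselect (addline K e g).
  have c0 : c != 0 by apply: contra_notN nKg => /eqP c0; move: Kc; rewrite c0 scale0r subr0.
  apply: (IH K) => // P sP KP Ps Pg; apply: (cov P) => // x; rewrite inE => /orP[/eqP ->|]; last exact: Ps.
  have := lin_closedZ c^-1 sP (lin_closedB sP Pg (KP _ Kc)).
  by rewrite opprB addrC subrK scalerA mulVf // scale1r.
have [||x|P sP KP Ps Pg|u [h1 h2]] := IH (addline K e).
- exact: addline_lin_closed.
- by [].
- exact: addline_far.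
- apply: (cov P) => //; first by move=> y Ky; apply: KP; exact: sub_addline.
  by move=> x; rewrite inE => /orP[/eqP ->|]; [apply: KP; exact: addline_mem|exact: Ps].
- by exists u; split=> // k Kk; apply: h1; exact: sub_addline.
Qed.

End closed_subspaces.

(** * Cesaro-invariance in terms of the orthogonal complement *)

Section invariant_subspaces.
Context {R : realType}.
Local Notation C := R[i].
Local Notation H := (hardy R).
Implicit Types (f g : H).

Lemma hcoef_sum d (c : 'I_d -> C) (u : 'I_d -> H) :
  hcoef (\sum_i c i *: u i) = \sum_i c i *: (hcoef (u i)).
Proof. by elim/big_rec2: _ => // i y1 y2 _ <-. Qed.

Variable M : set H.
Hypotheses (sM : lin_closed M) (cM : closed M) (fM : finite_codim M).
Local Notation N := (hardy_orth M).

Lemma orth_lin_closed : lin_closed N.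
Proof.
split=> [g _|a x y Nx Ny g Mg]; first exact: dot0l.
by rewrite dotPl Nx // Ny // mulr0 addr0.
Qed.

Lemma orth_orth g : (forall u, N u -> hardy_dot g u = 0) -> M g.
Proof.
move=> h; apply: contrapT => /(separation sM cM fM)[u [Nu]].
by apply; exact: h.
Qed.

(** Pairing with vectors that span a complement of [M] embeds the orthogonal complement in a space
    of rows, so it has a basis [u]. When [M] is invariant, the adjoint of the Cesaro operator acts
    on [u] by a matrix [A]; testing on differences of monomials gives u = A (Dop u), and inverting
    [A] expresses [Dop u] in terms of [u]. *)
Lemma orth_basis : exists r (u : 'I_r -> H), N = linear_span (range u) /\
  ((forall f, M f -> M (cesaro_op f)) ->
   forall i, linear_span (range (fun j => hcoef (u j))) (Dop (u i))).
Proof.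
have [E [/finite_seqP[s ->] codim]] := fM.
pose d := size s; pose e (k : 'I_d) := s`_k.
pose P u : 'rV[C]_d := \row_k hardy_dot u (e k).
have Plin a x y : P (a *: x + y) = a *: P x + P y.
  by apply/rowP => k; rewrite !mxE dotPl.
have spanE x : linear_span [set` s] x -> exists c : 'I_d -> C, x = \sum_k c k *: e k.
  have sE : [set` s] `<=` linear_span (range e).
    move=> y /= ys; have ly : (index y s < d)%N by rewrite index_mem.
    by apply: mem_linear_span; exists (Ordinal ly) => //; rewrite /e /= nth_index.
  by move=> /(span_mono sE)/spanP.
have Pinj x : N x -> P x = 0 -> x = 0.
  move=> Nx Px; apply: dot_eq0 => g; have [k Mk /spanE[c hc]] := codim g.
  rewrite -[g](subrK k) hc dotDr (Nx _ Mk) addr0 dot_sumr big1 // => j _.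
  by move/rowP/(_ j): Px; rewrite !mxE dotZr => ->; rewrite mulr0.
have [r [u [ufree Nu Nspan]]] := subspace_basis Plin orth_lin_closed Pinj.
exists r, u; split=> // Minv i.
pose B := \matrix_i P (u i).
have BE l l' : B l l' = hardy_dot (u l) (e l') by rewrite !mxE.
have dE g : M g -> forall c : 'I_r -> C, hardy_dot (\sum_j c j *: u j) g = 0.
  by move=> Mg c; rewrite dot_suml big1 // => j _; rewrite dotZl (Nu j) ?mulr0.
(* The functional g -> <u_k, C g> vanishes on [M], so it is known by its values [psi] on the
   complementary vectors; it is represented in the span of [u] once [psi] lies in the row space of
   [B]. *)
have rowA k : exists a : 'I_r -> C, forall g,
    hardy_dot (u k) (cesaro_op g) = hardy_dot (\sum_j a j *: u j) g.
  pose psi : 'rV[C]_d := \row_l hardy_dot (u k) (cesaro_op (e l)).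
  have psiE l : psi 0 l = hardy_dot (u k) (cesaro_op (e l)) by rewrite mxE.
  have /submxP[a psia] : (psi <= B)%MS.
    rewrite submxE; apply/eqP/rowP => j; rewrite mxE [RHS]mxE.
    (* Each column of the cokernel of [B] gives a vector orthogonal to all [u_j], hence in [M] by
       [orth_orth]; invariance of [M] then makes [psi] vanish on that column. *)
    pose y l := (cokermx B l j)^*.
    have My : M (\sum_l y l *: e l).
      apply: orth_orth => v; rewrite Nspan => /spanP[c ->].
      rewrite dot_sumr big1 // => l _; rewrite dotZr.
      have : (B *m cokermx B) l j = 0 by rewrite mulmx_coker mxE.
      rewrite mxE => h; rewrite dot_conj dot_sumr.
      have S0 : \sum_i0 hardy_dot (u l) (y i0 *: e i0) = 0.
        by rewrite -[RHS]h; apply: eq_bigr => l' _; rewrite dotZr /y conjCK mulrC BE.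
      by rewrite S0 conjC0 mulr0.
    have := Nu k _ (Minv _ My); rewrite cesaro_sum dot_sumr => {2}<-.
    by apply: eq_bigr => l _; rewrite psiE dotZr /y conjCK mulrC.
  exists (a 0) => g; have [m Mm /spanE[c hc]] := codim g.
  rewrite -[g](subrK m) hc.
  have -> : cesaro_op (\sum_k c k *: e k + m) = \sum_k c k *: cesaro_op (e k) + cesaro_op m.
    by rewrite -[\sum_k c k *: e k]scale1r cesaro_linear cesaro_sum scale1r.
  rewrite !dotDr (Nu k _ (Minv _ Mm)) (dE _ Mm) !addr0 !dot_sumr; apply: eq_bigr => l _.
  rewrite !dotZr dot_suml; congr (_ * _).
  move/rowP/(_ l): psia; rewrite psiE mxE => ->; apply: eq_bigr => j _.
  by rewrite BE dotZl.
have [a ha] := choice rowA.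
have aD k n : u k n = \sum_j a k j * Dop (u j) n :> C.
  have := ha k (hmonom n - hmonom n.+1); rewrite cesaro_monomB dotZr dot_monom.
  have -> : (n.+1%:R^-1 : C)^* = n.+1%:R^-1 by rewrite geC0_conj // invr_ge0 ler0n.
  rewrite -scaleN1r dotDr dotZr !dot_monom rmorphN1 mulN1r => h.
  have n0 : n.+1%:R != 0 :> C by rewrite pnatr_eq0.
  rewrite -[LHS](mulVKf n0) h.
  rewrite -[X in X - _]/(hcoef _ n) -[X in _ - X]/(hcoef _ n.+1) hcoef_sum.
  rewrite !fct_sumE /= -sumrB mulr_sumr; apply: eq_bigr => j _.
  change (n.+1%:R * (a k j * u j n - a k j * u j n.+1) = a k j * (n.+1%:R * (u j n - u j n.+1)) :> C).
  by rewrite -mulrBr mulrCA.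
pose A := \matrix_(k, j) a k j.
(* A relation between the rows of [A] would, through u = A (Dop u), be a relation between the basis
   vectors. *)
have Afree : row_free A.
  apply: inj_row_free => v vA; apply: (row_free_inj ufree); rewrite mul0mx.
  suff E0 : \sum_k v 0 k *: u k = 0.
    apply/rowP => l; rewrite !mxE -[RHS](dot0l (e l)) -E0 dot_suml; apply: eq_bigr => k _.
    by rewrite !mxE dotZl.
  apply: hcoef_inj => n; rewrite hcoef_sum fct_sumE /=.
  rewrite -[RHS]/(0 : C); under eq_bigr do rewrite fctE /GRing.scale /= aD mulr_sumr.
  rewrite exchange_big big1 // => j _ /=; under eq_bigr do rewrite mulrA.
  rewrite -mulr_suml; move/rowP/(_ j): vA; rewrite !mxE => h.
  rewrite (_ : \sum_i0 _ = 0) ?mul0r // -[RHS]h; apply: eq_bigr => k _.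
  by rewrite mxE.
have Au : A \in unitmx by rewrite -row_free_unit.
apply/spanP; exists (invmx A i); apply/funext => n.
rewrite fct_sumE; under eq_bigr do rewrite fctE /GRing.scale /= aD mulr_sumr.
rewrite exchange_big /=; under eq_bigr do under eq_bigr do rewrite mulrA.
under eq_bigr do rewrite -mulr_suml.
have h j : \sum_k invmx A i k * a k j = (i == j)%:R.
  have : (invmx A *m A) i j = (i == j)%:R by rewrite mulVmx // mxE.
  by rewrite mxE => <-; apply: eq_bigr => k _; rewrite mxE.
under eq_bigr do rewrite h.
rewrite (bigD1 i) //= eqxx mul1r big1 ?addr0 // => j ij.
by rewrite eq_sym (negPf ij) mul0r.
Qed.

(** Stated as surjectivity of [Dop] on the complement, since it is the inverse of [Dop], the adjoint
    of the Cesaro operator, that must map the complement to itself. *)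
Lemma Dop_cesaro_invariant :
  (forall f, N f -> exists2 g, N g & hcoef f = Dop g) ->
  forall f, M f -> M (cesaro_op f).
Proof.
move=> h f Mf; apply: orth_orth => u /h[v Nv /dot_cesaro_Dop ->].
by rewrite dot_conj (Nv _ Mf) conjC0.
Qed.

End invariant_subspaces.

(* If [Re c <= 1/2], then [n |f n|^2] is nondecreasing, so [f] is not square summable. *)
Lemma Dop_eigenvalue (R : realType) (c : R[i]) (f : hardy R) :
  f <> 0 -> Dop f = c *: hcoef f -> 1 / 2 < complex.Re c.
Proof.
move=> f0 Df; rewrite ltNge; apply/negP => c12.
have rec n : f n.+1 = f n * (1 - c / n.+1%:R) :> R[i].
  move/funeqP/(_ n): Df; rewrite /Dop /= !fctE /GRing.scale /= => h.
  have n0 : n.+1%:R != 0 :> R[i] by rewrite pnatr_eq0.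
  apply: (mulfI n0); rewrite mulrBr in h.
  rewrite mulrCA mulrBr mulr1 mulrCA mulfV // mulr1 mulrBr [f n * n.+1%:R]mulrC [f n * c]mulrC -h.
  by rewrite opprB addrC subrK.
have cn n : (1 - (2 * n.+1%:R)^-1) ^+ 2 <= normc (1 - c / n.+1%:R) ^+ 2.
  rewrite normc_sqr; apply: le_trans (_ : complex.Re (1 - c / n.+1%:R) ^+ 2 <= _); last by rewrite lerDl sqr_ge0.
  have -> : complex.Re (1 - c / n.+1%:R) = 1 - complex.Re c / n.+1%:R.
    have -> : (n.+1%:R)^-1 = (n.+1%:R^-1 : R)%:C%C by rewrite fmorphV rmorph_nat.
    by rewrite cReD cReN cReM /= mulr0 subr0.
  have h1 : (2 * n.+1%:R)^-1 <= 1 :> R.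
    by rewrite invf_le1 ?mulr_gt0 // -natrM ler1n.
  rewrite ler_sqr ?nnegrE; [|by rewrite subr_ge0|]; last first.
    rewrite (le_trans (_ : 0 <= 1 - (2 * n.+1%:R)^-1)) ?subr_ge0 // lerD2l lerN2.
    by rewrite invfM ler_wpM2r ?invr_ge0 // -div1r.
  by rewrite lerD2l lerN2 invfM ler_wpM2r ?invr_ge0 // -div1r.
have f00 : f 0%N <> 0 :> R[i].
  move=> h; apply: f0; apply: hcoef_inj => n; elim: n => [|n IH]; first exact: h.
  by rewrite rec IH mul0r.
have f1 : 0 < normc (f 1%N) ^+ 2.
  rewrite exprn_gt0 // rec normcM mulr_gt0 //.
    by rewrite lt_def normc_ge0 andbT; apply/eqP => /eq0_normc.
  have := cn 0%N; rewrite mulr1 => h; rewrite lt_def normc_ge0 andbT.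
  apply/eqP => h0; move: h; rewrite h0 expr0n /= leNgt => /negP; apply.
  by rewrite exprn_gt0 // subr_gt0 invf_lt1 // ltr1n.
have mon n : normc (f 1%N) ^+ 2 <= n.+1%:R * normc (f n.+1) ^+ 2.
  elim: n => [|n IH]; first by rewrite mul1r.
  apply: le_trans IH _; rewrite (rec n.+1) normcM exprMn.
  have := cn n.+1; have := sqr_ge0 (normc (f n.+1)).
  move: (normc (f n.+1) ^+ 2) (normc _ ^+ 2) => x y x0 xy.
  apply: le_trans (_ : n.+2%:R * (x * (1 - (2 * n.+2%:R)^-1) ^+ 2) <= _); last first.
    by rewrite ler_wpM2l // ler_wpM2l.
  rewrite mulrCA [n.+1%:R * x]mulrC ler_wpM2l //.
  have -> : n.+2%:R * (1 - (2 * n.+2%:R)^-1) ^+ 2 = n.+1%:R + (4 * n.+2%:R)^-1 :> R.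
    rewrite -[n.+2%:R]natr1; field; rewrite ?natr1 ?pnatr_eq0 //.
  by rewrite lerDl invr_ge0 mulr_ge0.
have := valP f; rewrite inE /= => cf.
apply: (@dvg_harmonic R).
have ctz : cvgn (series ((normc (f 1%N) ^+ 2)^-1 *: (fun n => normc (f n.+1) ^+ 2))).
  rewrite seriesZ; apply: is_cvgZl_tmp.
  have sv : (fun k => f k.+1) \in sqsummable (R := R).
    apply: (@sqsummable_bounded _ _ (sqsum f)) => n.
    apply: le_trans (series_le_sqsum n.+1 (valP f)).
    by rewrite /series /= big_nat_recl //= lerDr sqr_ge0.
  by move: sv; rewrite inE.
apply: (series_le_cvg _ _ _ ctz) => n.
- by rewrite invr_ge0.
- by rewrite mulr_ge0 ?sqr_ge0 // invr_ge0 ltW.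
- rewrite /harmonic /= -(ler_pM2l f1) mulrA mulfV ?gt_eqF // mul1r.
  by rewrite ler_pdivrMr // mulrC.
Qed.

(** * Integration on the half-line *)

Section half_line.
Context {R : realType}.
Local Notation mu := (@lebesgue_measure R).
Local Notation D := (`]0%R, +oo[%classic : set R).
Local Notation I f := (\int[mu]_(x in D) f x).
Implicit Types f g k F : R -> R.

Lemma mhalf_line : measurable (D : set (measurableTypeR R)).
Proof. exact: measurable_itv. Qed.
Hint Resolve mhalf_line : core.

Lemma inD (x : R) : D x <-> 0 < x.
Proof. by rewrite /= in_itv /= andbT. Qed.

Definition integ f := mu.-integrable D (EFin \o f).

Lemma integ_meas f : integ f -> measurable_fun D f.
Proof. by move=> /integrableP[/measurable_EFinP]. Qed.

Lemma integ_le f g : measurable_fun D f -> (forall x, 0 < x -> `|f x| <= g x) ->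
  integ g -> integ f.
Proof.
move=> mf fg ig; apply: (le_integrable _ _ _ ig) => //; first exact/measurable_EFinP.
move=> x /inD x0; rewrite /= lee_fin; apply: le_trans (fg _ x0) _; exact: ler_norm.
Qed.

Lemma eq_integ f g : (forall x, 0 < x -> f x = g x) -> integ f -> integ g.
Proof.
move=> fg; apply: eq_integrable => // x; rewrite inE => /inD x0; by rewrite /= fg.
Qed.

Lemma integD f g : integ f -> integ g -> integ (fun x => f x + g x).
Proof.
by move=> h1 h2; have := integrableD mhalf_line h1 h2; apply: eq_integrable => // x _ /=; rewrite EFinD.
Qed.

Lemma integZ c f : integ f -> integ (fun x => c * f x).
Proof.
by move=> h1; have := integrableZl mhalf_line c h1; apply: eq_integrable => // x _ /=; rewrite EFinM.
Qed.

Lemma integB f g : integ f -> integ g -> integ (fun x => f x - g x).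
Proof.
move=> h1 h2; have := integD h1 (integZ (-1) h2); apply: eq_integ => x _.
by rewrite mulN1r.
Qed.

Lemma IntD f g : integ f -> integ g -> I (fun x => f x + g x) = I f + I g.
Proof. by move=> h1 h2; rewrite RintegralD. Qed.
Lemma IntB f g : integ f -> integ g -> I (fun x => f x - g x) = I f - I g.
Proof. by move=> h1 h2; rewrite RintegralB. Qed.
Lemma IntZ c f : integ f -> I (fun x => c * f x) = c * I f.
Proof. by move=> h1; rewrite RintegralZl. Qed.
Lemma Int_eq f g : (forall x, 0 < x -> f x = g x) -> I f = I g.
Proof. by move=> fg; apply: eq_Rintegral => x; rewrite inE => /inD; exact: fg. Qed.
Lemma Int_ge0 f : (forall x, 0 < x -> 0 <= f x) -> 0 <= I f.
Proof. by move=> f0; apply: Rintegral_ge0 => x /inD; exact: f0. Qed.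
Lemma Int_le f g : integ f -> integ g -> (forall x, 0 < x -> f x <= g x) -> I f <= I g.
Proof. by move=> h1 h2 fg; apply: le_Rintegral => // x /inD; exact: fg. Qed.
Lemma Int0 : I (fun=> 0) = 0 :> R.
Proof. by rewrite Rintegral_cst // mul0r. Qed.
Lemma integ0 : integ (fun=> 0).
Proof. exact: integrable0. Qed.

Lemma integ_sum (J : Type) (r : seq J) (P : pred J) (h : J -> R -> R) :
  (forall j, P j -> integ (h j)) -> integ (fun x => \sum_(j <- r | P j) h j x).
Proof.
move=> ih; elim: r => [|j r IH].
  by apply: eq_integ integ0 => x _; rewrite big_nil.
have [Pj|nPj] := boolP (P j).
  by apply: eq_integ (integD (ih _ Pj) IH) => x _; rewrite big_cons Pj.
by apply: eq_integ IH => x _; rewrite big_cons (negPf nPj).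
Qed.

Lemma Int_sum (J : Type) (r : seq J) (P : pred J) (h : J -> R -> R) :
  (forall j, P j -> integ (h j)) ->
  I (fun x => \sum_(j <- r | P j) h j x) = \sum_(j <- r | P j) I (h j).
Proof.
move=> ih; elim: r => [|j r IH].
  by rewrite [RHS]big_nil -[RHS]Int0; apply: Int_eq => x _; rewrite big_nil.
rewrite big_cons; case: ifPn => Pj.
  rewrite -IH -IntD //; [|exact: ih|exact: integ_sum].
  by apply: Int_eq => x _; rewrite big_cons Pj.
by rewrite -IH; apply: Int_eq => x _; rewrite big_cons (negPf Pj).
Qed.

Lemma meas_cont f : (forall x, 0 < x -> {for x, continuous f}) -> measurable_fun D f.
Proof.
move=> cf; apply: open_continuous_measurable_fun; first exact: interval_open.
by move=> x; rewrite inE => /inD; exact: cf.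
Qed.

Definition L2r f := measurable_fun D f /\ integ (fun x => f x ^+ 2).

Lemma L2r_le f g : measurable_fun D f -> (forall x, 0 < x -> `|f x| <= `|g x|) ->
  L2r g -> L2r f.
Proof.
move=> mf fg [_ ig]; split => //; apply: integ_le ig => [|x x0].
  exact: measurable_funX.
rewrite normrX -[leRHS]real_normK ?num_real //.
by rewrite ler_sqr ?nnegrE //; exact: fg.
Qed.

Lemma L2rM f g : L2r f -> L2r g -> integ (fun x => f x * g x).
Proof.
move=> [mf if2] [mg ig2]; apply: integ_le (integD if2 ig2) => [|x _].
  exact: measurable_funM.
rewrite ler_norml; have := sqr_ge0 (f x + g x); have := sqr_ge0 (f x - g x).
by have := sqr_ge0 (f x); have := sqr_ge0 (g x); nra.
Qed.

Lemma L2rD f g : L2r f -> L2r g -> L2r (fun x => f x + g x).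
Proof.
move=> Lf Lg; have [mf if2] := Lf; have [mg ig2] := Lg; split; first exact: measurable_funD.
apply: eq_integ (integD (integD if2 ig2) (integZ 2 (L2rM Lf Lg))) => x _; ring.
Qed.

Lemma L2rZ c f : L2r f -> L2r (fun x => c * f x).
Proof.
move=> [mf if2]; split; first exact: measurable_funM.
by apply: eq_integ (integZ (c ^+ 2) if2) => x _; rewrite exprMn.
Qed.

Lemma L2rB f g : L2r f -> L2r g -> L2r (fun x => f x - g x).
Proof.
move=> Lf Lg; have := L2rD Lf (L2rZ (-1) Lg).
by rewrite (_ : (fun x => f x - g x) = (fun x => f x + -1 * g x)) //; apply/funext => x; rewrite mulN1r.
Qed.

Lemma L2r0 : L2r (fun=> 0).
Proof. by split => //; apply: eq_integ integ0 => x _; rewrite expr0n. Qed.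

Lemma L2r_sum (J : Type) (r : seq J) (P : pred J) (h : J -> R -> R) :
  (forall j, P j -> L2r (h j)) -> L2r (fun x => \sum_(j <- r | P j) h j x).
Proof.
move=> ih; elim: r => [|j r IH].
  by rewrite (_ : (fun _ => _) = (fun=> 0)); [exact: L2r0|apply/funext => x; rewrite big_nil].
have [Pj|nPj] := boolP (P j).
  by rewrite (_ : (fun _ => _) = (fun x => h j x + \sum_(j <- r | P j) h j x));
    [apply: L2rD => //; exact: ih|apply/funext => x; rewrite big_cons Pj].
by rewrite (_ : (fun _ => _) = (fun x => \sum_(j <- r | P j) h j x)) //;
  apply/funext => x; rewrite big_cons (negPf nPj).
Qed.

(** The Cauchy-Schwarz inequality in its weighted arithmetic-geometric form, with a free parameter
    [t] in place of square roots. *)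
Lemma L2r_int_bound f g (t : R) : 0 < t -> L2r f -> L2r g ->
  `|I (fun x => f x * g x)| <= (t^-1 * I (fun x => f x ^+ 2) + t * I (fun x => g x ^+ 2)) / 2.
Proof.
move=> t0 Lf Lg; have ifg := L2rM Lf Lg; have [mf if2] := Lf; have [mg ig2] := Lg.
apply: le_trans (le_normr_Rintegral mhalf_line ifg) _.
have i1 := integD (integZ (t^-1 / 2) if2) (integZ (t / 2) ig2).
have -> : (t^-1 * I (fun x => f x ^+ 2) + t * I (fun x => g x ^+ 2)) / 2 =
   I (fun x => t^-1 / 2 * f x ^+ 2 + t / 2 * g x ^+ 2).
  by rewrite IntD ?IntZ //; try exact: integZ; ring.
apply: Int_le => // [|x x0].
  apply: integ_le (integD if2 ig2) => [|x _].
    by apply: measurableT_comp => //; exact: measurable_funM.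
  rewrite normr_id ler_norml; have := sqr_ge0 (f x + g x); have := sqr_ge0 (f x - g x).
  by have := sqr_ge0 (f x); have := sqr_ge0 (g x); nra.
rewrite -subr_ge0.
(* Used with [s] equal to 1 or -1 according to the sign of [f x * g x], so that the term in
   [1 - s ^+ 2] vanishes. *)
have h (s : R) : t^-1 / 2 * f x ^+ 2 + t / 2 * g x ^+ 2 - s * (f x * g x) =
   t / 2 * ((t^-1 * f x - s * g x) ^+ 2 + (1 - s ^+ 2) * g x ^+ 2).
  by field; rewrite gt_eqF.
have [fg|fg] := lerP 0 (f x * g x); [rewrite ger0_norm // | rewrite ltr0_norm //].
  rewrite -[f x * g x]mul1r h expr1n subrr mul0r addr0.
  by rewrite mulr_ge0 ?sqr_ge0 // divr_ge0 // ltW.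
rewrite -[- (f x * g x)]mulN1r h sqrrN expr1n subrr mul0r addr0.
by rewrite mulr_ge0 ?sqr_ge0 // divr_ge0 // ltW.
Qed.

Lemma L2r_cvg (f_ : nat -> R -> R) f k : (forall n, L2r (f_ n)) -> L2r f -> L2r k ->
  (fun n => I (fun x => (f_ n x - f x) ^+ 2)) @ \oo --> 0 ->
  (fun n => I (fun x => f_ n x * k x)) @ \oo --> I (fun x => f x * k x).
Proof.
move=> Lf_ Lf Lk /cvgrPdist_lt h; apply/cvgrPdist_le => e e0.
pose A := I (fun x => k x ^+ 2).
have A0 : 0 <= A by apply: Int_ge0 => x _; exact: sqr_ge0.
(* Chosen so that [t * A <= e]; the added 1 covers [A = 0]. *)
pose t := e / (A + 1).
have t0 : 0 < t by rewrite divr_gt0 // ltr_wpDl.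
have te0 : 0 < t * e by rewrite mulr_gt0.
have := h _ te0; apply: filterS => n; rewrite sub0r normrN => hn.
rewrite distrC -IntB; [|exact: L2rM|exact: L2rM].
rewrite (Int_eq (g := fun x => (f_ n x - f x) * k x)); last by move=> x _; rewrite mulrBl.
apply: le_trans (L2r_int_bound t0 (L2rB (Lf_ n) Lf) Lk) _.
have h1 : t^-1 * I (fun x => (f_ n x - f x) ^+ 2) <= e.
  rewrite mulrC ler_pdivrMr // mulrC; apply/ltW; apply: le_lt_trans hn; exact: ler_norm.
have h2 : t * A <= e by rewrite /t mulrAC ler_pdivrMr ?ltr_wpDl // ler_wpM2l ?lerDl // ltW.
by rewrite -/A; lra.
Qed.

Lemma FTC_itv (F f : R -> R) (a b : R) : 0 < a -> a < b ->
  (forall x : R, 0 < x -> is_derive x (1 : R) F (f x)) ->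
  (forall x : R, 0 < x -> {for x, continuous f}) ->
  (\int[mu]_(x in `[a, b]) (f x)%:E = (F b)%:E - (F a)%:E)%E.
Proof.
move=> a0 ab dF cf.
have cF x : 0 < x -> {for x, continuous F}.
  by move=> x0; apply/differentiable_continuous/derivable1_diffP; case: (dF x x0).
apply: continuous_FTC2 => //.
- apply: continuous_in_subspaceT => x; rewrite inE /= in_itv /= => /andP[ax _].
  by apply: cf; exact: lt_le_trans ax.
- split.
  + by move=> x; rewrite in_itv /= => /andP[ax _]; case: (dF x (lt_trans a0 ax)).
  + by apply: cvg_at_right_filter; exact: cF.
  + by apply: cvg_at_left_filter; apply: cF; exact: lt_trans ab.
- move=> x; rewrite in_itv /= => /andP[ax _]; rewrite derive1E.
  by have := dF x (lt_trans a0 ax) => ?; rewrite derive_val.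
Qed.

(** An exhaustion of the half-line by compact intervals; the shift by 2 makes already the first one
    nondegenerate, as [FTC_itv] requires. *)
Let E (n : nat) := `[n.+2%:R^-1 : R, n.+2%:R]%classic.

Let ED n : E n `<=` D.
Proof.
move=> x; rewrite /E /= in_itv /= => /andP[h _]; apply/inD.
by apply: lt_le_trans h; rewrite invr_gt0.
Qed.

Let E_eventually (x : R) : 0 < x -> \forall n \near \oo, E n x.
Proof.
move=> x0; have n1 := nbhs_infty_ger x; have n2 := nbhs_infty_ger x^-1.
near=> n; rewrite /E /= in_itv /=; apply/andP; split.
  rewrite -[leRHS]invrK lef_pV2 ?posrE ?invr_gt0 //.
  apply: (@le_trans _ _ n%:R); first by near: n.
  by rewrite ler_nat; exact: leqW.
apply: (@le_trans _ _ n%:R); first by near: n.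
by rewrite ler_nat; exact: leqW.
Unshelve. all: by end_near. Qed.

Lemma FTC_half_line (F f : R -> R) (A B : R) :
  (forall x : R, 0 < x -> is_derive x (1 : R) F (f x)) ->
  (forall x : R, 0 < x -> {for x, continuous f}) -> integ f ->
  F x @[x --> 0^'+] --> A -> F x @[x --> +oo] --> B ->
  I f = B - A.
Proof.
move=> dF cf intf FA FB.
have mE n : measurable (E n) by exact: measurable_itv.
have En n : (\int[mu]_(x in D) ((EFin \o f) \_ (E n)) x = (F n.+2%:R - F n.+2%:R^-1)%:E)%E.
  rewrite -integral_mkcondr setIidr; last exact: ED.
  rewrite EFinB; apply: (FTC_itv _ _ dF cf) => //.
  apply: (@lt_trans _ _ 1); [by rewrite invf_lt1 // ltr1n|by rewrite ltr1n].
have H : (fun n => (\int[mu]_(x in D) ((EFin \o f) \_ (E n)) x)%E) @ \oo --> (\int[mu]_(x in D) (f x)%:E)%E.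
  apply: (@dominated_cvg _ _ _ mu D mhalf_line (fun n => (EFin \o f) \_ (E n)) (EFin \o f) (abse \o (EFin \o f))).
  - move=> n; apply/(measurable_restrict _ (mE n) mhalf_line).
    by apply: measurable_funS (measurable_int _ intf) => //; exact: subIsetl.
  - move=> x /inD x0; apply: cvg_near_cst; have := E_eventually x0; apply: filterS => n Ex.
    by rewrite patchE mem_set.
  - by move=> x _.
  - exact: integrable_abse.
  - move=> n x _; rewrite patchE; case: ifPn => _ //=.
    by rewrite normr0 lee_fin.
have H2 : (fun n => (F n.+2%:R - F n.+2%:R^-1)%:E) @ \oo --> (B - A)%:E.
  apply: cvg_EFin; first exact: nearW.
  apply: cvgB.
    apply: (cvg_comp _ _ _ FB); apply/cvgryPge => y.
    near=> n; apply: (@le_trans _ _ n%:R); first by near: n; exact: nbhs_infty_ger.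
    by rewrite ler_nat; exact: (leq_trans (leqnSn _) (leqnSn _)).
  move/cvg_at_rightP: FA; apply; split=> [n|]; first by rewrite invr_gt0.
  by have := @cvg_harmonic R; rewrite -cvg_shiftS.
rewrite /Rintegral; apply: EFin_inj; rewrite fineK; last exact: integrable_fin_num.
rewrite -[LHS](cvg_lim _ H) // -[RHS](cvg_lim _ H2) //; congr (limn _).
by apply/funext => n; rewrite En.
Unshelve. all: by end_near. Qed.

(** The integrals of [f] over the intervals [E n] increase to the integral over the half-line and,
    being increments of [F], are at most [2 B]. *)
Lemma integ_ge0_bounded (F f : R -> R) (B : R) :
  (forall x : R, 0 < x -> is_derive x (1 : R) F (f x)) ->
  (forall x : R, 0 < x -> {for x, continuous f}) ->
  (forall x, 0 < x -> 0 <= f x) -> (forall x, 0 < x -> `|F x| <= B) -> integ f.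
Proof.
move=> dF cf f0 FB.
have mE n : measurable (E n) by exact: measurable_itv.
have mf : measurable_fun D f by exact: meas_cont.
have UE : \bigcup_n E n = D.
  apply/seteqP; split=> [x [n _]|x /inD x0]; first exact: ED.
  have [n _ /(_ n (leqnn n)) h] := E_eventually x0; by exists n.
have ndE : nondecreasing_seq E.
  move=> n m nm; apply/subsetPset => x; rewrite /E /= !in_itv /= => /andP[h1 h2].
  apply/andP; split; last by apply: le_trans h2 _; rewrite ler_nat !ltnS.
  by apply: le_trans h1; rewrite lef_pV2 ?posrE // ler_nat !ltnS.
apply/integrableP; split; first exact/measurable_EFinP.
have -> : (\int[mu]_(x in D) `|(EFin \o f) x| = \int[mu]_(x in D) (f x)%:E)%E.
  by apply: eq_integral => x; rewrite inE => /inD x0 /=; rewrite ger0_norm // f0.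
have H : (\int[mu]_(x in E n) (f x)%:E)%E @[n --> \oo] --> (\int[mu]_(x in D) (f x)%:E)%E.
  rewrite -UE; apply: ge0_nondecreasing_set_cvg_integral => //.
  - move=> n; apply/measurable_EFinP; apply: measurable_funS mf => //; exact: ED.
  - by move=> n x /ED/inD x0; rewrite lee_fin f0.
apply: (@le_lt_trans _ _ (B + B)%:E); last exact: ltry.
apply: (cvge_le _ H); apply: nearW => n.
rewrite (FTC_itv _ _ dF cf) //; last first.
  apply: (@lt_trans _ _ 1); [by rewrite invf_lt1 // ltr1n|by rewrite ltr1n].
rewrite -EFinB lee_fin; apply: le_trans (ler_norm _) _; apply: le_trans (ler_normB _ _) _.
by apply: lerD; apply: FB.
Qed.

End half_line.

(** * Rules for derivatives and continuity *)

Section derivatives.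
Context {R : realType}.
Implicit Types (f g : R -> R) (x a b c : R).

Lemma dfun_eq f x a b : is_derive x (1 : R) f a -> a = b -> is_derive x (1 : R) f b.
Proof. by move=> h <-. Qed.
Lemma dfun_ext f g x a : (forall y, f y = g y) -> is_derive x (1 : R) f a -> is_derive x (1 : R) g a.
Proof. by move=> /funext <-. Qed.
Lemma dfunD f g x a b : is_derive x (1 : R) f a -> is_derive x (1 : R) g b ->
  is_derive x (1 : R) (fun y => f y + g y) (a + b).
Proof. by move=> h1 h2; exact: is_deriveD. Qed.
Lemma dfunB f g x a b : is_derive x (1 : R) f a -> is_derive x (1 : R) g b ->
  is_derive x (1 : R) (fun y => f y - g y) (a - b).
Proof. by move=> h1 h2; exact: is_deriveB. Qed.
Lemma dfunM f g x a b : is_derive x (1 : R) f a -> is_derive x (1 : R) g b ->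
  is_derive x (1 : R) (fun y => f y * g y) (a * g x + f x * b).
Proof.
move=> h1 h2; apply: (dfun_eq (is_deriveM h1 h2)).
by rewrite /GRing.scale /= addrC [g x * a]mulrC.
Qed.
Lemma dfunZ f x a c : is_derive x (1 : R) f a ->
  is_derive x (1 : R) (fun y => c * f y) (c * a).
Proof. by move=> h1; exact: is_deriveZ. Qed.
Lemma dfunN f x a : is_derive x (1 : R) f a ->
  is_derive x (1 : R) (fun y => - f y) (- a).
Proof. by move=> h1; exact: is_deriveN. Qed.
Lemma dfun_id x : is_derive x (1 : R) (fun y : R => y) 1.
Proof. exact: is_derive_id. Qed.
Lemma dfun_cst x c : is_derive x (1 : R) (fun y : R => c) 0.
Proof. exact: is_derive_cst. Qed.
Lemma dfun_expR f x a : is_derive x (1 : R) f a ->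
  is_derive x (1 : R) (fun y => expR (f y)) (a * expR (f x)).
Proof. by move=> h; apply: (dfun_eq (is_derive1_comp (is_derive_expR _) h)); exact: mulrC. Qed.
Lemma dfun_cos f x a : is_derive x (1 : R) f a ->
  is_derive x (1 : R) (fun y => cos (f y)) (- (a * sin (f x))).
Proof.
by move=> h; apply: (dfun_eq (is_derive1_comp (is_derive_cos _) h)); rewrite mulNr mulrC.
Qed.
Lemma dfun_sin f x a : is_derive x (1 : R) f a ->
  is_derive x (1 : R) (fun y => sin (f y)) (a * cos (f x)).
Proof. by move=> h; apply: (dfun_eq (is_derive1_comp (is_derive_sin _) h)); exact: mulrC. Qed.
Lemma dfun_cont f x a : is_derive x (1 : R) f a -> {for x, continuous f}.
Proof. by move=> h; apply/differentiable_continuous/derivable1_diffP; case: h. Qed.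

Lemma contD f g x : {for x, continuous f} -> {for x, continuous g} ->
  {for x, continuous (fun y => f y + g y)}.
Proof. by move=> h1 h2; exact: cvgD. Qed.
Lemma contM f g x : {for x, continuous f} -> {for x, continuous g} ->
  {for x, continuous (fun y => f y * g y)}.
Proof. by move=> h1 h2; exact: cvgM. Qed.
Lemma contZ c f x : {for x, continuous f} -> {for x, continuous (fun y => c * f y)}.
Proof. by move=> h; apply: contM => //; exact: cvg_cst. Qed.
Lemma contB f g x : {for x, continuous f} -> {for x, continuous g} ->
  {for x, continuous (fun y => f y - g y)}.
Proof. by move=> h1 h2; exact: cvgB. Qed.

End derivatives.

(** * Polynomials times decaying exponentials *)

Section polyexp.
Context {R : realType}.
Local Notation mu := (@lebesgue_measure R).
Local Notation D := (`]0%R, +oo[%classic : set R).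
Local Notation I f := (\int[mu]_(x in D) f x).
Implicit Types (p q : {poly R}) (c x : R).

Definition polyexp p c : R -> R := fun x => p.[x] * expR (- (c * x)).

Lemma poly_le_exp p c : 0 < c -> exists C, forall x, 0 <= x -> `|p.[x]| <= C * expR (c * x).
Proof.
elim/poly_ind: p c => [|p a IH] c c0.
  by exists 0 => x _; rewrite horner0 normr0 mul0r.
have c2 : 0 < c / 2 by rewrite divr_gt0.
have [C hC] := IH _ c2.
exists (C * (c / 2)^-1 + `|a|) => x x0; rewrite hornerMXaddC.
apply: le_trans (ler_normD _ _) _; rewrite mulrDl; apply: lerD; last first.
  by rewrite ler_peMr // -expR0 ler_expR mulr_ge0 // ltW.
rewrite normrM (ger0_norm x0).
(* Half of the exponent absorbs the polynomial of lower degree, the other half the factor [x]. *)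
have -> : c * x = c / 2 * x + c / 2 * x by field.
rewrite expRD mulrACA; apply: ler_pM => //; first exact: hC.
rewrite mulrC ler_pdivlMr // mulrC; apply: le_trans (expR_ge1Dx _).
by rewrite lerDr.
Qed.

Lemma polyexp_deriv p c x :
  is_derive x (1 : R) (polyexp p c) (polyexp (p^`() - c *: p) c x).
Proof.
apply: (dfun_eq (dfunM (is_derive_poly p x) (dfun_expR (dfunN (dfunZ c (dfun_id x)))))).
by rewrite /polyexp hornerD hornerN hornerZ; ring.
Qed.

Lemma polyexp_cont p c x : {for x, continuous (polyexp p c)}.
Proof. exact: dfun_cont (polyexp_deriv p c x). Qed.

Lemma exp_integ c : 0 < c -> integ (fun x => expR (- (c * x))).
Proof.
move=> c0; apply: (@integ_ge0_bounded _ (fun x => - c^-1 * expR (- (c * x))) _ c^-1).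
- move=> x _; apply: (dfun_eq (dfunZ _ (dfun_expR (dfunN (dfunZ c (dfun_id x)))))).
  by field; rewrite gt_eqF.
- by move=> x _; apply: dfun_cont (dfun_expR (dfunN (dfunZ c (dfun_id x)))).
- by move=> x _; exact: expR_ge0.
- move=> x x0; rewrite normrM normrN normfV (gtr0_norm c0) (ger0_norm (expR_ge0 _)).
  by rewrite ler_piMr ?invr_ge0 ?ltW // -expR0 ltr_expR oppr_lt0 mulr_gt0.
Qed.

Lemma expM_L2 c : 0 < c -> L2r (fun x => expR (- (c * x))).
Proof.
move=> c0; split; first by apply: meas_cont => x _; apply: dfun_cont (dfun_expR (dfunN (dfunZ c (dfun_id x)))).
have c2 : 0 < c + c by rewrite addr_gt0.
apply: eq_integ (exp_integ c2) => x _; rewrite expr2 -expRD; congr expR; ring.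
Qed.

Lemma polyexp_le p c : 0 < c -> exists C, forall x, 0 < x -> `|polyexp p c x| <= `|C * expR (- (c / 2 * x))|.
Proof.
move=> c0; have c2 : 0 < c / 2 by rewrite divr_gt0.
have [C hC] := poly_le_exp p c2; exists C => x x0.
rewrite /polyexp normrM; apply: le_trans (ler_norm _).
rewrite (ger0_norm (expR_ge0 _)).
apply: (@le_trans _ _ (C * expR (c / 2 * x) * expR (- (c * x)))).
  by rewrite ler_wpM2r ?expR_ge0 // hC // ltW.
by rewrite -mulrA -expRD; have -> : c / 2 * x - c * x = - (c / 2 * x) by field.
Qed.

Lemma polyexp_meas p c : measurable_fun D (polyexp p c).
Proof. by apply: meas_cont => x _; exact: polyexp_cont. Qed.

Lemma polyexp_L2 p c : 0 < c -> L2r (polyexp p c).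
Proof.
move=> c0; have [C hC] := polyexp_le p c0.
by apply: (L2r_le (polyexp_meas _ _) hC); apply: L2rZ; apply: expM_L2; rewrite divr_gt0.
Qed.

Lemma polyexp_integ p c : 0 < c -> integ (polyexp p c).
Proof.
move=> c0; have [C hC] := polyexp_le p c0.
apply: (integ_le (polyexp_meas _ _) (g := fun x => `|C| * expR (- (c / 2 * x)))).
  by move=> x /hC; rewrite [`|C * _|]normrM (ger0_norm (expR_ge0 _)).
by apply: integZ; apply: exp_integ; rewrite divr_gt0.
Qed.

Lemma cvg_expMy c : 0 < c -> (fun x => expR (- (c * x))) x @[x --> +oo] --> 0.
Proof.
move=> c0; apply: (cvg_comp (fun x => c * x) (fun y => expR (- y))); last exact: cvgr_expR.
apply/cvgryPge => A; apply: filterS (nbhs_pinfty_ge (num_real (c^-1 * A))) => x.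
by rewrite ler_pdivrMl.
Qed.

Lemma polyexp_cvgy p c : 0 < c -> polyexp p c x @[x --> +oo] --> 0.
Proof.
move=> c0; have c2 : 0 < c / 2 by rewrite divr_gt0.
have [C hC] := polyexp_le p c0.
have h : (fun x => `|C| * expR (- (c / 2 * x))) x @[x --> +oo] --> 0.
  by rewrite -(mulr0 `|C|); apply: cvgMl_tmp; exact: cvg_expMy.
apply/norm_cvg0P; apply: (squeeze_cvgr _ (cvg_cst 0) h).
near=> x; rewrite normr_ge0 /=.
have := hC x; rewrite [`|C * _|]normrM (ger0_norm (expR_ge0 _)); apply.
by near: x; exact: nbhs_pinfty_gt.
Unshelve. all: by end_near. Qed.

Lemma polyexp_cvg0 p c : polyexp p c x @[x --> 0^'+] --> p.[0].
Proof.
have -> : p.[0] = polyexp p c 0 by rewrite /polyexp mulr0 oppr0 expR0 mulr1.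
exact/cvg_at_right_filter/polyexp_cont.
Qed.

(** The integrals in the orthogonality relations and in the norm of the kernel are evaluated by
    writing their integrand as the derivative of some [polyexp p c], so that only the value at 0
    remains. *)
Lemma Int_polyexp_deriv p c : 0 < c -> I (polyexp (p^`() - c *: p) c) = - p.[0].
Proof.
move=> c0; rewrite (@FTC_half_line R (polyexp p c) _ p.[0] 0 (fun x _ => polyexp_deriv p c x)) ?sub0r //.
- by move=> x _; exact: polyexp_cont.
- exact: polyexp_integ.
- exact: polyexp_cvg0.
- exact: polyexp_cvgy.
Qed.

End polyexp.

(** * Laguerre functions *)

Section laguerre.
Context {R : realType}.
Local Notation mu := (@lebesgue_measure R).
Local Notation D := (`]0%R, +oo[%classic : set R).
Local Notation I f := (\int[mu]_(x in D) f x).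

(* [laguerre n] is the Laguerre polynomial L_n evaluated at 2x. *)
Fixpoint laguerre (n : nat) : {poly R} :=
  if n is m.+1 then
    laguerre m - (m.+1%:R^-1)%:P * ('X * (laguerre m *+ 2 - (laguerre m)^`()))
  else 1.

Lemma laguerre0 n : (laguerre n).[0] = 1.
Proof.
elim: n => [|n IH] /=; first by rewrite hornerE.
by rewrite hornerD hornerN IH 2!hornerM hornerX mul0r mulr0 subr0.
Qed.

Let natrVP n : (n.+1%:R^-1)%:P *+ n.+1 = 1 :> {poly R}.
Proof. by rewrite -polyCMn -[_ *+ n.+1]mulr_natr mulVf ?pnatr_eq0. Qed.

Lemma laguerre_rec n :
  'X * (laguerre n *+ 2 - (laguerre n)^`()) = (laguerre n - laguerre n.+1) *+ n.+1.
Proof.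
by rewrite /= opprB addrCA subrr addr0 -mulrnAl natrVP mul1r.
Qed.

(** The second identity is Laguerre's differential equation in the variable 2x. The two are proved
    together: the equation at [n] gives the derivative relation at [n], and both give the equation
    at [n + 1]. *)
Lemma laguerre_deriv_ode n :
  (laguerre n.+1)^`() = (laguerre n)^`() - laguerre n *+ 2 /\
  'X * (laguerre n)^`()^`() = 'X * (laguerre n)^`() *+ 2 - (laguerre n)^`() - laguerre n *+ (2 * n).
Proof.
have step m : 'X * (laguerre m)^`()^`() = 'X * (laguerre m)^`() *+ 2 - (laguerre m)^`() - laguerre m *+ (2 * m) ->
    (laguerre m.+1)^`() = (laguerre m)^`() - laguerre m *+ 2.
  move=> ode; rewrite [LHS]/=.
  rewrite derivB derivM derivC mul0r add0r derivM derivX mul1r derivB derivMn mulrBr ode.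
  rewrite [X in _ * X](_ : _ = laguerre m *+ 2 *+ m.+1); last first.
    rewrite mulrnAr mulrnA [_ *+ m.+1]mulrS; move: (laguerre m *+ 2 *+ m) => z; ring.
  by rewrite mulrnAr -mulrnAl natrVP mul1r.
elim: n => [|n [IH1 IH2]].
  have ode : 'X * (laguerre 0)^`()^`() = 'X * (laguerre 0)^`() *+ 2 - (laguerre 0)^`() - laguerre 0 *+ (2 * 0).
    by rewrite /= derivC linear0 mulr0 mul0rn muln0 mulr0n !subr0.
  by split=> //; exact: step.
suff ode : 'X * (laguerre n.+1)^`()^`() = 'X * (laguerre n.+1)^`() *+ 2 - (laguerre n.+1)^`() - laguerre n.+1 *+ (2 * n.+1).
  by split=> //; exact: step.
have -> : laguerre n.+1 *+ (2 * n.+1) = (laguerre n *+ n.+1 - 'X * (laguerre n *+ 2 - (laguerre n)^`())) *+ 2.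
  rewrite [(2 * _)%N]mulnC mulrnA; congr (_ *+ 2).
  by rewrite laguerre_rec mulrnBl opprB addrCA subrr addr0.
rewrite IH1 derivB derivMn mulrBr IH2 [(2 * n)%N]mulnC mulrnA [_ *+ n.+1]mulrSr.
move: (laguerre n) ((laguerre n)^`()) (laguerre n *+ n) => p p' np.
by ring.
Qed.

Lemma laguerre_deriv n : (laguerre n)^`() - (laguerre n.+1)^`() = laguerre n *+ 2.
Proof. by have [-> _] := laguerre_deriv_ode n; rewrite opprB addrCA subrr addr0. Qed.

(** The primitive of [laguerre n] that vanishes at 0. *)
Definition laghalf n : {poly R} := 2^-1 *: (laguerre n - laguerre n.+1).

Lemma laghalf_deriv n : (laghalf n)^`() = laguerre n.
Proof.
have h : laguerre n *+ 2 = 2 *: laguerre n by rewrite scaler_nat.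
by rewrite /laghalf derivZ derivB laguerre_deriv h scalerA mulVf ?scale1r ?pnatr_eq0.
Qed.

Lemma laghalf0 n : (laghalf n).[0] = 0.
Proof. by rewrite hornerZ hornerD hornerN !laguerre0 subrr mulr0. Qed.

Lemma laguerreSE n : laguerre n.+1 = laguerre n - 2 *: laghalf n.
Proof. by rewrite /laghalf scalerA mulfV // scale1r opprB addrCA subrr addr0. Qed.

Definition lag n : R -> R := polyexp (laguerre n) 1.

Lemma lag_L2 n : L2r (lag n).
Proof. exact: polyexp_L2. Qed.

(** The integral is unchanged when both indices increase by one, because the difference of the
    integrands is the derivative of [2 laghalf k laghalf l] times e^(-2x), which vanishes at both
    ends. This reduces to an index 0, where the product is again an exact derivative. *)
Lemma lag_orthogonal n m : I (fun x => lag n x * lag m x) = (n == m)%:R / 2.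
Proof.
have E k l : I (fun x => lag k x * lag l x) = I (polyexp (laguerre k * laguerre l) 2).
  apply: Int_eq => x _; rewrite /lag /polyexp hornerM mulrACA -expRD; congr (_ * expR _); ring.
have shift k l : I (fun x => lag k.+1 x * lag l.+1 x) = I (fun x => lag k x * lag l x).
  rewrite !E; apply/esym/eqP; rewrite -subr_eq0 -IntB; try exact: polyexp_integ.
  pose r := 2 *: (laghalf k * laghalf l).
  rewrite (Int_eq (g := polyexp (r^`() - 2 *: r) 2)).
    by rewrite Int_polyexp_deriv // /r hornerZ hornerM laghalf0 mul0r mulr0 oppr0.
  move=> x _; rewrite /polyexp -mulrBl -hornerN -hornerD; congr (_.[_] * _).
  by rewrite /r derivZ derivM !laghalf_deriv !laguerreSE -!mul_polyC polyCMn; ring.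
have zero k : I (fun x => lag k.+1 x * lag 0 x) = 0.
  rewrite E mulr1 laguerreSE -{1}(laghalf_deriv k) Int_polyexp_deriv //.
  by rewrite laghalf0 oppr0.
elim: n m => [|n IH] [|m].
- rewrite E mulr1 (_ : laguerre 0 = (- (2^-1)%:P)^`() - 2 *: (- (2^-1)%:P)).
    by rewrite Int_polyexp_deriv // !hornerE opprK.
  by rewrite derivN derivC oppr0 add0r scalerN opprK scale_polyC mulfV.
- rewrite mul0r -[RHS](zero m); apply: Int_eq => x _; exact: mulrC.
- by rewrite mul0r zero.
- by rewrite shift IH.
Qed.

(** The differential relation behind [Dop]: x (1 - d/dx) takes [lag n] to (n+1) times the difference
    of consecutive Laguerre functions. *)
Lemma lag_euler n x : is_derive x (1 : R) (lag n) (polyexp ((laguerre n)^`() - laguerre n) 1 x) /\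
  x * (lag n x - polyexp ((laguerre n)^`() - laguerre n) 1 x) = n.+1%:R * (lag n x - lag n.+1 x).
Proof.
split; first by have := polyexp_deriv (laguerre n) 1 x; rewrite scale1r.
rewrite /lag /polyexp -!mulrBl !mulrA; congr (_ * _).
have := congr1 (fun p => p.[x]) (laguerre_rec n).
rewrite hornerM hornerX hornerMn [in X in _ = X]hornerD [in X in _ = X]hornerN -mulr_natl => <-.
by rewrite !(hornerD, hornerN, hornerMn); ring.
Qed.

End laguerre.

Section complex_integrals.
Context {R : realType}.
Local Notation C := R[i].
Local Notation mu := (@lebesgue_measure R).
Local Notation D := (`]0%R, +oo[%classic : set R).
Local Notation I f := (\int[mu]_(x in D) f x).
Local Notation Re := (@complex.Re R).
Local Notation Im := (@complex.Im R).
Implicit Types (f g h : R -> C) (x : R).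

Definition CL2 f := L2r (fun x => Re (f x)) /\ L2r (fun x => Im (f x)).
Local Notation cint f := (cintegral D f).

Lemma cintE f : cint f = (I (fun x => Re (f x)) +i* I (fun x => Im (f x)))%C.
Proof. by []. Qed.

Lemma CL2D f g : CL2 f -> CL2 g -> CL2 (fun x => f x + g x).
Proof.
move=> [f1 f2] [g1 g2]; split.
  by rewrite (_ : (fun _ => _) = (fun x => Re (f x) + Re (g x))); [exact: L2rD|apply/funext => x; rewrite cReD].
by rewrite (_ : (fun _ => _) = (fun x => Im (f x) + Im (g x))); [exact: L2rD|apply/funext => x; rewrite cImD].
Qed.

Lemma CL2Z c f : CL2 f -> CL2 (fun x => c * f x).
Proof.
move=> [f1 f2]; split.
  rewrite (_ : (fun _ => _) = (fun x => Re c * Re (f x) - Im c * Im (f x))).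
    by apply: L2rB; exact: L2rZ.
  by apply/funext => x; rewrite cReM.
rewrite (_ : (fun _ => _) = (fun x => Re c * Im (f x) + Im c * Re (f x))).
  by apply: L2rD; exact: L2rZ.
by apply/funext => x; rewrite cImM.
Qed.

Lemma CL2P f : CL2 f <-> L2 D (cst 1) f.
Proof.
split=> [[[m1 i1] [m2 i2]]|[m1 m2 ifin]].
  split => //; have /integrableP[_ +] := integD i1 i2.
  apply: le_lt_trans; apply: ge0_le_integral => //.
  - by move=> x _; rewrite lee_fin mulr1 sqr_ge0.
  - apply/measurable_EFinP; rewrite (_ : (fun _ => _) = (fun x => Re (f x) ^+ 2 + Im (f x) ^+ 2)).
      by apply: measurable_funD; exact: measurable_funX.
    by apply/funext => x; rewrite mulr1 normc_sqr.
  - apply: measurableT_comp => //; apply/measurable_EFinP.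
    by apply: measurable_funD; exact: measurable_funX.
  - by move=> x _ /=; rewrite lee_fin mulr1 normc_sqr ler_norm.
have i0 : integ (fun x => Re (f x) ^+ 2 + Im (f x) ^+ 2).
  apply/integrableP; split.
    by apply/measurable_EFinP; apply: measurable_funD; exact: measurable_funX.
  apply: le_lt_trans ifin; rewrite le_eqVlt; apply/orP; left; apply/eqP; apply: eq_integral => x _ /=.
  by rewrite mulr1 normc_sqr ger0_norm // addr_ge0 // sqr_ge0.
split; split => //; apply: integ_le i0 => [|x _]; try exact: measurable_funX.
  by rewrite ger0_norm ?sqr_ge0 // lerDl sqr_ge0.
by rewrite ger0_norm ?sqr_ge0 // lerDr sqr_ge0.
Qed.

End complex_integrals.

(** * Laguerre expansions and the Laplace kernel *)

Section laguerre_expansion.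
Context {R : realType}.
Local Notation C := R[i].
Local Notation mu := (@lebesgue_measure R).
Local Notation D := (`]0%R, +oo[%classic : set R).
Local Notation I f := (\int[mu]_(x in D) f x).
Local Notation Re := (@complex.Re R).
Local Notation Im := (@complex.Im R).
Implicit Types (f : R -> R) (g : R -> C) (x : R) (s : C).

Definition partial_lag (c : nat -> R) m : R -> R := fun x => \sum_(n < m) c n * lag n x.

Lemma partial_lag_L2 c m : L2r (partial_lag c m).
Proof. by apply: L2r_sum => n _; apply: L2rZ; exact: lag_L2. Qed.

Lemma partial_lag_dot c m f : L2r f ->
  I (fun x => partial_lag c m x * f x) = \sum_(n < m) c n * I (fun x => f x * lag n x).
Proof.
move=> Lf; rewrite (Int_eq (g := fun x => \sum_(n < m) c n * (f x * lag n x))); last first.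
  by move=> x _; rewrite mulr_suml; apply: eq_bigr => n _; ring.
rewrite Int_sum => [|n _]; last by apply: integZ; apply: L2rM => //; exact: lag_L2.
by apply: eq_bigr => n _; rewrite IntZ //; apply: L2rM => //; exact: lag_L2.
Qed.

Lemma partial_lag_coef c m n : I (fun x => partial_lag c m x * lag n x) =
  if (n < m)%N then c n / 2 else 0.
Proof.
rewrite partial_lag_dot; last exact: lag_L2.
under eq_bigr do rewrite lag_orthogonal.
case: ltnP => [nm|mn]; last first.
  by rewrite big1 // => i _; rewrite gtn_eqF ?mul0r ?mulr0 // (leq_trans (ltn_ord i)).
rewrite (bigD1 (Ordinal nm)) //= eqxx mul1r big1 ?addr0 // => i ik.
case: eqP => [ni|_]; last by rewrite mul0r mulr0.
by case/eqP: ik; exact: val_inj.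
Qed.

Lemma partial_lag_norm c m : I (fun x => partial_lag c m x ^+ 2) = (\sum_(n < m) c n ^+ 2) / 2.
Proof.
rewrite (Int_eq (g := fun x => partial_lag c m x * partial_lag c m x)); last by move=> x _; rewrite expr2.
rewrite partial_lag_dot; last exact: partial_lag_L2.
rewrite mulr_suml; apply: eq_bigr => n _; rewrite partial_lag_coef ltn_ord; ring.
Qed.

(** The factor 2 compensates for the squared norm 1/2 of [lag n]. *)
Definition lag_coef f n := 2 * I (fun x => f x * lag n x).

Lemma bessel_eq f m : L2r f ->
  I (fun x => (partial_lag (lag_coef f) m x - f x) ^+ 2) =
  I (fun x => f x ^+ 2) - 2 * \sum_(n < m) I (fun x => f x * lag n x) ^+ 2.
Proof.
move=> Lf; set S := partial_lag _ m; have LS : L2r S by exact: partial_lag_L2.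
have [_ iS] := LS; have [_ iF] := Lf.
rewrite (Int_eq (g := fun x => S x ^+ 2 - 2 * (S x * f x) + f x ^+ 2)); last by move=> x _; ring.
have iSf := integZ 2 (L2rM LS Lf).
rewrite IntD ?IntB ?IntZ //; [|exact: L2rM|exact: integB].
rewrite partial_lag_norm partial_lag_dot //.
set Q := \sum_(n < m) I (fun x => f x * lag n x) ^+ 2.
have -> : \sum_(n < m) lag_coef f n ^+ 2 = 4 * Q.
  by rewrite mulr_sumr; apply: eq_bigr => n _; rewrite /lag_coef; ring.
have -> : \sum_(n < m) lag_coef f n * I (fun x => f x * lag n x) = 2 * Q.
  by rewrite mulr_sumr; apply: eq_bigr => n _; rewrite /lag_coef; ring.
by field.
Qed.

Lemma bessel_le f m : L2r f -> 2 * \sum_(n < m) I (fun x => f x * lag n x) ^+ 2 <= I (fun x => f x ^+ 2).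
Proof.
move=> Lf; rewrite -subr_ge0 -bessel_eq //; apply: Int_ge0 => x _; exact: sqr_ge0.
Qed.

Definition kerR s x := expR (- (Re s * x)) * cos (Im s * x).
Definition kerI s x := - (expR (- (Re s * x)) * sin (Im s * x)).

Lemma cexp_kernel s x : cexp (- s * x%:C%C) = (kerR s x +i* kerI s x)%C.
Proof.
case: s => a b; rewrite /cexp /kerR /kerI; apply: complex_eq => /=;
rewrite !mulr0 ?mul0r !(addr0, subr0, add0r) !mulNr ?cosN ?sinN; ring.
Qed.

Lemma kerR_deriv s x : is_derive x (1 : R) (kerR s) (- Re s * kerR s x + Im s * kerI s x).
Proof.
apply: (dfun_eq (dfunM (dfun_expR (dfunN (dfunZ _ (dfun_id x)))) (dfun_cos (dfunZ _ (dfun_id x))))).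
by rewrite /kerR /kerI; ring.
Qed.

Lemma kerI_deriv s x : is_derive x (1 : R) (kerI s) (- Re s * kerI s x - Im s * kerR s x).
Proof.
apply: (dfun_eq (dfunN (dfunM (dfun_expR (dfunN (dfunZ _ (dfun_id x)))) (dfun_sin (dfunZ _ (dfun_id x)))))).
by rewrite /kerR /kerI; ring.
Qed.

Lemma ker_le s x : `|kerR s x| <= expR (- (Re s * x)) /\ `|kerI s x| <= expR (- (Re s * x)).
Proof.
rewrite /kerR /kerI normrN !normrM !(ger0_norm (expR_ge0 _)); split; rewrite ler_piMr ?expR_ge0 // ler_norml.
  by rewrite cos_geN1 cos_le1.
by rewrite sin_geN1 sin_le1.
Qed.

Lemma kerR_L2 s : 0 < Re s -> L2r (kerR s).
Proof.
move=> s0; apply: (L2r_le _ _ (expM_L2 s0)) => [|x _].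
  by apply: meas_cont => x _; exact: dfun_cont (kerR_deriv s x).
by rewrite [leRHS]ger0_norm ?expR_ge0 //; case: (ker_le s x).
Qed.

Lemma kerI_L2 s : 0 < Re s -> L2r (kerI s).
Proof.
move=> s0; apply: (L2r_le _ _ (expM_L2 s0)) => [|x _].
  by apply: meas_cont => x _; exact: dfun_cont (kerI_deriv s x).
by rewrite [leRHS]ger0_norm ?expR_ge0 //; case: (ker_le s x).
Qed.

Lemma ker_norm s : 0 < Re s -> I (fun x => kerR s x ^+ 2) + I (fun x => kerI s x ^+ 2) = (2 * Re s)^-1.
Proof.
move=> s0; have [_ i1] := kerR_L2 s0; have [_ i2] := kerI_L2 s0; rewrite -IntD //.
have c0 : 0 < 2 * Re s by rewrite mulr_gt0.
have := Int_polyexp_deriv (- (2 * Re s)^-1)%:P c0; rewrite hornerC opprK => <-.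
apply: Int_eq => x _; rewrite /polyexp derivC sub0r scale_polyC mulrN mulfV ?gt_eqF // -polyCN opprK hornerC mul1r.
rewrite /kerR /kerI sqrrN !exprMn -mulrDr cos2Dsin2 mulr1 expr2 -expRD; congr expR; ring.
Qed.

Lemma ker_cvgy (p : {poly R}) s : 0 < Re s ->
  (polyexp p 1 x * kerR s x @[x --> +oo] --> 0) /\ (polyexp p 1 x * kerI s x @[x --> +oo] --> 0).
Proof.
move=> s0; have h := polyexp_cvgy p (@ltr01 R); have h' : `|polyexp p 1 x| @[x --> +oo] --> 0 by exact/norm_cvg0P.
have le1 (k : R -> R) x : 0 < x -> `|k x| <= expR (- (Re s * x)) -> `|polyexp p 1 x * k x| <= `|polyexp p 1 x|.
  move=> x0 kx; rewrite normrM ler_piMr // (le_trans kx) // -expR0 ler_expR oppr_le0.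
  by rewrite mulr_ge0 // ltW.
by split; apply/norm_cvg0P; (apply: (squeeze_cvgr _ (cvg_cst 0) h'));
  near=> x; rewrite normr_ge0 /=; apply: le1; [near: x; exact: nbhs_pinfty_gt|case: (ker_le s x)
     |near: x; exact: nbhs_pinfty_gt|case: (ker_le s x)].
Unshelve. all: by end_near. Qed.

(** The real and imaginary parts of one integration by parts: with L(p) the integral of p e^(-x)
    e^(-s x), it reads L(p' - p) = s L(p) - p(0). *)
Lemma ker_parts (p : {poly R}) s : 0 < Re s ->
  let A q := I (fun x => polyexp q 1 x * kerR s x) in
  let B q := I (fun x => polyexp q 1 x * kerI s x) in
  A (p^`() - p) = Re s * A p - Im s * B p - p.[0] /\
  B (p^`() - p) = Re s * B p + Im s * A p.
Proof.
move=> s0 A B; have [h1 h2] := ker_cvgy p s0.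
have iA q := L2rM (polyexp_L2 q ltr01) (kerR_L2 s0).
have iB q := L2rM (polyexp_L2 q ltr01) (kerI_L2 s0).
have d0 x : is_derive x (1 : R) (polyexp p 1) (polyexp (p^`() - p) 1 x).
  by have := polyexp_deriv p 1 x; rewrite scale1r.
have cR x : {for x, continuous (kerR s)} by exact: dfun_cont (kerR_deriv s x).
have cI x : {for x, continuous (kerI s)} by exact: dfun_cont (kerI_deriv s x).
have cA q x : {for x, continuous (fun x => polyexp q 1 x * kerR s x)} by apply: contM => //; exact: polyexp_cont.
have cB q x : {for x, continuous (fun x => polyexp q 1 x * kerI s x)} by apply: contM => //; exact: polyexp_cont.
split.
  have dA x : 0 < x -> is_derive x (1 : R) (fun x => polyexp p 1 x * kerR s x)
     (polyexp (p^`() - p) 1 x * kerR s x - Re s * (polyexp p 1 x * kerR s x) + Im s * (polyexp p 1 x * kerI s x)).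
    move=> _; apply: (dfun_eq (dfunM (d0 x) (kerR_deriv s x))); ring.
  have := FTC_half_line (A := p.[0]) dA _ _ _ h1.
  rewrite IntD ?IntB ?IntZ //; [|exact: integZ|by apply: integB => //; exact: integZ|exact: integZ].
  rewrite -/(A _) -/(A _) -/(B _) => H; apply/eqP; rewrite -subr_eq0; apply/eqP.
  transitivity (A (p^`() - p) - Re s * A p + Im s * B p - (0 - p.[0])); first by ring.
  rewrite H ?subrr //.
  - by move=> x _; apply: contD; [apply: contB => //|]; exact: contZ.
  - by apply: integD; [apply: integB => //; exact: integZ|exact: integZ].
  - have -> : p.[0] = polyexp p 1 0 * kerR s 0.
      by rewrite /polyexp /kerR !mulr0 oppr0 expR0 cos0 !mulr1.
    by apply: cvg_at_right_filter; apply: cvgM; [exact: polyexp_cont|exact: cR].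
have dB x : 0 < x -> is_derive x (1 : R) (fun x => polyexp p 1 x * kerI s x)
   (polyexp (p^`() - p) 1 x * kerI s x - Re s * (polyexp p 1 x * kerI s x) - Im s * (polyexp p 1 x * kerR s x)).
  move=> _; apply: (dfun_eq (dfunM (d0 x) (kerI_deriv s x))); ring.
have := FTC_half_line (A := 0) dB _ _ _ h2.
rewrite IntB ?IntB ?IntZ //; [|exact: integZ|by apply: integB => //; exact: integZ|exact: integZ].
rewrite -/(B _) -/(A _) -/(B _) => H; apply/eqP; rewrite -subr_eq0; apply/eqP.
transitivity (B (p^`() - p) - Re s * B p - Im s * A p - (0 - 0)); first by ring.
rewrite H ?subrr //.
- by move=> x _; apply: contB; [apply: contB => //|]; exact: contZ.
- by apply: integB; [apply: integB => //; exact: integZ|exact: integZ].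
- have : polyexp p 1 x * kerI s x @[x --> 0^'+] --> polyexp p 1 0 * kerI s 0.
    by apply: cvg_at_right_filter; exact: cB.
  by rewrite {2}/kerI !mulr0 sin0 mulr0 oppr0 mulr0.
Qed.

(** Integration by parts on the primitive [laghalf n], which vanishes at 0, divides the transform by
    s + 1. Since [laguerre n.+1] is [laguerre n - 2 laghalf n], each step multiplies by 1 - 2 / (s +
    1) = (s - 1) / (s + 1). *)
Lemma ker_lag s n : 0 < Re s ->
  (I (fun x => kerR s x * lag n x) +i* I (fun x => kerI s x * lag n x))%C =
  ((s - 1) / (s + 1)) ^+ n / (s + 1).
Proof.
move=> s0; pose L q : C := (I (fun x => polyexp q 1 x * kerR s x) +i* I (fun x => polyexp q 1 x * kerI s x))%C.
have s1 : s + 1 != 0.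
  apply/eqP => /(congr1 Re); rewrite cReD /= => h; move: s0; rewrite -(subr0 (Re s)); move: h; lra.
have -> : (I (fun x => kerR s x * lag n x) +i* I (fun x => kerI s x * lag n x))%C = L (laguerre n).
  by congr (_ +i* _)%C; apply: Int_eq => x _; rewrite mulrC.
have iA q := L2rM (polyexp_L2 q ltr01) (kerR_L2 s0).
have iB q := L2rM (polyexp_L2 q ltr01) (kerI_L2 s0).
have Llin c p q : L (p - c *: q) = L p - c%:C%C * L q.
  have E x : polyexp (p - c *: q) 1 x = polyexp p 1 x - c * polyexp q 1 x.
    by rewrite /polyexp hornerD hornerN hornerZ; ring.
  apply: complex_eq; rewrite ?cReD ?cImD ?cReN ?cImN ?cReM ?cImM /= mul0r ?subr0 ?addr0 -IntZ // -IntB //; try exact: integZ;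
  by apply: Int_eq => x _; rewrite E; ring.
have Lparts p : L (p^`() - p) = s * L p - (p.[0])%:C%C.
  have [h1 h2] := ker_parts p s0.
  apply: complex_eq; rewrite ?cReD ?cImD ?cReN ?cImN ?cReM ?cImM /=; [rewrite h1|rewrite h2 oppr0 addr0]; ring.
elim: n => [|n IH].
  rewrite expr0 mul1r; apply: (mulIf s1); rewrite mulVf //.
  have := Lparts 1; have := Llin 1 0 1; rewrite derivC scale1r => -> h.
  have L0 : L 0 = 0.
    by rewrite /L; congr (_ +i* _)%C; rewrite -[RHS](@Int0 R); apply: Int_eq => x _; rewrite /polyexp horner0 !mul0r.
  move: h; rewrite L0 mul1r hornerC sub0r => h.
  by rewrite mulrDr mulr1 mulrC -(subrK 1%:C%C (s * L 1)) -h addrAC addNr add0r.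
have := Lparts (laghalf n); rewrite laghalf_deriv laghalf0 subr0.
have -> : laguerre n - laghalf n = laguerre n - (1 : R) *: laghalf n by rewrite scale1r.
rewrite Llin mul1r.
move=> h; have hu : L (laghalf n) = L (laguerre n) / (s + 1).
  apply: (mulIf s1); rewrite divfK // mulrDr mulr1 mulrC -h subrK //.
rewrite laguerreSE Llin hu IH exprS.
have -> : 2%:C%C = 2 :> C by rewrite rmorph_nat.
by field.
Qed.

End laguerre_expansion.

(** * Completeness and the Laplace transform *)

Section riesz_fischer.
Context {R : realType}.
Local Notation C := R[i].
Local Notation mu := (@lebesgue_measure R).
Local Notation D := (`]0%R, +oo[%classic : set R).
Local Notation I f := (\int[mu]_(x in D) f x).
Implicit Types (f : R -> R) (g : R -> C) (x : R) (s : C).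

Let mD : measurable (D : set (measurableTypeR R)). Proof. exact: mhalf_line. Qed.

Lemma Int_EFin f : integ f -> (\int[mu]_(x in D) (f x)%:E = (I f)%:E)%E.
Proof. by move=> h; rewrite /Rintegral fineK //; exact: integrable_fin_num. Qed.

Lemma integ_ge0_fin f : measurable_fun D f -> (forall x, 0 < x -> 0 <= f x) ->
  (\int[mu]_(x in D) (f x)%:E < +oo)%E -> integ f.
Proof.
move=> mf f0 fin; apply/integrableP; split; first exact/measurable_EFinP.
have -> // : (\int[mu]_(x in D) `|(EFin \o f) x| = \int[mu]_(x in D) (f x)%:E)%E.
by apply: eq_integral => x; rewrite inE => /inD x0 /=; rewrite ger0_norm // f0.
Qed.

(* L^2 is complete: along a rapidly converging subsequence [T k] the series
   of [2^k (T k.+1 - T k)^2] is integrable, hence the subsequence converges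
   almost everywhere, and Fatou's lemma bounds the distance to the limit. *)
Lemma L2r_complete (S : nat -> R -> R) : (forall n, L2r (S n)) ->
  (forall e, 0 < e -> exists N, forall m n, (N <= m)%N -> (N <= n)%N ->
     I (fun x => (S m x - S n x) ^+ 2) <= e) ->
  exists f, L2r f /\ (fun m => I (fun x => (S m x - f x) ^+ 2)) @ \oo --> 0.
Proof.
move=> LS cS.
have e4 (k : nat) : 0 < (4 ^+ k)^-1 :> R by rewrite invr_gt0 exprn_gt0.
have [N0 hN0] := choice (fun k => cS _ (e4 k)).
(* Adding up the thresholds [N0] makes [N] monotone, at least [k] and at least [N0 k]. *)
pose N k := (k + \sum_(j < k.+1) N0 j)%N.
have Nk k : (k <= N k)%N by exact: leq_addr.
have N0N k : (N0 k <= N k)%N.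
  by rewrite /N big_ord_recr /= addnA leq_addl.
have NS k : (N k <= N k.+1)%N.
  by rewrite /N [X in (_ <= _ + X)%N]big_ord_recr /= addnA; apply: leq_trans (leq_addr _ _); rewrite leq_add2r.
pose T k := S (N k).
have LT k : L2r (T k) by exact: LS.
pose d k x := T k.+1 x - T k x.
have Ld k : L2r (d k) by apply: L2rB.
have dk k : I (fun x => d k x ^+ 2) <= (4 ^+ k)^-1.
  by apply: hN0 => //; exact: leq_trans (N0N k) (NS k).
(* The weight 2^k still leaves integrals bounded by 2^k / 4^k = 2^(-k), which are summable. *)
pose u k x := 2 ^+ k * d k x ^+ 2.
have u0 k x : 0 <= u k x by apply: mulr_ge0; [exact: exprn_ge0|exact: sqr_ge0].
have iu k : integ (u k) by apply: integZ; case: (Ld k).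
pose H x := (\sum_(k <oo) (u k x)%:E)%E.
have mH : measurable_fun D H.
  apply: (@ge0_emeasurable_sum _ _ _ D (fun k x => (u k x)%:E) xpredT) => [k x _ _|k _].
    by rewrite lee_fin.
  by apply/measurable_EFinP; exact: integ_meas.
have H0 x : (0 <= H x)%E by apply: nneseries_ge0 => k _ _; rewrite lee_fin.
have iH : mu.-integrable D H.
  apply/integrableP; split => //.
  have -> : (\int[mu]_(x in D) `|H x| = \int[mu]_(x in D) H x)%E.
    by apply: eq_integral => x _; rewrite gee0_abs.
  rewrite integral_nneseries //; last 2 first.
  - by move=> k; apply/measurable_EFinP; exact: integ_meas.
  - by move=> k x _; rewrite lee_fin.
  apply: (@le_lt_trans _ _ (\sum_(k <oo) ((2^-1) ^+ k)%:E)%E).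
    apply: lee_nneseries => [k _ _|k _]; first by apply: integral_ge0 => x _; rewrite lee_fin.
    rewrite Int_EFin // lee_fin IntZ; last by case: (Ld k).
    apply: (@le_trans _ _ (2 ^+ k * (4 ^+ k)^-1)); first by rewrite ler_wpM2l ?exprn_ge0.
    by rewrite -!exprVn -exprMn (_ : 2 * 4^-1 = 2^-1) //; field.
  have -> : (\sum_(k <oo) ((2^-1 : R) ^+ k)%:E)%E = 2%:E.
    apply/cvg_lim => //; rewrite (_ : (fun _ => _) = EFin \o series (geometric 1 2^-1)); last first.
      by apply/funext => n; rewrite /= sumEFin; congr (_%:E); apply: eq_bigr => k _; rewrite /= mul1r.
    apply: cvg_EFin; first exact: nearW.
    have := @cvg_geometric_series R 1 2^-1; rewrite (_ : 1 / (1 - 2^-1) = 2); last by field.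
    by apply; rewrite ger0_norm ?invr_ge0 // invf_lt1 // ltr1n.
  exact: ltry.
have [Z [mZ Z0 ZH]] := integrable_ae mD iH.
have good x : 0 < x -> ~ Z x -> cvgn (fun k => T k x).
  move=> x0 nZ; have Hfin : H x \is a fin_num.
    by apply: contrapT => nH; apply: nZ; apply: ZH => /= /(_ ((inD x).2 x0)).
  have su n : series (u^~ x) n <= fine (H x).
    rewrite -lee_fin fineK // /series /= -sumEFin.
    by apply: nneseries_lim_ge => k _ _; rewrite lee_fin.
  have cu : cvgn (series (u^~ x)).
    apply: nondecreasing_is_cvgn; first by apply: nondecreasing_series => k _ _; exact: u0.
    by exists (fine (H x)) => _ [n _ <-].
  have cd : cvgn (series (d^~ x)).
    (* Completing the square in (2^n |d| - 1)^2 bounds |d| by 2^n d^2 + 2^(-n). *)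
    apply: normed_cvg; apply: (@series_le_cvg _ _ (u^~ x + geometric 1 2^-1)).
    - by move=> n /=; exact: normr_ge0.
    - by move=> n; rewrite addr_ge0 //= mul1r exprn_ge0 // invr_ge0.
    - move=> n /=; rewrite !fctE /= mul1r /u.
      set p := 2 ^+ n; have p0 : 0 < p :> R by rewrite exprn_gt0.
      rewrite exprVn -/p -[X in `|X|]/(d n x); have := sqr_ge0 (p * `|d n x| - 1) => h.
      rewrite -(ler_pM2l p0) mulrDr mulfV ?gt_eqF //.
      have : d n x ^+ 2 = `|d n x| ^+ 2 by rewrite real_normK ?num_real.
      move=> ->; have := mulr_ge0 (ltW p0) (normr_ge0 (d n x)).
      move: h; set q := p * `|d n x|; have -> : p * (p * `|d n x| ^+ 2) = q ^+ 2 by rewrite /q; ring.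
      nra.
    - rewrite (_ : series _ = series (u^~ x) + series (geometric 1 2^-1)).
        apply: is_cvgD => //; apply: is_cvg_geometric_series.
        by rewrite ger0_norm ?invr_ge0 // invf_lt1 // ltr1n.
      by apply/funext => n; rewrite /series /= !fctE big_split.
  have E n : T n x = T 0 x + series (d^~ x) n.
    by rewrite /series /= /d telescope_sumr // addrC subrK.
  under eq_fun do rewrite E.
  apply: is_cvgD => //; exact: is_cvg_cst.
(* The upper limit gives a function measurable on the whole half-line that agrees with the limit off
   the null set [Z]. *)
pose f x := fine (limn_esup (fun k => (T k x)%:E)).
have mT k : measurable_fun D (T k) by case: (LT k).
have mf : measurable_fun D f.
  apply: measurableT_comp => //; apply: measurable_fun_limn_esup => k.
  exact/measurable_EFinP.
have Tf x : 0 < x -> ~ Z x -> T k x @[k --> \oo] --> f x.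
  move=> x0 nZ; have /cvg_ex[l cl] := good x x0 nZ.
  have -> // : f x = l.
  have cE : (T k x)%:E @[k --> \oo] --> l%:E by apply: cvg_EFin => //; exact: nearW.
  by rewrite /f; have [_ ->] := cvg_limn_einf_sup cE.
have main m e : 0 < e -> (forall n, (m <= n)%N -> I (fun x => (S m x - S n x) ^+ 2) <= e) ->
    (\int[mu]_(x in D) ((S m x - f x) ^+ 2)%:E <= e%:E)%E.
  move=> e0 he; have mS : measurable_fun D (S m) by case: (LS m).
  (* Starting the subsequence at [k + m] keeps its indices at least [m], where the hypothesis [he]
     applies. *)
  have mh k : measurable_fun (D : set (measurableTypeR R)) (fun x => ((S m x - T (k + m)%N x) ^+ 2)%:E).
    by apply/measurable_EFinP; apply: measurable_funX; apply: measurable_funB => //; exact: mT.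
  rewrite (ge0_negligible_integral mZ) //; last 2 first.
  - by apply/measurable_EFinP; apply: measurable_funX; exact: measurable_funB.
  - by move=> x _; rewrite lee_fin sqr_ge0.
  have mDZ : measurable (D `\` Z : set (measurableTypeR R)) by exact: measurableD.
  have := @fatou _ _ R mu (D `\` Z) mDZ (fun k x => ((S m x - T (k + m)%N x) ^+ 2)%:E) _ _.
  have -> : (\int[mu]_(x in D `\` Z) limn_einf (fun k => ((S m x - T (k + m)%N x) ^+ 2)%:E) =
      \int[mu]_(x in D `\` Z) ((S m x - f x) ^+ 2)%:E)%E.
    apply: eq_integral => x; rewrite inE => -[/inD x0 nZ].
    have h : ((S m x - T (k + m)%N x) ^+ 2)%:E @[k --> \oo] --> ((S m x - f x) ^+ 2)%:E.
      apply: cvg_EFin; first exact: nearW.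
      have h1 : S m x - T (k + m)%N x @[k --> \oo] --> S m x - f x.
        apply: cvgB; first exact: cvg_cst.
        by rewrite (cvg_shiftn m (fun k => T k x) (nbhs (f x))); exact: Tf.
      by rewrite expr2; under eq_fun do rewrite /= expr2; exact: (cvgM (h1) (h1)).
    by have [-> _] := cvg_limn_einf_sup h.
  move=> hf; apply: (le_trans (hf _ _)).
  - by move=> k; apply: measurable_funS (mh k) => //; exact: subDsetl.
  - by move=> k x _; rewrite lee_fin sqr_ge0.
  rewrite limn_einf_lim; apply: lime_le; first exact: is_cvg_einfs.
  apply: nearW => k; apply: (@le_trans _ _ (\int[mu]_(x in D `\` Z) ((S m x - T (k + m)%N x) ^+ 2)%:E)%E).
    by apply: ereal_inf_lbound; exists k => //=.
  apply: (@le_trans _ _ (\int[mu]_(x in D) ((S m x - T (k + m)%N x) ^+ 2)%:E)%E).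
    apply: ge0_subset_integral => //.
    by move=> x _; rewrite lee_fin sqr_ge0.
  rewrite Int_EFin; last by case: (L2rB (LS m) (LT (k + m)%N)).
  rewrite lee_fin; apply: he; exact: leq_trans (leq_addl _ _) (Nk _).
have isq m e : 0 < e -> (forall n, (m <= n)%N -> I (fun x => (S m x - S n x) ^+ 2) <= e) ->
    integ (fun x => (S m x - f x) ^+ 2).
  move=> e0 he; apply: integ_ge0_fin.
  - by apply: measurable_funX; apply: measurable_funB => //; case: (LS m).
  - by move=> x _; exact: sqr_ge0.
  - exact: le_lt_trans (main m e e0 he) (ltry _).
have Lf : L2r f.
  have [M hM] := cS 1 ltr01.
  have i1 := isq M 1 ltr01 (fun n Mn => hM M n (leqnn M) Mn).
  have L1 : L2r (fun x => S M x - f x).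
    by split => //; apply: measurable_funB => //; case: (LS M).
  have := L2rB (LS M) L1; rewrite (_ : (fun _ => _) = f) //.
  by apply/funext => x; rewrite opprB addrC subrK.
exists f; split => //; apply/cvgrPdist_le => e e0.
have [M hM] := cS e e0; exists M => // m /= Mm.
rewrite sub0r normrN ger0_norm; last by apply: Int_ge0 => x _; exact: sqr_ge0.
have he n : (m <= n)%N -> I (fun x => (S m x - S n x) ^+ 2) <= e.
  by move=> mn; apply: hM => //; exact: leq_trans mn.
by have := main m e e0 he; rewrite Int_EFin ?lee_fin //; exact: isq he.
Qed.

Lemma partial_lagB c m n : (n <= m)%N ->
  I (fun x => (partial_lag c m x - partial_lag c n x) ^+ 2) = (\sum_(n <= k < m) c k ^+ 2) / 2.
Proof.
move=> nm; rewrite (Int_eq (g := fun x => partial_lag (fun k => if (k < n)%N then 0 else c k) m x ^+ 2)).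
  rewrite partial_lag_norm; congr (_ / _).
  rewrite -(big_mkord xpredT (fun k => (if (k < n)%N then 0 else c k) ^+ 2)) (big_cat_nat (n := n)) //=.
  rewrite big_nat_cond big1 ?add0r => [|k /andP[/andP[_ kn] _]]; last by rewrite kn expr0n.
  by apply: eq_big_nat => k /andP[nk _]; rewrite ltnNge nk.
move=> x _; congr (_ ^+ 2); rewrite /partial_lag.
rewrite -(big_mkord xpredT (fun k => c k * lag k x)) -(big_mkord xpredT (fun k => c k * lag k x)).
rewrite -(big_mkord xpredT (fun k => (if (k < n)%N then 0 else c k) * lag k x)).
rewrite (big_cat_nat (n := n)) //= [in RHS](big_cat_nat (n := n)) //= addrAC subrr add0r.
rewrite [X in _ = X + _]big_nat_cond [X in _ = X + _]big1 ?add0r => [|k /andP[/andP[_ kn] _]]; last by rewrite kn mul0r.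
by apply: eq_big_nat => k /andP[nk _]; rewrite ltnNge nk.
Qed.

Lemma riesz_fischer (c : nat -> R) : cvgn (series (fun n => c n ^+ 2)) ->
  exists f, L2r f /\ forall n, I (fun x => f x * lag n x) = c n / 2.
Proof.
move=> cc.
have [||f [Lf hf]] := @L2r_complete (partial_lag c).
- by move=> n; exact: partial_lag_L2.
- move=> e e0.
  have /cvgrPdist_lt/(_ e e0)[N _ hN] := cc.
  pose l := limn (series (fun n => c n ^+ 2)).
  have nd : {homo series (fun n => c n ^+ 2) : n m / (n <= m)%N >-> n <= m}.
    by apply: nondecreasing_series => k _ _; exact: sqr_ge0.
  have bound m n : (N <= n)%N -> (n <= m)%N -> I (fun x => (partial_lag c m x - partial_lag c n x) ^+ 2) <= e.
    move=> Nn nm; rewrite partial_lagB //.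
    have -> : \sum_(n <= k < m) c k ^+ 2 = series (fun n => c n ^+ 2) m - series (fun n => c n ^+ 2) n.
      by rewrite /series /= (big_cat_nat (n := n) (m := 0%N) (p := m)) //= addrAC subrr add0r.
    have h1 := hN n Nn; have h2 := nondecreasing_cvgn_le nd cc m.
    move: h1; rewrite ltr_norml => /andP[_]; rewrite -/l in h2 *; lra.
  exists N => m n Nm Nn; have [nm|/ltnW mn] := leqP n m; first exact: bound.
  rewrite (Int_eq (g := fun x => (partial_lag c n x - partial_lag c m x) ^+ 2)); first exact: bound.
  by move=> x _; rewrite -sqrrN opprB.
exists f; split=> // n.
have h := L2r_cvg (fun m => partial_lag_L2 c m) Lf (lag_L2 n) hf.
have h2 : (fun m => I (fun x => partial_lag c m x * lag n x)) @ \oo --> c n / 2.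
  apply: cvg_near_cst; exists n.+1 => // m /= nm.
  by rewrite partial_lag_coef nm.
by rewrite -(cvg_lim (@Rhausdorff R) h) (cvg_lim (@Rhausdorff R) h2).
Qed.

End riesz_fischer.

(** * Injectivity of the Laplace transform *)

Section laplace_uniqueness.
Context {R : realType}.
Local Notation mu := (@lebesgue_measure R).
Local Notation D := (`]0%R, +oo[%classic : set R).
Local Notation I f := (\int[mu]_(x in D) f x).
Implicit Types (f h k G : R -> R) (x a : R).

Let mD : measurable (D : set (measurableTypeR R)). Proof. exact: mhalf_line. Qed.

Lemma aeS2 (P Q S : R -> Prop) : (forall x, P x -> Q x -> S x) ->
  {ae mu, forall x, P x} -> {ae mu, forall x, Q x} -> {ae mu, forall x, S x}.
Proof.
move=> PQS; have F := ae_filter_ringOfSetsType mu.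
exact: (@filterS2 _ _ F _ _ _ PQS).
Qed.

(** Convergence may fail at one point [a]: in the limit towards the indicator of a ray, this is the
    endpoint of the ray. *)
Lemma Int_dominated (f_ : nat -> R -> R) f G a :
  (forall n, measurable_fun D (f_ n)) -> measurable_fun D f -> integ G ->
  (forall x, 0 < x -> x != a -> f_ n x @[n --> \oo] --> f x) ->
  (forall n x, 0 < x -> `|f_ n x| <= G x) ->
  integ f /\ (fun n => I (f_ n)) @ \oo --> I f.
Proof.
move=> mf_ mf iG cf fG.
have := @dominated_convergence _ _ R mu D mD (fun n => EFin \o f_ n) (EFin \o f) (EFin \o G) _ _ _ iG _.
case.
- by move=> n; apply/measurable_EFinP; exact: mf_.
- exact/measurable_EFinP.
- exists [set a]; split; [exact: measurable_set1|exact: lebesgue_measure_set1|].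
  move=> x /= nx; apply: contrapT => xa; apply: nx => /inD x0.
  by apply: cvg_EFin; [exact: nearW|apply: cf => //; exact/eqP].
- by apply: aeW => x n /inD x0; rewrite /= lee_fin; exact: fG.
move=> intf _ cI; split => //.
rewrite /Rintegral; apply: (fine_cvg (f := fun n => \int[mu]_(x in D) (f_ n x)%:E)%E).
by rewrite fineK //; exact: integrable_fin_num.
Qed.

Let dexp c x : is_derive x (1 : R) (fun y => expR (- (c * y))) (- c * expR (- (c * x))).
Proof.
apply: (dfun_eq (dfun_expR (dfunN (dfunZ c (dfun_id x))))); ring.
Qed.

(** In the power series of exp(-y) with y = e^(n a) e^(-n x), every term is a multiple of some e^(-j
    x), whose integral against [k] vanishes. The partial sums are dominated by exp(e^(n a)) because
    y is at most e^(n a) on the half-line. *)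
Lemma exp_series_null k (n : nat) a : integ k ->
  (forall j : nat, I (fun x => k x * expR (- (j%:R * x))) = 0) ->
  I (fun x => k x * expR (- expR (n%:R * (a - x)))) = 0.
Proof.
move=> ik k0; have mk := integ_meas ik.
pose y x := expR (n%:R * (a - x)).
have y0 x : 0 <= y x by exact: expR_ge0.
have yn x j : y x ^+ j = expR (n%:R * a) ^+ j * expR (- ((n * j)%:R * x)).
  by rewrite /y -!expRM_natl -expRD; congr expR; rewrite natrM; ring.
pose F j x := k x * series (exp_coeff (- y x)) j.
have iF i : integ (fun x => k x * expR (- (i%:R * x))).
  apply: (integ_le _ _ (integrable_norm ik)) => [|x x0].
    apply: measurable_funM => //; apply: meas_cont => x _; exact: dfun_cont (dexp i%:R x).
  rewrite normrM ler_piMr // ger0_norm ?expR_ge0 // -expR0 ler_expR oppr_le0.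
  by rewrite mulr_ge0 // ltW.
have FE j x : F j x = \sum_(i < j) ((-1) ^+ i / i`!%:R * expR (n%:R * a) ^+ i) * (k x * expR (- ((n * i)%:R * x))).
  rewrite /F /series /= big_mkord mulr_sumr; apply: eq_bigr => i _.
  rewrite -[exp_coeff _ i]/((- y x) ^+ i / i`!%:R) [(- y x) ^+ i]exprNn.
  by rewrite (yn x i); ring.
have IF0 j : I (F j) = 0.
  rewrite (Int_eq (g := fun x => \sum_(i < j) ((-1) ^+ i / i`!%:R * expR (n%:R * a) ^+ i) * (k x * expR (- ((n * i)%:R * x))))) //.
  rewrite Int_sum => [|i _]; last by apply: integZ; exact: iF.
  by rewrite big1 // => i _; rewrite IntZ ?k0 ?mulr0 //; exact: iF.
have bound x : 0 < x -> y x <= expR (n%:R * a).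
  by move=> x0; rewrite ler_expR ler_wpM2l // gerBl ltW.
have mF j : measurable_fun D (F j).
  rewrite (_ : F j = fun x => \sum_(i < j) ((-1) ^+ i / i`!%:R * expR (n%:R * a) ^+ i) * (k x * expR (- ((n * i)%:R * x)))).
    by apply: integ_meas; apply: integ_sum => i _; apply: integZ; exact: iF.
  by apply/funext => x; rewrite FE.
have my : measurable_fun D (fun x => expR (- y x)).
  apply: meas_cont => x _; apply: dfun_cont (dfun_expR (dfunN (dfun_expR (dfunZ n%:R (dfunB (dfun_cst x a) (dfun_id x)))))).
have [|||||_ cI] := @Int_dominated F (fun x => k x * expR (- y x)) (fun x => expR (expR (n%:R * a)) * `|k x|) 0.
- exact: mF.
- exact: measurable_funM.
- by apply: integZ; exact: integrable_norm.
- move=> x x0 _; apply: cvgMl_tmp; exact: is_cvg_series_exp_coeff.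
- move=> j x x0; rewrite normrM mulrC ler_wpM2r //.
  apply: (@le_trans _ _ (series (exp_coeff (y x)) j)).
    rewrite /series /=; apply: le_trans (ler_norm_sum _ _ _) _.
    apply: ler_sum => i _; rewrite /exp_coeff /= normrM normfV normr_nat normrX normrN ger0_norm //.
  apply: (@le_trans _ _ (expR (y x))); last by rewrite ler_expR bound.
  apply: nondecreasing_cvgn_le; last exact: is_cvg_series_exp_coeff.
  by apply: nondecreasing_series => i _ _; exact: exp_coeff_ge0.
have E : (fun j => I (F j)) = cst 0 by apply/funext => j; rewrite IF0.
by move: cI; rewrite E => /(cvg_lim (@Rhausdorff R)) <-; exact: lim_cst.
Qed.

(* As n tends to infinity, [expR (- expR (n * (a - x)))] tends to the
   indicator of [a < x]. *)
Lemma exp_null_ray k a : integ k ->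
  (forall j : nat, I (fun x => k x * expR (- (j%:R * x))) = 0) ->
  I (fun x => k x * (a < x)%R%:R) = 0.
Proof.
move=> ik k0; have mk := integ_meas ik.
pose F n x := k x * expR (- expR (n%:R * (a - x))).
have mi : measurable_fun D (fun x => (a < x)%R%:R : R).
  rewrite (_ : (fun _ => _) = \1_(`]a, +oo[%classic : set R)); last first.
    by apply/funext => x; rewrite indicE mem_setE in_itv /= andbT.
  exact: measurable_indic.
have [|||||_ cI] := @Int_dominated F (fun x => k x * (a < x)%R%:R) (fun x => `|k x|) a.
- move=> n; apply: measurable_funM => //; apply: meas_cont => x _.
  exact: dfun_cont (dfun_expR (dfunN (dfun_expR (dfunZ n%:R (dfunB (dfun_cst x a) (dfun_id x)))))).
- exact: measurable_funM.
- exact: integrable_norm.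
- move=> x x0 xa; apply: cvgMl_tmp; have [ax|xle] := ltrP a x.
    have c0 : 0 < x - a by rewrite subr_gt0.
    have h : expR (n%:R * (a - x)) @[n --> \oo] --> 0.
      apply: (cvg_comp (fun n => n%:R) (fun y => expR (y * (a - x))) (G := +oo)).
        exact: cvgr_idn.
      have := cvg_expMy c0; apply: cvg_trans; apply: near_eq_cvg; apply: nearW => y.
      by congr expR; ring.
    have h1 : 1 - expR (n%:R * (a - x)) @[n --> \oo] --> (1 : R).
      by rewrite -[X in _ --> X]subr0; apply: cvgB => //; exact: cvg_cst.
    rewrite /=; apply: (squeeze_cvgr _ h1 (cvg_cst (1 : R))); apply: nearW => n.
    by rewrite expR_ge1Dx -expR0 ler_expR oppr_le0 expR_ge0.
  have c0 : 0 < a - x by rewrite subr_gt0 lt_neqAle xa.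
  apply: (@squeeze_cvgr _ _ _ _ (cst 0) (fun n => expR (- ((a - x) * n%:R)))); last 2 first.
  + exact: cvg_cst.
  + apply: (cvg_comp (fun n => n%:R) (fun y => expR (- ((a - x) * y))) (G := +oo)).
      exact: cvgr_idn.
    exact: cvg_expMy.
  apply: nearW => n; rewrite expR_ge0 /= ler_expR lerN2 mulrC.
  by apply: le_trans (expR_ge1Dx _); rewrite lerDr.
- move=> n x x0; rewrite normrM ler_piMr // ger0_norm ?expR_ge0 // -expR0 ler_expR oppr_le0 expR_ge0.
have E : (fun n => I (F n)) = cst 0 by apply/funext => n; rewrite exp_series_null.
by move: cI; rewrite E => /(cvg_lim (@Rhausdorff R)) <-; exact: lim_cst.
Qed.

(** The integral of [k] over (0, y] is the total integral minus that over the ray beyond y, hence 0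
    for all y; by Lebesgue differentiation [k] vanishes almost everywhere. *)
Lemma ray_null_ae k : integ k -> (forall a, I (fun x => k x * (a < x)%R%:R) = 0) ->
  {ae mu, forall x, 0 < x -> k x = 0}.
Proof.
move=> ik k0; pose K := k \_ D.
have iK : mu.-integrable setT (EFin \o K).
  have := ik; rewrite /integ (@integrable_mkcond _ _ R mu D (EFin \o k) mD).
  by rewrite restrict_EFin.
have iKy (y : R) : mu.-integrable [set` Interval (BRight 0) (BRight y)] (EFin \o K).
  by apply: integrableS iK.
have Iall : I k = 0.
  have := k0 0; rewrite (Int_eq (g := k)) // => x ->; by rewrite mulr1.
have F0 y : \int[mu]_(t in [set` Interval (BRight 0) (BRight y)]) K t = 0.
  rewrite Rintegral_mkcond.
  have -> : (K \_ [set` Interval (BRight 0) (BRight y)]) = (fun x => k x - k x * (y < x)%R%:R) \_ D.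
    apply/funext => x; rewrite /K !patchE !mem_setE !in_itv /= andbT.
    case: ltrP => x0 /=; last by [].
    by case: ltrP => _ /=; rewrite ?mulr1 ?mulr0 ?subrr ?subr0.
  rewrite -Rintegral_mkcond IntB // ?Iall ?k0 ?subrr //.
  apply: integ_le (integrable_norm ik) => [|x x0].
    apply: measurable_funM; first exact: integ_meas.
    rewrite (_ : (fun _ => _) = \1_(`]y, +oo[%classic : set R)); last first.
      by apply/funext => x; rewrite indicE mem_setE in_itv /= andbT.
    exact: measurable_indic.
  by rewrite normrM ler_piMr // normr_nat lern1; case: (y < x).
have lK : locally_integrable setT K by exact: integrable_locally.
have := FTC1 iKy lK; apply: filterS; first exact: (ae_filter_ringOfSetsType mu).
move=> x /= h x0.
have [] := h; first by rewrite lte_fin.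
move=> _; rewrite (_ : (fun _ => _) = cst 0); last by apply/funext => y; exact: F0.
by rewrite derive1_cst /K patchE mem_set //; exact/inD.
Qed.

(** The factor e^(-x) makes [h] integrable and turns the exponents [n + 1] into all [j >= 0],
    including the constant 1. *)
Lemma laplace_null_ae h : L2r h ->
  (forall n : nat, I (fun x => h x * expR (- (n.+1%:R * x))) = 0) ->
  {ae mu, forall x, 0 < x -> h x = 0}.
Proof.
move=> Lh h0; pose k x := h x * expR (- (1 * x)).
have ik : integ k by apply: L2rM => //; exact: expM_L2.
have : {ae mu, forall x, 0 < x -> k x = 0}.
  apply: ray_null_ae => // a; apply: exp_null_ray => // j.
  rewrite -[RHS](h0 j); apply: Int_eq => x _; rewrite /k -mulrA -expRD; congr (_ * expR _).
  by rewrite -natr1; ring.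
apply: filterS; first exact: (ae_filter_ringOfSetsType mu).
move=> x hk x0; apply: (mulIf (x := expR (- (1 * x)))); first by rewrite gt_eqF ?expR_gt0.
by rewrite mul0r; exact: hk.
Qed.

End laplace_uniqueness.

(** * The Laplace transform in Laguerre coordinates *)

Section paley_wiener.
Context {R : realType}.
Local Notation C := R[i].
Local Notation mu := (@lebesgue_measure R).
Local Notation D := (`]0%R, +oo[%classic : set R).
Local Notation I f := (\int[mu]_(x in D) f x).
Local Notation Re := (@complex.Re R).
Local Notation Im := (@complex.Im R).
Implicit Types (g : R -> C^o) (x : R) (s : C).

Definition lag_dot g n : C := (I (fun x => Re (g x) * lag n x) +i* I (fun x => Im (g x) * lag n x))%C.

(* The coordinates of [g] in the orthonormal basis of L^2(0, +oo) that the
   Laplace transform maps to a multiple of the image of [(z^n)] in H^2(C_+). *)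
Definition psi g : nat -> C^o := fun n => (Num.sqrt 2)%:C%C * lag_dot g n.

Lemma psi_sqsummable g : CL2 g -> psi g \in sqsummable (R := R).
Proof.
move=> [L1 L2]; apply: (@sqsummable_bounded _ _ (I (fun x => Re (g x) ^+ 2) + I (fun x => Im (g x) ^+ 2))) => n.
apply: le_trans (lerD (bessel_le n L1) (bessel_le n L2)).
rewrite -mulrDr -big_split [leLHS]big_mkord mulr_sumr; apply: ler_sum => i _.
by rewrite /psi normcM exprMn normcR real_normK ?num_real // sqr_sqrtr // normc_sqr.
Qed.

Lemma lag_dotP c g g' n : CL2 g -> CL2 g' ->
  lag_dot (fun x => c * g x + g' x) n = c * lag_dot g n + lag_dot g' n.
Proof.
move=> [g1 g2] [g1' g2']; have Ll := lag_L2 n (R := R).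
have i1 := L2rM g1 Ll; have i2 := L2rM g2 Ll; have i1' := L2rM g1' Ll; have i2' := L2rM g2' Ll.
apply: complex_eq; rewrite ?cReD ?cImD ?cReM ?cImM /= -!IntZ //.
  rewrite -IntB -?IntD //; try (by apply: integB => //; exact: integZ); try exact: integZ.
  by apply: Int_eq => x _; rewrite cReD cReM; ring.
rewrite -!IntD //; try (by apply: integD => //; exact: integZ); try exact: integZ.
by apply: Int_eq => x _; rewrite cImD cImM; ring.
Qed.

Lemma psiP c g g' n : CL2 g -> CL2 g' ->
  psi (fun x => c * g x + g' x) n = c * psi g n + psi g' n.
Proof. by move=> h1 h2; rewrite /psi lag_dotP // mulrDr mulrCA. Qed.

Lemma psi_surjective (a : nat -> C^o) : a \in sqsummable (R := R) ->
  exists2 g, CL2 g & psi g = a.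
Proof.
move=> sa; have := sa; rewrite inE /= => ca.
(* The prescribed values are scaled by the root of 2: [riesz_fischer] returns them halved and [psi]
   multiplies by the root of 2 once more. *)
have cs (F : C -> R) : (forall z, `|F z| <= normc z) -> cvgn (series (fun n => (Num.sqrt 2 * F (a n)) ^+ 2)).
  move=> hF; rewrite (_ : (fun _ => _) = 2 *: (fun n => F (a n) ^+ 2)); last first.
    by apply/funext => n; rewrite exprMn sqr_sqrtr.
  rewrite seriesZ; apply: is_cvgZl_tmp; apply: (series_le_cvg _ _ _ ca) => n; try exact: sqr_ge0.
  by rewrite -[leLHS]real_normK ?num_real // ler_sqr ?nnegrE ?normc_ge0.
have [f1 [L1 h1]] := riesz_fischer (cs Re (@normRe_le R)).
have [f2 [L2 h2]] := riesz_fischer (cs Im (@normIm_le R)).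
exists (fun x => (f1 x +i* f2 x)%C) => //; apply/funext => n.
rewrite /psi /lag_dot /= h1 h2.
have s2 : Num.sqrt 2 * Num.sqrt 2 = 2 :> R by rewrite -expr2 sqr_sqrtr.
by apply: complex_eq; rewrite ?cReM ?cImM /= mul0r ?subr0 ?addr0 !mulrA s2; field.
Qed.

Lemma disc_map_lt1 s : 0 < Re s -> normc ((s - 1) / (s + 1)) ^+ 2 < 1.
Proof.
move=> s0; rewrite normcM normcV exprMn exprVn ltr_pdivrMr ?mul1r.
  rewrite !normc_sqr !cReD !cImD cReN cImN /=; nra.
rewrite normc_sqr cReD cImD /=; nra.
Qed.

(** By [ker_lag] the squared coefficients of the kernel form a geometric progression of ratio q =
    |(s - 1) / (s + 1)|^2, and (1 - q) |s + 1|^2 = 4 Re s makes the full sum equal to the squared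
    norm of the kernel. The remainder is therefore explicit and tends to 0. *)
Lemma ker_bessel s m : 0 < Re s ->
  I (fun x => (partial_lag (lag_coef (kerR s)) m x - kerR s x) ^+ 2) +
  I (fun x => (partial_lag (lag_coef (kerI s)) m x - kerI s x) ^+ 2) =
  (normc ((s - 1) / (s + 1)) ^+ 2) ^+ m / (2 * Re s).
Proof.
move=> s0; have LR := kerR_L2 s0; have LI := kerI_L2 s0.
rewrite !bessel_eq //; set q := normc _ ^+ 2.
have q1 : q < 1 by exact: disc_map_lt1.
have qn1 : q != 1 by rewrite lt_eqF.
have N0 : normc (s + 1) ^+ 2 != 0.
  by rewrite normc_sqr cReD cImD /= gt_eqF //; nra.
have sum : \sum_(n < m) I (fun x => kerR s x * lag n x) ^+ 2 + \sum_(n < m) I (fun x => kerI s x * lag n x) ^+ 2 =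
   (1 - q ^+ m) / (1 - q) / normc (s + 1) ^+ 2.
  rewrite -big_split /=.
  have := congr1 (fun u => u m) (geometric_seriesE 1 qn1); rewrite /series /= big_mkord mul1r => <-.
  rewrite mulr_suml; apply: eq_bigr => n _.
  have := congr1 (fun z => normc z ^+ 2) (ker_lag n s0); rewrite [in LHS]normc_sqr /= => ->.
  rewrite normcM normcV exprMn exprVn mul1r /q; congr (_ / _).
  have -> : normc (((s - 1) / (s + 1)) ^+ n) = normc ((s - 1) / (s + 1)) ^+ n.
    by elim: (nat_of_ord n) => [|j IH]; rewrite ?expr0 ?normc1 // !exprS normcM IH.
  by rewrite -!exprM mulnC.
have := ker_norm s0 => kn.
rewrite addrACA kn -opprD -mulrDr sum.
have qE : (1 - q) * normc (s + 1) ^+ 2 = 4 * Re s.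
  rewrite mulrBl mul1r /q normcM normcV exprMn exprVn divfK // !normc_sqr !cReD !cImD cReN cImN /=; ring.
rewrite -mulrA -invfM qE; field; rewrite gt_eqF //.
Qed.

(** Expanding the kernel, which converges in L^2 by [ker_bessel], turns the Laplace integral of [g]
    into a power series in (s - 1) / (s + 1) with the Laguerre coordinates of [g] as
    coefficients. *)
Lemma laplace_psi g s (f : hardy R) : CL2 g -> 0 < Re s -> hcoef f = psi g ->
  laplace g s = disc_to_half_plane f s.
Proof.
move=> [g1 g2] s0 fg; have LR := kerR_L2 s0; have LI := kerI_L2 s0.
set w := (s - 1) / (s + 1).
have s1 : s + 1 != 0.
  apply/eqP => /(congr1 Re); rewrite cReD /= => h; move: s0 h; lra.
have Ilim (k : R -> R) : L2r k -> I (fun x => (partial_lag (lag_coef k) m x - k x) ^+ 2) @[m --> \oo] --> 0 ->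
   forall v, L2r v -> I (fun x => partial_lag (lag_coef k) m x * v x) @[m --> \oo] --> I (fun x => k x * v x).
  by move=> Lk h v Lv; apply: L2r_cvg => // n; exact: partial_lag_L2.
have c0 : (normc w ^+ 2) ^+ m / (2 * Re s) @[m --> \oo] --> 0.
  rewrite -(mul0r (2 * Re s)^-1); apply: cvgMr_tmp; apply: cvg_expr.
  by rewrite ger0_norm ?sqr_ge0 //; exact: disc_map_lt1.
have cR : I (fun x => (partial_lag (lag_coef (kerR s)) m x - kerR s x) ^+ 2) @[m --> \oo] --> 0.
  apply: (squeeze_cvgr _ (cvg_cst 0) c0); apply: nearW => m.
  by rewrite Int_ge0 => [|x _]; rewrite ?sqr_ge0 // -ker_bessel // lerDl Int_ge0 // => x _; exact: sqr_ge0.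
have cI : I (fun x => (partial_lag (lag_coef (kerI s)) m x - kerI s x) ^+ 2) @[m --> \oo] --> 0.
  apply: (squeeze_cvgr _ (cvg_cst 0) c0); apply: nearW => m.
  by rewrite Int_ge0 => [|x _]; rewrite ?sqr_ge0 // -ker_bessel // lerDr Int_ge0 // => x _; exact: sqr_ge0.
have LE : laplace g s = ((I (fun x => kerR s x * Re (g x)) - I (fun x => kerI s x * Im (g x))) +i*
   (I (fun x => kerI s x * Re (g x)) + I (fun x => kerR s x * Im (g x))))%C.
  rewrite /laplace cintE -IntB -?IntD; try exact: L2rM.
  congr (_ +i* _)%C; apply: Int_eq => x _; rewrite cexp_kernel ?cReM ?cImM /=; ring.
pose r2 : C := (Num.sqrt 2)%:C%C.
have r20 : r2 != 0.
  by apply/eqP => /complexI/eqP; rewrite sqrtr_eq0 leNgt ltr0n.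
have termE m : r2 / (s + 1) * series (fun n => f n * w ^+ n : C^o) m =
   ((I (fun x => partial_lag (lag_coef (kerR s)) m x * Re (g x)) - I (fun x => partial_lag (lag_coef (kerI s)) m x * Im (g x))) +i*
   (I (fun x => partial_lag (lag_coef (kerI s)) m x * Re (g x)) + I (fun x => partial_lag (lag_coef (kerR s)) m x * Im (g x))))%C.
  have -> : r2 / (s + 1) * series (fun n => f n * w ^+ n : C^o) m = \sum_(n < m) 2 * (lag_dot g n * (w ^+ n / (s + 1))).
    rewrite /series /= big_mkord mulr_sumr; apply: eq_bigr => n _.
    rewrite fg /psi -/r2.
    (* One factor belongs to [psi], the other to the map U. *)
    have -> : 2 = r2 * r2 :> C by rewrite /r2 -rmorphM -expr2 sqr_sqrtr // rmorph_nat.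
    ring.
  rewrite !partial_lag_dot //.
  apply: complex_eq; rewrite ?cRe_sum ?cIm_sum /= -?sumrB -?big_split /=; apply: eq_bigr => n _;
    rewrite -(ker_lag n s0) -[2](@rmorph_nat _ _ (real_complex R)) ?cReM ?cImM /lag_coef /=; ring.
have cT : (fun m => r2 / (s + 1) * series (fun n => f n * w ^+ n : C^o) m) @ \oo --> (laplace g s : C^o).
  apply/cvg_complexP; rewrite LE; split => /=.
    under eq_fun do rewrite termE /=; apply: cvgB; exact: Ilim.
  by under eq_fun do rewrite termE /=; apply: cvgD; exact: Ilim.
rewrite /disc_to_half_plane /hardy_fun -/w [1 + s]addrC -/r2.
have := cvg_complexZ (c := (r2 / (s + 1))^-1) cT.
have rs0 : r2 / (s + 1) != 0 by rewrite mulf_neq0 ?invr_eq0.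
rewrite (_ : (fun _ => _) = series (fun n => f n * w ^+ n : C^o)); last first.
  by apply/funext => m; rewrite mulKf.
by move=> /cseriesP ->; rewrite mulVKf.
Qed.

(** Evaluation at the positive integers suffices; the kernel is real there, so real and imaginary
    parts separate. *)
Lemma laplace_inj g g' : CL2 g -> CL2 g' ->
  (forall s, 0 < Re s -> laplace g s = laplace g' s) ->
  {ae mu, forall x, 0 < x -> g x = g' x}.
Proof.
move=> [g1 g2] [g1' g2'] h.
have lapE (u : R -> C) (n : nat) : CL2 u -> laplace u (n.+1%:R)%:C%C =
   (I (fun x => Re (u x) * expR (- (n.+1%:R * x))) +i* I (fun x => Im (u x) * expR (- (n.+1%:R * x))))%C.
  move=> _; rewrite /laplace cintE; congr (_ +i* _)%C; apply: Int_eq => x _;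
  by rewrite cexp_kernel /kerR /kerI /= mul0r cos0 sin0 mulr0 oppr0 ?cReM ?cImM /=; ring.
have L (n : nat) : L2r (fun x => expR (- (n.+1%:R * x)) : R) by exact: expM_L2.
have hn n := h (n.+1%:R)%:C%C (ltr0Sn R n).
have h1 : {ae mu, forall x, 0 < x -> Re (g x) - Re (g' x) = 0}.
  apply: laplace_null_ae => [|n]; first exact: L2rB.
  have := congr1 Re (hn n); rewrite !lapE //= => E.
  rewrite (Int_eq (g := fun x => Re (g x) * expR (- (n.+1%:R * x)) - Re (g' x) * expR (- (n.+1%:R * x)))).
    by rewrite IntB ?E ?subrr //; exact: L2rM.
  by move=> x _; rewrite mulrBl.
have h2 : {ae mu, forall x, 0 < x -> Im (g x) - Im (g' x) = 0}.
  apply: laplace_null_ae => [|n]; first exact: L2rB.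
  have := congr1 Im (hn n); rewrite !lapE //= => E.
  rewrite (Int_eq (g := fun x => Im (g x) * expR (- (n.+1%:R * x)) - Im (g' x) * expR (- (n.+1%:R * x)))).
    by rewrite IntB ?E ?subrr //; exact: L2rM.
  by move=> x _; rewrite mulrBl.
apply: aeS2 h1 h2 => x k1 k2 x0; apply: complex_eq; apply/eqP; rewrite -subr_eq0; apply/eqP; [exact: k1|exact: k2].
Qed.

End paley_wiener.

(** * The exponential change of variables *)

Section change_of_variables.
Context {R : realType}.
Local Notation T := (measurableTypeR R).
Local Notation mu := (@lebesgue_measure R).
Local Notation D := (`]0%R, +oo[%classic : set R).
Local Open Scope ereal_scope.

Let mD : measurable (D : set T). Proof. exact: mhalf_line. Qed.

Let mexp (A : set R) : measurable_fun (A : set T) (fun y : T => (expR y)%:E).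
Proof. by apply/measurable_EFinP; exact: measurable_funS (@measurable_expR R). Qed.

(** The image under [ln] of Lebesgue measure on the half-line, given by its density. *)
Definition exp_measure (A : set T) : \bar R := \int[mu]_(y in A) (expR y)%:E.

Let exp_measure0 : exp_measure set0 = 0.
Proof. exact: integral_set0. Qed.

Let exp_measure_ge0 A : 0 <= exp_measure A.
Proof. by apply: integral_ge0 => y _; rewrite lee_fin expR_ge0. Qed.

Let exp_measure_sigma_additive : semi_sigma_additive exp_measure.
Proof.
move=> /= F mF tF mUF; rewrite /exp_measure; apply: cvg_toP.
  apply: ereal_nondecreasing_is_cvgn => m n mn.
  apply: lee_sum_nneg_natr => // k _ _; exact: exp_measure_ge0.
by rewrite ge0_integral_bigcup //= => y _; rewrite lee_fin expR_ge0.
Qed.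

HB.instance Definition _ := isMeasure.Build _ T R exp_measure
  exp_measure0 exp_measure_ge0 exp_measure_sigma_additive.

Let mln : measurable_fun [set: T] (@ln R : T -> T). Proof. exact: measurable_ln. Qed.

Lemma ln_preimage_itv (a b : R) :
  (@ln R) @^-1` `]a, b]%classic `&` D = `]expR a, expR b]%classic.
Proof.
apply/seteqP; split => x /=; rewrite !in_itv /= ?andbT.
  by move=> [/andP[h1 h2] x0]; rewrite -(lnK x0) ltr_expR ler_expR h1 h2.
move=> /andP[h1 h2]; have x0 : (0 < x)%R by exact: lt_trans (expR_gt0 a) h1.
by split => //; rewrite -ltr_expR -ler_expR (lnK x0) h1 h2.
Qed.

Lemma exp_measure_itv (a b : R) : exp_measure `]a, b]%classic = mu ((@ln R) @^-1` `]a, b]%classic `&` D).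
Proof.
have [ab|ba] := ltrP a b; last first.
  rewrite set_itv_ge ?bnd_simp -?leNgt // exp_measure0 preimage_set0 set0I.
  by rewrite measure0.
rewrite ln_preimage_itv lebesgue_measure_itv /= lte_fin ltr_expR ab -EFinB.
rewrite /exp_measure integral_itv_obnd_cbnd //.
rewrite (@continuous_FTC2 _ _ expR) //.
- by apply: continuous_subspaceT => x; exact: continuous_expR.
- split; first by move=> x _; exact: derivable_expR.
    by apply: cvg_at_right_filter; exact: continuous_expR.
  by apply: cvg_at_left_filter; exact: continuous_expR.
- by move=> x _; rewrite derive1E derive_val.
- exact: mexp.
Qed.

(** The two measures agree on half-open intervals, by the fundamental theorem of calculus for
    [expR]; these generate the measurable sets, and countably many of finite measure cover the
    line. *)
Lemma exp_measureE (A : set T) : measurable A ->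
  exp_measure A = mu ((@ln R) @^-1` A `&` D).
Proof.
move=> mA; pose m2 : {measure set T -> \bar R} := (pushforward (mrestr mu mD) (@ln R : T -> T) : measure T R).
have := @measure_unique _ R T (@ocitv R) (fun n : nat => `](- n%:R)%R, n%:R%R]%classic) _ _ _ _ exp_measure (m2 mln) _ _ A mA; apply => //.
- exact: ocitvI.
- by move=> n; exact: is_ocitv.
- by rewrite bigcup_itvT.
- by move=> _ [[a b] _ <-]; exact: exp_measure_itv.
- move=> k; rewrite /= (exp_measure_itv _ _).
  by rewrite ln_preimage_itv lebesgue_measure_itv /=; case: ifP => // _; rewrite ltry.
Qed.

Import HBNNSimple.

Lemma ge0_integral_exp (f : R -> \bar R) : measurable_fun (setT : set T) f ->
  (forall y, 0 <= f y) ->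
  (* The substitution x = e^y: monotone approximation by simple functions reduces it to sets, where
     it is [exp_measureE]. *)
  \int[mu]_y (f y * (expR y)%:E) = \int[mu]_(x in D) f (ln x).
Proof.
move=> mf f0; pose h := nnsfun_approx (@measurableT _ T) mf.
have ndh a b y : (a <= b)%N -> (h a y <= h b y)%R.
  by move=> ab; exact/lefP/nd_nnsfun_approx.
have cf y : (h n y)%:E @[n --> \oo] --> f y by exact: cvg_nnsfun_approx.
have mh n : measurable_fun (setT : set T) (EFin \o h n).
  exact/measurable_EFinP.
have mhk n k : measurable (h n @^-1` [set k] : set T) by [].
have e0 (y : R) : 0 <= (expR y)%:E by rewrite lee_fin expR_ge0.
have -> : \int[mu]_y (f y * (expR y)%:E) =
    lim (\int[mu]_y ((h n y)%:E * (expR y)%:E) @[n --> \oo]).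
  rewrite -monotone_convergence //.
  - apply: eq_integral => y _; apply/esym/cvg_lim => //.
    exact: cvgeZr (cf y).
  - by move=> n; apply: (@emeasurable_funM _ T R); [exact: mh|exact: mexp].
  - by move=> n y _; rewrite mule_ge0 ?lee_fin.
  - move=> y _ a b ab; rewrite lee_wpmul2r ?lee_fin //; exact: ndh.
have -> : \int[mu]_(x in D) f (ln x) =
    lim (\int[mu]_(x in D) (h n (ln x))%:E @[n --> \oo]).
  rewrite -monotone_convergence //.
  - by apply: eq_integral => x _; apply/esym/cvg_lim => //; exact: cf.
  - move=> n; apply: measurable_funS (measurableT_comp (mh n) mln) => //.
  - by move=> n x _; rewrite lee_fin.
  - by move=> x _ a b ab; rewrite lee_fin; exact: ndh.
congr (limn _); apply/funext => n.
transitivity (\sum_(k \in range (h n)) (k%:E * mu ((@ln R) @^-1` (h n @^-1` [set k]) `&` D))).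
  under eq_integral => y _.
    rewrite (fimfunE (h n) y) -fsumEFin // ge0_mule_fsuml; last first.
      by move=> k; exact: nnfun_muleindic_ge0.
    over.
  rewrite ge0_integral_fsum //; last 2 first.
  - move=> k; apply: emeasurable_funM; last exact: mexp.
    apply/measurable_EFinP; apply: measurable_funM => //.
  - by move=> k y _; rewrite mule_ge0 ?nnfun_muleindic_ge0.
  apply: eq_fsbigr => k /[!inE] -[y0 _ <-].
  rewrite -exp_measureE // /exp_measure.
  under eq_integral do rewrite EFinM -muleA.
  rewrite ge0_integralZl ?lee_fin //; last first.
    by apply: emeasurable_funM; [exact/measurable_EFinP|exact: mexp].
  congr (_ * _); rewrite [RHS]integral_mkcond; apply: eq_integral => y _.
  by rewrite epatch_indic muleC.
under [RHS]eq_integral => x _ do rewrite (fimfunE (h n) (ln x)) -fsumEFin //.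
rewrite ge0_integral_fsum //; last 2 first.
- move=> k; apply/measurable_EFinP; apply: measurable_funM => //.
  apply: measurable_funS (measurableT_comp _ mln) => //.
- by move=> k x _; exact: nnfun_muleindic_ge0.
apply: eq_fsbigr => k /[!inE] -[y0 _ <-].
under eq_integral do rewrite EFinM.
rewrite ge0_integralZl ?lee_fin //; last first.
  apply/measurable_EFinP; apply: measurable_funS (measurableT_comp _ mln) => //.
congr (_ * _).
rewrite (_ : (fun x => _) = (fun x => (\1_((@ln R) @^-1` (h n @^-1` [set h n y0])) x)%:E)) //.
rewrite integral_indic //.
by rewrite -[X in measurable X]setTI; exact: mln.
Qed.

(** The preimage under [expR] of a null set has [exp_measure] 0, and a set on which a positive
    density integrates to 0 is null. *)
Lemma ae_expR (P : R -> Prop) : {ae mu, forall x, (0 < x)%R -> P x} ->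
  {ae mu, forall y, P (expR y)}.
Proof.
move=> [N [mN N0 PN]]; exists ((@expR R) @^-1` N).
have mA : measurable ((@expR R) @^-1` N : set T).
  by rewrite -[X in measurable X]setTI; exact: (@measurable_expR R measurableT).
split => //; last first.
  by move=> y /= Py; apply: PN => h; apply: Py; apply: h; exact: expR_gt0.
have A0 : exp_measure ((@expR R) @^-1` N) = 0.
  apply/eqP; rewrite eq_le measure_ge0 andbT -N0 exp_measureE //.
  apply: le_measure; rewrite ?inE //.
    apply: measurableI => //; rewrite -[X in measurable X]setTI.
    exact: (mln measurableT).
  by move=> x [/= xN /inD x0]; rewrite lnK in xN.
have : \int[mu]_(y in (@expR R) @^-1` N) `|(expR y)%:E| = 0.
  by rewrite -A0; apply: eq_integral => y _; rewrite /= ger0_norm ?expR_ge0.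
have H := @ae_eq_integral_abs _ T R mu _ mA (fun y => (expR y)%:E) (@mexp _).
move=> /H [N' [mN' N'0 AN']].
apply/eqP; rewrite eq_le measure_ge0 andbT -N'0; apply: le_measure; rewrite ?inE //.
by move=> y yA; apply: AN' => /= /(_ yA) [] /eqP; rewrite gt_eqF ?expR_gt0.
Qed.

Lemma ae_ln (P : R -> Prop) : {ae mu, forall y, P y} ->
  {ae mu, forall x, (0 < x)%R -> P (ln x)}.
Proof.
move=> [N [mN N0 PN]]; exists ((@ln R) @^-1` N `&` D); split.
- apply: measurableI => //; rewrite -[X in measurable X]setTI.
  exact: (mln measurableT).
- rewrite -exp_measureE //; apply: null_set_integral => //; exact: mexp.
- move=> x /= nx; have x0 : (0 < x)%R by apply: contrapT => x0; apply: nx.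
  by split; [apply: PN => Px; apply: nx|exact/inD].
Qed.

Lemma Tinv_L2 (g : R -> R[i]^o) : CL2 g -> L2 setT weight (Wmul (Tinv g)).
Proof.
move=> [[m1 i1] [m2 i2]].
have mc (k : R -> R) : measurable_fun D k -> measurable_fun setT (fun y : R => k (expR y)).
  move=> /(measurable_restrictT _ mD) mk.
  rewrite (_ : (fun y => _) = (k \_ D) \o (@expR R)).
    exact: measurableT_comp (@measurable_expR R).
  apply/funext => y; rewrite /= patchE mem_set //; apply/inD; exact: expR_gt0.
have mW : measurable_fun setT (fun y : R => expR (expR y - 1) * expR (y / 2))%R.
  apply: continuous_measurable_fun => y.
  exact: dfun_cont (dfunM (dfun_expR (dfunB (dfun_expR (dfun_id y)) (dfun_cst y 1%R))) (dfun_expR (dfunM (dfun_id y) (dfun_cst y (2^-1)%R)))).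
split.
- apply: (eq_measurable_fun (fun y => expR (expR y - 1) * expR (y / 2) * complex.Re (g (expR y)))%R).
    by move=> y _; rewrite /Wmul /Tinv !cReM !cImM /=; ring.
  by apply: measurable_funM; [exact: mW|exact: (mc _ m1)].
- apply: (eq_measurable_fun (fun y => expR (expR y - 1) * expR (y / 2) * complex.Im (g (expR y)))%R).
    by move=> y _; rewrite /Wmul /Tinv !cImM !cReM /=; ring.
  by apply: measurable_funM; [exact: mW|exact: (mc _ m2)].
pose k x := (complex.Re (g x) ^+ 2 + complex.Im (g x) ^+ 2)%R.
have E : (fun y : R => (normc (Wmul (Tinv g) y) ^+ 2 * weight y)%:E) = (fun y => (k (expR y))%:E * (expR y)%:E).
  apply/funext => y; rewrite -EFinM; congr EFin.
  rewrite /Wmul /Tinv !normcM !normcR !exprMn !normc_sqr -/(k _) !real_normK ?num_real //.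
  have e1 : (expR (expR y - 1) ^+ 2 * weight y = 1)%R.
    by rewrite -expRM_natl /weight -expRD -[RHS]expR0; congr expR; ring.
  have e2 : (expR (y / 2) ^+ 2 = expR y)%R by rewrite -expRM_natl; congr expR; field.
  by rewrite e2 mulrAC e1 mul1r mulrC.
have ik : integ k by exact: integD.
rewrite E ge0_integral_exp.
- have := integrable_lty mD ik; apply: le_lt_trans.
  by rewrite le_eqVlt; apply/orP; left; apply/eqP; apply: eq_integral => x /[!inE] /inD x0; rewrite lnK.
- apply/measurable_EFinP; apply: mc; exact: integ_meas.
- by move=> y; rewrite lee_fin addr_ge0 ?sqr_ge0.
Qed.

End change_of_variables.

(** * Exponential monomials *)

Section tame_functions.
Context {R : realType}.
Local Notation mu := (@lebesgue_measure R).
Local Notation D := (`]0%R, +oo[%classic : set R).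
Local Notation I f := (\int[mu]_(x in D) f x).
Implicit Types (v w : R -> R) (x y a b : R).

Lemma dfun_comp_ln v x c : 0 < x -> is_derive (ln x) (1 : R) v c ->
  is_derive x (1 : R) (fun t => v (ln t)) (c / x).
Proof. by move=> x0 h; apply: (dfun_eq (is_derive1_comp h (is_derive1_ln x0))). Qed.

Lemma dfun_ln x : 0 < x -> is_derive x (1 : R) (@ln R) x^-1.
Proof. exact: is_derive1_ln. Qed.

(** The power x^b for x > 0. *)
Definition exp_ln b x := expR (b * ln x).

Lemma exp_ln_deriv b x : 0 < x -> is_derive x (1 : R) (exp_ln b) (b / x * exp_ln b x).
Proof. by move=> x0; exact: dfun_expR (dfunZ b (dfun_ln x0)). Qed.

Lemma exp_ln_le b : 0 < b -> exists C, forall x, 0 < x -> exp_ln b x <= C * expR (x / 2).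
Proof.
move=> b0; have b2 : 0 < 2 * b by rewrite mulr_gt0.
(* The constant is (2b)^b: multiply ln u <= u at u = x / (2b) by [b]. *)
exists (expR (b * ln (2 * b))) => x x0; rewrite -expRD ler_expR.
have xb : 0 < x / (2 * b) by rewrite divr_gt0.
have h : -1 < x / (2 * b) - 1 by rewrite ltrBrDl subrr.
have := le_ln1Dx h; rewrite addrC subrK ln_div ?posrE // => h1.
have h2 : ln x - ln (2 * b) <= x / (2 * b) by apply: le_trans h1 _; rewrite gerBl.
have := ler_wpM2l (ltW b0) h2.
have -> : b * (x / (2 * b)) = x / 2 by field; rewrite gt_eqF.
by rewrite mulrBr; lra.
Qed.

Lemma exp_ln_cvg0 b : 0 < b -> exp_ln b x @[x --> 0^'+] --> 0.
Proof.
move=> b0; apply/cvgrPdist_le => e e0; near=> x.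
have x0 : 0 < x by near: x; exact: nbhs_right_gt.
rewrite sub0r normrN ger0_norm ?expR_ge0 // -[leRHS](lnK e0) ler_expR mulrC -ler_pdivlMr //.
rewrite -ler_expR lnK //; near: x; apply: nbhs_right_le; exact: expR_gt0.
Unshelve. all: by end_near. Qed.

Lemma exp_ln_exp_cvgy b : 0 < b -> exp_ln b x * expR (- x) @[x --> +oo] --> 0.
Proof.
move=> b0; have [C hC] := exp_ln_le b0.
have c2 : (0 : R) < 2^-1 by rewrite invr_gt0.
have h : C * expR (- (2^-1 * x)) @[x --> +oo] --> 0.
  by rewrite -(mulr0 C); apply: cvgMl_tmp; exact: cvg_expMy.
apply: (squeeze_cvgr _ (cvg_cst 0) h); near=> x.
have x0 : 0 < x by near: x; exact: nbhs_pinfty_gt.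
rewrite mulr_ge0 ?expR_ge0 //=; apply: le_trans (ler_wpM2r (expR_ge0 _) (hC x x0)) _.
by rewrite -mulrA -expRD le_eqVlt; apply/orP; left; apply/eqP; congr (_ * expR _); field.
Unshelve. all: by end_near. Qed.

(** One comparison treats both ends: the derivative b x^(b-1) / (1 + x^b)^2 of the bounded function
    -1 / (1 + x^b) is integrable, and (1 + x^b) e^(-x) is bounded by 1 + |C|. *)
Lemma exp_ln_integ b : 0 < b -> integ (fun x => exp_ln b x / x * expR (- (2 * x))).
Proof.
move=> b0; have [C hC] := exp_ln_le b0.
have E0 x : 0 < exp_ln b x by exact: expR_gt0.
have dV x : 0 < x -> is_derive x (1 : R) (fun t : R => t^-1) (- x ^- 2).
  by move=> x0; apply: is_derive_eq (is_deriveV _ _) _; rewrite ?gt_eqF // /GRing.scale /= mulr1.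
have d x : 0 < x -> is_derive x (1 : R) (fun x => exp_ln b x / x * expR (- (2 * x)))
   ((b / x * exp_ln b x / x - exp_ln b x / x ^+ 2 - 2 * (exp_ln b x / x)) * expR (- (2 * x))).
  move=> x0.
  apply: (dfun_eq (dfunM (dfunM (exp_ln_deriv b x0) (dV x x0)) (dfun_expR (dfunN (dfunZ 2 (dfun_id x)))))).
  ring.
have F1 x : 1 + exp_ln b x != 0 by rewrite gt_eqF // addr_gt0.
pose F x := - (1 + exp_ln b x)^-1.
have dF x : 0 < x -> is_derive x (1 : R) F (b * (exp_ln b x / x * (F x * F x))).
  move=> x0; have := dfunD (dfun_cst x 1) (exp_ln_deriv b x0) => h.
  apply: is_derive_eq (is_deriveN (is_deriveV _ h)) _ => //.
  by rewrite /GRing.scale /F /= add0r; field; rewrite F1 gt_eqF.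
have iF : integ (fun x => b * (exp_ln b x / x * (F x * F x))).
  apply: (@integ_ge0_bounded _ F _ 1) => //.
  - move=> x x0.
    have dE : {for x, continuous (fun t => exp_ln b t / t)}.
      exact: dfun_cont (dfunM (exp_ln_deriv b x0) (dV x x0)).
    by apply: contZ; apply: contM => //; apply: contM; exact: dfun_cont (dF x x0).
  - by move=> x x0; rewrite -expr2 mulr_ge0 ?(ltW b0) // mulr_ge0 ?sqr_ge0 // divr_ge0 // ltW.
  - move=> x x0; rewrite /F normrN ger0_norm; last by rewrite invr_ge0 addr_ge0 // ltW.
    by rewrite invf_le1 ?addr_gt0 // lerDl ltW.
apply: (integ_le (g := fun x => ((1 + `|C|) ^+ 2 / b) * (b * (exp_ln b x / x * (F x * F x))))).
- by apply: meas_cont => x x0; exact: dfun_cont (d x x0).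
- move=> x x0; rewrite ger0_norm; last by rewrite mulr_ge0 ?expR_ge0 // divr_ge0 // ltW.
  have -> : (1 + `|C|) ^+ 2 / b * (b * (exp_ln b x / x * (F x * F x))) =
     exp_ln b x / x * ((1 + `|C|) / (1 + exp_ln b x)) ^+ 2.
    by rewrite /F; field; rewrite F1 !gt_eqF.
  apply: ler_wpM2l; first by rewrite divr_ge0 // ltW.
  rewrite (_ : expR (- (2 * x)) = expR (- x) ^+ 2); last by rewrite -expRM_natl; congr expR; ring.
  rewrite ler_sqr ?nnegrE ?expR_ge0 //; last by rewrite divr_ge0 // addr_ge0 // ltW.
  rewrite ler_pdivlMr ?addr_gt0 // mulrDr mulr1 lerD //.
    by rewrite -expR0 ler_expR oppr_le0 ltW.
  apply: le_trans (ler_wpM2l (expR_ge0 _) (hC x x0)) _.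
  rewrite mulrCA -expRD; apply: le_trans (ler_norm _) _; rewrite normrM ler_piMr // ger0_norm ?expR_ge0 //.
  rewrite (_ : - x + x / 2 = - (x / 2)); last by field.
  by rewrite -expR0 ler_expR oppr_le0 divr_ge0 // ltW.
- exact: integZ.
Qed.

(** With [a] and [b] positive this controls both ends of the line at once, that is, the behaviour
    near 0 and near infinity after the substitution y = ln x. *)
Definition exp_growth a b v := exists K, forall y,
  `|v y| <= K * (expR (a * y) + expR (b * y)).

Lemma exp_growthD a b v w : exp_growth a b v -> exp_growth a b w ->
  exp_growth a b (fun y => v y + w y).
Proof.
move=> [K h] [K' h']; exists (K + K') => y; rewrite mulrDl.
by apply: le_trans (ler_normD _ _) _; exact: lerD.
Qed.

Lemma exp_growthZ a b c v : exp_growth a b v -> exp_growth a b (fun y => c * v y).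
Proof. by move=> [K h]; exists (`|c| * K) => y; rewrite normrM -mulrA ler_wpM2l. Qed.

Lemma pow_exp_growth k a b : a < b -> exp_growth a b (fun y => y ^+ k * expR ((a + b) / 2 * y)).
Proof.
(* Half the gap between [a] and [b]: e^(d |y|) absorbs the power of y and moves the midpoint
   exponent to [b] for y >= 0 and to [a] for y < 0. *)
move=> ab; pose d := (b - a) / 2; have d0 : 0 < d by rewrite divr_gt0 // subr_gt0.
exists (k`!%:R / d ^+ k) => y.
have P t : 0 <= t -> t ^+ k <= k`!%:R * expR t.
  case: k => [|k] t0; first by rewrite expr0 mul1r -[leLHS]expR0 ler_expR.
  rewrite -ler_pdivrMl ?ltr0n ?fact_gt0 // mulrC.
  by apply: le_trans (expR_ge1Dxn k t0); rewrite lerDr.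
have h : `|y| ^+ k <= k`!%:R / d ^+ k * expR (d * `|y|).
  rewrite mulrAC ler_pdivlMr ?exprn_gt0 // mulrC -exprMn; apply: P.
  by rewrite mulr_ge0 // ltW.
have h2 : expR (d * `|y|) * expR ((a + b) / 2 * y) <= expR (a * y) + expR (b * y).
  rewrite -expRD; case: (ger0P y) => _.
    rewrite [X in expR X](_ : _ = b * y); last by rewrite /d; field.
    by rewrite lerDr expR_ge0.
  rewrite [X in expR X](_ : _ = a * y); last by rewrite /d; field.
  by rewrite lerDl expR_ge0.
rewrite normrM normrX (ger0_norm (expR_ge0 _)).
apply: le_trans (ler_wpM2r (expR_ge0 ((a + b) / 2 * y)) h) _.
apply: (@le_trans _ _ (k`!%:R / d ^+ k * (expR (d * `|y|) * expR ((a + b) / 2 * y)))).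
  by rewrite !mulrA.
apply: ler_wpM2l h2; by rewrite divr_ge0 // exprn_ge0 // ltW.
Qed.

(* On real-valued functions, the inverse of [W \o T^-1]. *)
Definition pull v x := expR (1 - x - ln x / 2) * v (ln x).

Lemma pull_cont v x : 0 < x -> {for ln x, continuous v} -> {for x, continuous (pull v)}.
Proof.
move=> x0 cv; apply: contM.
  exact: dfun_cont (dfun_expR (dfunB (dfunB (dfun_cst x 1) (dfun_id x)) (dfunM (dfun_ln x0) (dfun_cst x 2^-1)))).
apply: continuous_comp cv; exact: dfun_cont (dfun_ln x0).
Qed.

Lemma pull_deriv v c x : 0 < x -> is_derive (ln x) (1 : R) v c ->
  is_derive x (1 : R) (pull v) ((- 1 - (2 * x)^-1) * pull v x + expR (1 - x - ln x / 2) * c / x).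
Proof.
move=> x0 dv.
apply: (dfun_eq (dfunM (dfun_expR (dfunB (dfunB (dfun_cst x 1) (dfun_id x)) (dfunM (dfun_ln x0) (dfun_cst x 2^-1)))) (dfun_comp_ln x0 dv))).
by rewrite /pull; field; rewrite gt_eqF.
Qed.

(** The square is x^(2a - 1) e^(-2x), integrable near 0 as [a] is positive. *)
Lemma exp_ln_L2 (a : R) : 0 < a -> L2r (fun x => exp_ln (a - 2^-1) x * expR (- x)).
Proof.
move=> a0; split.
  by apply: meas_cont => x x0; exact: dfun_cont (dfunM (exp_ln_deriv _ x0) (dfun_expR (dfunN (dfun_id x)))).
have a2 : 0 < 2 * a by rewrite mulr_gt0.
apply: eq_integ (exp_ln_integ a2) => x x0.
rewrite exprMn -!expRM_natl -[x in _ / x](lnK x0) -expRN -!expRD //; by congr expR; field.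
Qed.

Context (a b : R).
Hypotheses (a0 : 0 < a) (b0 : 0 < b).

Lemma pull_bound v : exp_growth a b v -> exists K,
  forall x, `|pull v x| <= K * (exp_ln (a - 2^-1) x * expR (- x) + exp_ln (b - 2^-1) x * expR (- x)).
Proof.
move=> [K h]; exists (expR 1 * K) => x.
rewrite normrM ger0_norm ?expR_ge0 //.
apply: le_trans (ler_wpM2l (expR_ge0 _) (h (ln x))) _; rewrite le_eqVlt; apply/orP; left; apply/eqP.
have E c : expR (1 - x - ln x / 2) * expR (c * ln x) = expR 1 * (exp_ln (c - 2^-1) x * expR (- x)).
  by rewrite -!expRD; congr expR; field.
by rewrite mulrCA mulrDr !E; ring.
Qed.

Lemma pull_L2 v : continuous v -> exp_growth a b v -> L2r (pull v).
Proof.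
move=> cv /pull_bound[K h].
have L := L2rZ K (L2rD (exp_ln_L2 a0) (exp_ln_L2 b0)).
apply: L2r_le L => [|x x0].
  by apply: meas_cont => x x0; exact: (pull_cont x0 (cv _)).
exact: le_trans (h x) (ler_norm _).
Qed.

(** The factor x raises the exponents a - 1/2 and b - 1/2, possibly negative, to positive ones, so
    the boundary terms of the integration by parts in [pull_shift] vanish. *)
Lemma pull_cvg0 v : exp_growth a b v ->
  x * pull v x @[x --> 0^'+] --> 0 /\ x * pull v x @[x --> +oo] --> 0.
Proof.
move=> /pull_bound[K h].
have a2 : 0 < a + 2^-1 by rewrite addr_gt0.
have b2 : 0 < b + 2^-1 by rewrite addr_gt0.
have h' x : 0 < x -> `|x * pull v x| <= K * (exp_ln (a + 2^-1) x * expR (- x) + exp_ln (b + 2^-1) x * expR (- x)).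
  move=> x0; rewrite normrM gtr0_norm //; apply: le_trans (ler_wpM2l (ltW x0) (h x)) _.
  have E c : exp_ln (c + 2^-1) x = x * exp_ln (c - 2^-1) x.
    by rewrite -[x in x * _](lnK x0) -expRD; congr expR; field.
  by rewrite !E le_eqVlt; apply/orP; left; apply/eqP; ring.
have ex0 : expR (- x) @[x --> 0^'+] --> (1 : R).
  have -> : (1 : R) = expR (- 0) by rewrite oppr0 expR0.
  exact/cvg_at_right_filter/(dfun_cont (dfun_expR (dfunN (dfun_id 0)))).
split; apply/norm_cvg0P.
- have c : K * (exp_ln (a + 2^-1) x * expR (- x) + exp_ln (b + 2^-1) x * expR (- x)) @[x --> 0^'+] --> 0.
    rewrite -[X in _ --> X](mulr0 K) -[X in K * X](addr0 0) -[X in K * (X + X)](mul0r 1).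
    by apply: cvgMl_tmp; apply: cvgD; apply: cvgM => //; exact: exp_ln_cvg0.
  apply: (squeeze_cvgr _ (cvg_cst 0) c); near=> x.
  by rewrite normr_ge0 h' //; near: x; exact: nbhs_right_gt.
- have c : K * (exp_ln (a + 2^-1) x * expR (- x) + exp_ln (b + 2^-1) x * expR (- x)) @[x --> +oo] --> 0.
    rewrite -[X in _ --> X](mulr0 K) -[X in K * X](addr0 0).
    by apply: cvgMl_tmp; apply: cvgD; exact: exp_ln_exp_cvgy.
  apply: (squeeze_cvgr _ (cvg_cst 0) c); near=> x.
  by rewrite normr_ge0 h' //; near: x; exact: nbhs_pinfty_gt.
Unshelve. all: by end_near. Qed.

(** Integrate the derivative of x [pull v] [lag n] over the half-line and rewrite x (1 - d/dx)
    [lag n] with [lag_euler]. The term 1/2 is the 1 from differentiating x minus the 1/2 contributed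
    by the factor x^(-1/2) in [pull]. *)
Lemma pull_shift v w n : (forall y, is_derive y (1 : R) v (w y)) -> continuous w ->
  exp_growth a b v -> exp_growth a b w ->
  n.+1%:R * (I (fun x => pull v x * lag n x) - I (fun x => pull v x * lag n.+1 x)) =
  I (fun x => pull w x * lag n x) + I (fun x => pull v x * lag n x) / 2.
Proof.
move=> dv cw gv gw.
have cv : continuous v by move=> y; exact: dfun_cont (dv y).
have Lv := pull_L2 cv gv; have Lw := pull_L2 cw gw.
have L := lag_L2 n (R := R); have L1 := lag_L2 n.+1 (R := R).
have i1 := L2rM Lv L; have i2 := L2rM Lv L1; have i3 := L2rM Lw L.
pose f x := pull w x * lag n x + 2^-1 * (pull v x * lag n x) - n.+1%:R * (pull v x * lag n x - pull v x * lag n.+1 x).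
have i_f : integ f.
  by apply: integB; [apply: integD => //|]; apply: integZ => //; exact: integB.
have dF x : 0 < x -> is_derive x (1 : R) (fun x => x * pull v x * lag n x) (f x).
  move=> x0; have [dl el] := lag_euler n x.
  apply: (dfun_eq (dfunM (dfunM (dfun_id x) (pull_deriv x0 (dv (ln x)))) dl)).
  have -> : f x = pull w x * lag n x + 2^-1 * (pull v x * lag n x) - pull v x * (n.+1%:R * (lag n x - lag n.+1 x)).
    by rewrite /f; ring.
  by rewrite -el /pull; field; rewrite gt_eqF.
have F0 : I f = 0.
  rewrite (FTC_half_line (A := 0) (B := 0) dF) ?subrr //.
  - move=> x x0; have lc m : {for x, continuous (lag m)} by exact: polyexp_cont.
    have pc u : continuous u -> {for x, continuous (pull u)}.
      by move=> cu; exact: (pull_cont x0 (cu _)).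
    apply: contB; first by apply: contD; [|apply: contZ]; apply: contM => //; exact: pc.
    by apply: contZ; apply: contB; apply: contM => //; exact: pc.
  - rewrite -[X in _ --> X](mul0r (laguerre n).[0]); apply: cvgM; first by case: (pull_cvg0 gv).
    exact: polyexp_cvg0.
  - rewrite -[X in _ --> X](mul0r 0); apply: cvgM; first by case: (pull_cvg0 gv).
    exact: polyexp_cvgy.
have i12 := integB i1 i2; have := F0; rewrite /f IntB ?IntD ?IntZ ?IntB //.
- by move=> h; apply/eqP; rewrite eq_sym -subr_eq0 -[X in _ == X]h; apply/eqP; ring.
- by apply: integZ.
- by apply: integD => //; apply: integZ.
- by apply: integZ.
Qed.

End tame_functions.

(** * Exponential monomials as Jordan chains *)

Section exponential_monomials.
Context {R : realType}.
Local Notation C := R[i].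
Local Notation mu := (@lebesgue_measure R).
Local Notation D := (`]0%R, +oo[%classic : set R).
Local Notation I f := (\int[mu]_(x in D) f x).
Local Notation Re := (@complex.Re R).
Local Notation Im := (@complex.Im R).
Implicit Types (v w : R -> C^o) (x y : R) (l : C).

Definition cpull v : R -> C^o := fun x => (expR (1 - x - ln x / 2))%:C%C * v (ln x).

Lemma cpullK v : Wmul (Tinv (cpull v)) = v.
Proof.
apply/funext => y; rewrite /Wmul /Tinv /cpull expRK !mulrA -!rmorphM -!expRD.
rewrite [X in expR X](_ : _ = 0) ?expR0 ?mul1r //; by field.
Qed.

Lemma cpullP c v w : cpull (fun y => c * v y + w y) = fun x => c * cpull v x + cpull w x.
Proof. by apply/funext => x; rewrite /cpull; ring. Qed.

Lemma Re_cpull v x : Re (cpull v x) = pull (fun y => Re (v y)) x.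
Proof. by rewrite /cpull cReM /= mul0r subr0. Qed.

Lemma Im_cpull v x : Im (cpull v x) = pull (fun y => Im (v y)) x.
Proof. by rewrite /cpull cImM /= mul0r addr0. Qed.

Definition tame a b v := [/\ continuous (fun y => Re (v y)), continuous (fun y => Im (v y)),
  exp_growth a b (fun y => Re (v y)) & exp_growth a b (fun y => Im (v y))].

Lemma tameP a b c v w : tame a b v -> tame a b w -> tame a b (fun y => c * v y + w y).
Proof.
move=> [c1 c2 g1 g2] [c1' c2' g1' g2'].
have ER : (fun y => Re (c * v y + w y)) = (fun y => Re c * Re (v y) + (- Im c) * Im (v y) + Re (w y)).
  by apply/funext => y; rewrite cReD cReM mulNr.
have EI : (fun y => Im (c * v y + w y)) = (fun y => Re c * Im (v y) + Im c * Re (v y) + Im (w y)).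
  by apply/funext => y; rewrite cImD cImM.
split; rewrite ?ER ?EI.
- by move=> y; exact: contD (contD (contZ (c1 y)) (contZ (c2 y))) (c1' y).
- by move=> y; exact: contD (contD (contZ (c2 y)) (contZ (c1 y))) (c2' y).
- exact: exp_growthD (exp_growthD (exp_growthZ _ g1) (exp_growthZ _ g2)) g1'.
- exact: exp_growthD (exp_growthD (exp_growthZ _ g2) (exp_growthZ _ g1)) g2'.
Qed.

Lemma cpull_CL2 a b v : 0 < a -> 0 < b -> tame a b v -> CL2 (cpull v).
Proof.
move=> a0 b0 [c1 c2 g1 g2]; split.
  rewrite (_ : (fun x => _) = pull (fun y => Re (v y))); last by apply/funext => x; exact: Re_cpull.
  exact: (pull_L2 a0 b0).
rewrite (_ : (fun x => _) = pull (fun y => Im (v y))); last by apply/funext => x; exact: Im_cpull.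
exact: (pull_L2 a0 b0).
Qed.

(* The generator of the composition semigroup, conjugated by [psi] and
   [cpull], becomes [d/dy + 1/2]. *)
Lemma Dop_psi a b v w : 0 < a -> 0 < b -> tame a b v -> tame a b w ->
  (forall y, is_derive y (1 : R) (fun y => Re (v y)) (Re (w y))) ->
  (forall y, is_derive y (1 : R) (fun y => Im (v y)) (Im (w y))) ->
  Dop (psi (cpull v)) = (fun n => psi (cpull w) n + 2^-1 * psi (cpull v) n : C^o).
Proof.
move=> a0 b0 [_ _ v1 v2] [c1 c2 w1 w2] d1 d2; apply/funext => n.
rewrite /Dop /psi -mulrBr mulrCA [2^-1 * _]mulrCA -mulrDr; congr (_ * _).
have PR u m : I (fun x => Re (cpull u x) * lag m x) = I (fun x => pull (fun y => Re (u y)) x * lag m x).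
  by apply: Int_eq => x _; rewrite Re_cpull.
have PI u m : I (fun x => Im (cpull u x) * lag m x) = I (fun x => pull (fun y => Im (u y)) x * lag m x).
  by apply: Int_eq => x _; rewrite Im_cpull.
have h1 := pull_shift a0 b0 n d1 c1 v1 w1; have h2 := pull_shift a0 b0 n d2 c2 v2 w2.
have -> : n.+1%:R = (n.+1%:R : R)%:C%C by rewrite rmorph_nat.
have -> : 2^-1 = (2^-1 : R)%:C%C by rewrite fmorphV rmorph_nat.
rewrite /lag_dot !PR !PI; apply: complex_eq; rewrite ?cReD ?cImD ?cReM ?cImM ?cReN ?cImN /= ?cReN ?cImN /= !mul0r ?subr0 ?addr0.
  by rewrite h1 mulrC.
by rewrite h2 mulrC.
Qed.

Lemma exp_monomialE l k y : exp_monomial l k y =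
  (y ^+ k)%:C%C * ((expR (Re l * y))%:C%C * (cos (Im l * y) +i* sin (Im l * y))%C).
Proof.
rewrite /exp_monomial /cexp; have -> : Re (l * y%:C%C) = Re l * y by rewrite cReM /= mulr0 subr0.
by have -> : Im (l * y%:C%C) = Im l * y by rewrite cImM /= mulr0 add0r.
Qed.

Lemma Re_exp_monomial l k y : Re (exp_monomial l k y) = y ^+ k * (expR (Re l * y) * cos (Im l * y)).
Proof. by rewrite exp_monomialE cReM /= !mul0r !subr0. Qed.

Lemma Im_exp_monomial l k y : Im (exp_monomial l k y) = y ^+ k * (expR (Re l * y) * sin (Im l * y)).
Proof. by rewrite exp_monomialE cImM /= !mul0r !addr0. Qed.

Definition exp_monomial' l k : R -> C^o := fun y => l * exp_monomial l k y + k%:R * exp_monomial l k.-1 y.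

Lemma exp_monomial_deriv l k y :
  is_derive y (1 : R) (fun y => Re (exp_monomial l k y)) (Re (exp_monomial' l k y)) /\
  is_derive y (1 : R) (fun y => Im (exp_monomial l k y)) (Im (exp_monomial' l k y)).
Proof.
have dp : is_derive y (1 : R) (fun y : R => y ^+ k) (k%:R * y ^+ k.-1).
  apply: dfun_ext (dfun_eq (is_derive_poly 'X^k y) _) => [t|]; first by rewrite hornerXn.
  by rewrite derivXn hornerMn hornerXn mulr_natl.
have de := dfun_expR (dfunZ (Re l) (dfun_id y)).
have dc := dfun_cos (dfunZ (Im l) (dfun_id y)); have ds := dfun_sin (dfunZ (Im l) (dfun_id y)).
have kE : k%:R = (k%:R : R)%:C%C by rewrite rmorph_nat.
rewrite /exp_monomial' kE; split.
- apply: (dfun_ext (fun y => esym (Re_exp_monomial l k y))).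
  apply: (dfun_eq (dfunM dp (dfunM de dc))).
  by rewrite cReD (cReM l) (cReM (k%:R)%:C%C) !Re_exp_monomial !Im_exp_monomial /=; ring.
- apply: (dfun_ext (fun y => esym (Im_exp_monomial l k y))).
  apply: (dfun_eq (dfunM dp (dfunM de ds))).
  by rewrite cImD (cImM l) (cImM (k%:R)%:C%C) !Re_exp_monomial !Im_exp_monomial /=; ring.
Qed.

Lemma exp_monomial_tame l k : 0 < Re l -> tame (Re l / 2) (Re l * (3 / 2)) (exp_monomial l k).
Proof.
(* The two exponents are positive with midpoint [Re l], as [pow_exp_growth] requires. *)
move=> l0; have ab : Re l / 2 < Re l * (3 / 2) by lra.
have [K hK] := pow_exp_growth k ab.
have E : (Re l / 2 + Re l * (3 / 2)) / 2 = Re l by field.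
rewrite E in hK.
split; try (by move=> y; have [h1 h2] := exp_monomial_deriv l k y; first [exact: dfun_cont h1|exact: dfun_cont h2]).
- exists K => y; apply: le_trans (hK y); rewrite Re_exp_monomial mulrA normrM ler_piMr //.
  by rewrite ler_norml cos_geN1 cos_le1.
- exists K => y; apply: le_trans (hK y); rewrite Im_exp_monomial mulrA normrM ler_piMr //.
  by rewrite ler_norml sin_geN1 sin_le1.
Qed.

Lemma psi0 : psi (fun=> 0) = 0 :> (nat -> C^o).
Proof.
apply/funext => n; rewrite /psi /lag_dot /=; have -> : I (fun x => 0 * lag n x) = 0.
  by rewrite -[RHS]Int0; apply: Int_eq => x _; rewrite mul0r.
by rewrite mulr0.
Qed.

(** Equal Laguerre coordinates give equal Laplace transforms, so completeness of the Laguerre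
    functions follows from injectivity of the Laplace transform. *)
Lemma psi_inj g g' : CL2 g -> CL2 g' -> psi g = psi g' ->
  {ae mu, forall x, 0 < x -> g x = g' x}.
Proof.
move=> cg cg' E; apply: laplace_inj => // s s0.
by rewrite (laplace_psi (f := Hardy (psi_sqsummable cg)) cg s0) // (laplace_psi (f := Hardy (psi_sqsummable cg)) cg' s0).
Qed.

Lemma psi_ae g g' : CL2 g -> CL2 g' -> {ae mu, forall x, 0 < x -> g x = g' x} ->
  psi g = psi g'.
Proof.
move=> [[g1 _] [g2 _]] [[g1' _] [g2' _]] gg'; apply/funext => n; rewrite /psi; congr (_ * _).
have mD : measurable (D : set (measurableTypeR R)) by exact: mhalf_line.
have ml : measurable_fun D (lag n) by case: (lag_L2 n (R := R)).
have H (F : C -> R) : measurable_fun D (fun x => F (g x)) -> measurable_fun D (fun x => F (g' x)) ->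
    I (fun x => F (g x) * lag n x) = I (fun x => F (g' x) * lag n x).
  move=> m m'; rewrite /Rintegral; congr fine; apply: (@ae_eq_integral _ _ R mu D) => //.
  - by apply/measurable_EFinP; exact: measurable_funM.
  - by apply/measurable_EFinP; exact: measurable_funM.
  apply: (filterS _ gg'); first exact: (ae_filter_ringOfSetsType mu).
  by move=> x h /inD /h /= ->.
by rewrite /lag_dot (H Re) // (H Im).
Qed.

Definition chain l k : nat -> C^o := psi (cpull (exp_monomial l k)).

Lemma exp_monomial_CL2 l k : 0 < Re l -> CL2 (cpull (exp_monomial l k)).
Proof. by move=> l0; apply: cpull_CL2 (exp_monomial_tame k l0); rewrite ?mulr_gt0. Qed.

Lemma Dop_chain l k : 0 < Re l ->
  Dop (chain l k) = (l + 2^-1) *: chain l k + k%:R *: chain l k.-1.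
Proof.
move=> l0; have a0 : 0 < Re l / 2 by rewrite divr_gt0.
have b0 : 0 < Re l * (3 / 2) by rewrite mulr_gt0.
have t k' := exp_monomial_tame k' l0.
have c k' := exp_monomial_CL2 k' l0.
have tame0 : tame (Re l / 2) (Re l * (3 / 2)) (fun=> 0).
  by split; try (by move=> y; exact: cvg_cst); exists 0 => y; rewrite normr0 mul0r.
have T0 : tame (Re l / 2) (Re l * (3 / 2)) (fun y => k%:R * exp_monomial l k.-1 y).
  have := tameP k%:R (t k.-1) tame0; rewrite (_ : (fun y => _) = (fun y => k%:R * exp_monomial l k.-1 y : C^o)) //.
  by apply/funext => y; rewrite addr0.
have dR y := (exp_monomial_deriv l k y).1; have dI y := (exp_monomial_deriv l k y).2.
rewrite /chain (Dop_psi a0 b0 (t k) (tameP l (t k) T0) dR dI); apply/funext => n.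
have := psiP l n (c k) (cpull_CL2 a0 b0 T0); rewrite -cpullP => ->.
rewrite !fctE -![_ *: _]/(_ * _).
have -> : psi (cpull (fun y => k%:R * exp_monomial l k.-1 y)) n = k%:R * psi (cpull (exp_monomial l k.-1)) n.
  have z : CL2 (fun=> 0 : C^o) by split; exact: L2r0.
  have E : cpull (fun y => k%:R * exp_monomial l k.-1 y) = fun x => k%:R * cpull (exp_monomial l k.-1) x + 0.
    by apply/funext => x; rewrite /cpull addr0; ring.
  by rewrite E psiP // psi0; exact: addr0.
by rewrite mulrDl -addrA [_ + 2^-1 * _]addrC addrA.
Qed.

(** Otherwise a nowhere vanishing function would be 0 almost everywhere on the half-line, which
    would then be a null set. *)
Lemma chain0_neq0 l : 0 < Re l -> chain l 0 <> 0.
Proof.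
move=> l0 c0; have c := exp_monomial_CL2 0 l0.
have z : CL2 (fun=> 0 : C^o) by split; exact: L2r0.
have z0 : psi (fun=> 0) = 0 :> (nat -> C^o) by exact: psi0.
have := psi_inj c z (etrans c0 (esym z0)) => -[N [mN N0 DN]].
suff : mu D = 0%E by rewrite lebesgue_measure_itv /= ltry.
apply/eqP; rewrite eq_le measure_ge0 andbT -N0; apply: le_measure; rewrite ?inE //.
move=> x /inD x0; apply: DN => /= /(_ x0) /(congr1 (fun z => normc z ^+ 2)) /eqP.
rewrite normc_sqr Re_cpull Im_cpull /pull Re_exp_monomial Im_exp_monomial !expr0 !mul1r.
rewrite normc0 expr0n /= !exprMn -!mulrDr cos2Dsin2 mulr1 gt_eqF //.
by rewrite mulr_gt0 ?exprn_gt0 ?expR_gt0.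
Qed.

End exponential_monomials.

(** * The transform of the orthogonal complement *)

Section frak_transform.
Context {R : realType}.
Local Notation C := R[i].
Local Notation H := (hardy R).
Local Notation mu := (@lebesgue_measure R).
Local Notation Re := (@complex.Re R).
Implicit Types (f : H) (v : R -> C^o) (L : set C) (n : C -> nat).

Lemma ae_eqP v w : (v = w %[ae mu]) <-> {ae mu, forall y, v y = w y}.
Proof.
split; apply: filterS; try exact: (ae_filter_ringOfSetsType mu).
  by move=> y; apply.
by move=> y h _.
Qed.

(** The choice in [laplace_inv] ranges over a nonempty set, by [psi_surjective] and [laplace_psi];
    whichever representative it returns has the coordinates of [f], by injectivity. *)
Lemma frakFE f : exists g, [/\ CL2 g, psi g = hcoef f & frakF f = Wmul (Tinv g)].
Proof.
have [g Lg gf] := psi_surjective (valP f).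
have lap s : right_half_plane s -> laplace g s = disc_to_half_plane f s.
  by move=> s0; exact: laplace_psi.
pose P := [set g : R -> C^o | L2 `]0, +oo[ (cst 1) g /\
  forall s, right_half_plane s -> laplace g s = disc_to_half_plane f s].
have Pg : P g by split => //; exact/CL2P.
have : P (laplace_inv (disc_to_half_plane f)) by exact: (@xgetPex _ 0 P (ex_intro _ g Pg)).
move=> [/CL2P Lg' lap']; exists (laplace_inv (disc_to_half_plane f)); split => //.
rewrite -[RHS]gf; apply: psi_ae => //; apply: laplace_inj => // s s0.
by rewrite lap' // lap.
Qed.

Lemma frakF_L2 f : L2 setT weight (frakF f).
Proof. by have [g [Lg _ ->]] := frakFE f; exact: Tinv_L2. Qed.

(** Turns equality almost everywhere on the line into equality of coefficient sequences, where the
    linear algebra takes place. *)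
Lemma frakFP f v : CL2 (cpull v) ->
  (frakF f = v %[ae mu]) <-> psi (cpull v) = hcoef f.
Proof.
move=> Lv; have [g [Lg gf ->]] := frakFE f; split.
  move=> /ae_eqP/ae_ln h; rewrite -gf; apply/esym/psi_ae => //.
  apply: (filterS _ h); first exact: (ae_filter_ringOfSetsType mu).
  move=> x + x0 => /(_ x0); rewrite /cpull => <-.
  rewrite /Wmul /Tinv lnK // !mulrA -!rmorphM -!expRD.
  by rewrite [X in expR X](_ : _ = 0) ?expR0 ?mul1r //; field.
rewrite -gf => /esym/(psi_inj Lg Lv)/ae_expR h; apply/ae_eqP.
apply: (filterS _ h); first exact: (ae_filter_ringOfSetsType mu).
by move=> y E; rewrite -[in RHS](cpullK v) /Wmul /Tinv E.
Qed.

Lemma psi_cpull_sum m (c : 'I_m -> C) (u : 'I_m -> R -> C^o) :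
  (forall i, CL2 (cpull (u i))) ->
  CL2 (cpull (\sum_i c i *: u i)) /\
  psi (cpull (\sum_i c i *: u i)) = \sum_i c i *: psi (cpull (u i)).
Proof.
move=> Lu; elim/big_rec2: _ => [|i a b _ [IH1 IH2]].
  have -> : cpull (0 : R -> C^o) = fun=> 0 by apply/funext => x; exact: mulr0.
  by split; [split; exact: L2r0|exact: psi0].
have -> : cpull (c i *: u i + b) = fun x => c i * cpull (u i) x + cpull b x.
  exact: (cpullP (c i) (u i) b).
split; first by apply: CL2D => //; exact: CL2Z.
by apply/funext => k; rewrite psiP // IH2.
Qed.

Definition exp_monomials L n : set (R -> C^o) :=
  \bigcup_(l in L) [set exp_monomial l k | k in [set k | (k <= n l)%N]].

Lemma span_CL2 L n v : L `<=` right_half_plane ->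
  linear_span (exp_monomials L n) v -> CL2 (cpull v).
Proof.
move=> LA [m [c [u [Su ->]]]]; have [] // := @psi_cpull_sum _ c u => i.
by have [l Ll [k _ <-]] := Su i; apply: exp_monomial_CL2; exact: LA.
Qed.

Lemma span_psi L n : L `<=` right_half_plane ->
  linear_span (chains chain L n) =
  [set psi (cpull v) | v in linear_span (exp_monomials L n)].
Proof.
move=> LA; have Lu u : exp_monomials L n u -> CL2 (cpull u).
  by move=> h; apply: (span_CL2 LA); exact: mem_linear_span h.
apply/seteqP; split.
  move=> _ [m [c [w [Sw ->]]]].
  have /choice[u hu] : forall i, exists u, exp_monomials L n u /\ psi (cpull u) = w i.
    move=> i; have [l Ll [k kn <-]] := Sw i.
    by exists (exp_monomial l k); split => //; exists l => //; exists k.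
  have [_ s2] := psi_cpull_sum c (fun i => Lu _ (hu i).1).
  exists (\sum_i c i *: u i); first by exists m, c, u; split => // i; case: (hu i).
  by rewrite s2; apply: eq_bigr => i _; case: (hu i) => _ ->.
move=> _ [_ [m [c [u [Su ->]]]] <-].
have [_ ->] := psi_cpull_sum c (fun i => Lu _ (Su i)).
exists m, c, (fun i => psi (cpull (u i))); split => // i.
by have [l Ll [k kn <-]] := Su i; exists l => //; exists k.
Qed.

Lemma L2_classes_frakF (N : set H) L n : L `<=` right_half_plane ->
  L2_classes weight (frakF @` N) = L2_classes weight (linear_span (exp_monomials L n)) <->
  (@hcoef R) @` N = linear_span (chains chain L n).
Proof.
move=> LA; have symT (u w : R -> C^o) : (u = w %[ae mu]) -> (w = u %[ae mu]).
  move=> /ae_eqP h; apply/ae_eqP; apply: (filterS _ h); first exact: (ae_filter_ringOfSetsType mu).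
  by move=> y ->.
have transT (u w z : R -> C^o) : (u = w %[ae mu]) -> (w = z %[ae mu]) -> (u = z %[ae mu]).
  by move=> /ae_eqP h /ae_eqP h'; apply/ae_eqP; apply: aeS2 h h' => y -> ->.
rewrite span_psi //; split=> E; apply/seteqP; split.
- move=> _ [f Nf <-].
  have : L2_classes weight (frakF @` N) (frakF f).
    by split; [exact: frakF_L2|exists (frakF f); [exists f|exact/ae_eqP/aeW]].
  rewrite E => -[_ [v sv fv]]; exists v => //.
  exact/(frakFP f (span_CL2 LA sv)).
- move=> _ [v sv <-]; have Lv := span_CL2 LA sv.
  have : L2_classes weight (linear_span (exp_monomials L n)) v.
    by split; [rewrite -(cpullK v); exact: Tinv_L2|exists v => //; exact/ae_eqP/aeW].
  rewrite -E => -[_ [_ [f Nf <-] vf]]; exists f => //.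
  by apply/esym/(frakFP f Lv); exact: symT.
- move=> h [Lh [_ [f Nf <-] hf]]; split => //.
  have [v sv va] : [set psi (cpull v) | v in linear_span (exp_monomials L n)] (hcoef f).
    by rewrite -E; exists f.
  by exists v => //; apply: transT hf _; apply/(frakFP f (span_CL2 LA sv)).
- move=> h [Lh [v sv hv]]; split => //.
  have [f Nf fv] : (@hcoef R @` N) (psi (cpull v)) by rewrite E; exists v.
  exists (frakF f); first by exists f.
  by apply: transT hv _; apply: symT; apply/(frakFP f (span_CL2 LA sv)).
Qed.

(** Chains are re-indexed by the eigenvalue c = l + 1/2, as [jordan] expects, in place of the
    exponent l. *)
Let half_plane : set C := [set c | 1 / 2 < Re c].
Let e (c : C) k : nat -> C^o := chain (c - 2^-1) k.

Lemma Re_half : Re (2^-1) = 2^-1.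
Proof. by rewrite (_ : 2^-1 = (2^-1 : R)%:C%C) // fmorphV rmorph_nat. Qed.

Let eA c : half_plane c -> 0 < Re (c - 2^-1).
Proof. by rewrite /half_plane /= cReD cReN Re_half subr_gt0 div1r. Qed.

Let eT c k : half_plane c -> Dop (e c k) = c *: e c k + k%:R *: e c k.-1.
Proof. by move=> /eA c0; rewrite /e Dop_chain // subrK. Qed.

Let e_neq0 c : half_plane c -> e c 0 <> 0.
Proof. by move=> /eA; exact: chain0_neq0. Qed.

Lemma cesaro_invariantP (M : set H) : lin_closed M -> closed M -> finite_codim M ->
  (forall f, M f -> M (cesaro_op f)) <->
  exists L n, [/\ finite_set L, L `<=` right_half_plane &
    (@hcoef R) @` hardy_orth M = linear_span (chains chain L n)].
Proof.
move=> sM cM fM; split.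
  move=> inv; have [r [u [Nu /(_ inv) stab]]] := orth_basis sM cM fM.
  have NE : (@hcoef R) @` hardy_orth M = linear_span (range (fun j => hcoef (u j))).
    rewrite Nu; apply/seteqP; split.
      by move=> _ [_ /spanP[c ->] <-]; rewrite hcoef_sum; apply/spanP; exists c.
    move=> _ /spanP[c ->]; exists (\sum_i c i *: u i); last by rewrite hcoef_sum.
    by apply/spanP; exists c.
  have [||L [n [fL LA spanE]]] := @jordan _ _ _ half_plane e (@Dop_eig1 R) e_neq0 eT r (fun j => hcoef (u j)).
  - exact: stab.
  - move=> c x; rewrite -NE => -[f Nf <-] f0 Df; apply: Dop_eigenvalue Df => f0'.
    by apply: f0; rewrite f0'.
  exists [set c - 2^-1 | c in L], (fun l => n (l + 2^-1)); split.
  + exact: finite_image.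
  + by move=> _ [c Lc <-]; apply: eA; exact: LA.
  + rewrite NE spanE; congr linear_span; apply/seteqP; split.
      move=> _ [c Lc [k kn <-]]; exists (c - 2^-1); first by exists c.
      by exists k => //=; rewrite subrK.
    move=> _ [_ [c Lc <-] [k kn <-]]; rewrite /= subrK in kn; by exists c => //; exists k.
move=> [L [n [fL LA E]]]; apply: (Dop_cesaro_invariant sM cM fM) => f Nf.
pose S := linear_span (chains chain L n).
suff : S `<=` [set Dop a | a in S].
  have : S (hcoef f) by rewrite /S -E; exists f.
  by move=> Sf /(_ _ Sf)[a]; rewrite /S -E => -[g Ng <-] h; exists g.
apply: span_sub.
  split; first by exists 0; [exact: (span_lin_closed _).1|rewrite linear0].
  move=> c _ _ [a Sa <-] [b Sb <-]; exists (c *: a + b); last by rewrite linearP.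
  exact: (span_lin_closed _).2.
move=> _ [l Ll [k kn <-]].
have lh : half_plane (l + 2^-1).
  by rewrite /half_plane /= cReD Re_half div1r ltrDr; exact: LA.
have l0 : l + 2^-1 != 0.
  by apply/eqP => h; move: lh; rewrite h /half_plane /=; lra.
(* As 0 is not in [half_plane], [chains_surj] with [c = 0] inverts [Dop] within an initial segment
   of the chain, hence within the span. *)
have [a sa] := @chains_surj _ _ _ _ _ eT 0 _ k lh l0; rewrite scale0r subr0 /e addrK => Da.
exists a => //; move: sa; apply: span_mono => _ [j /= jk <-].
apply: mem_linear_span; exists l => //; exists j => //=; first exact: leq_trans kn.
by rewrite /e addrK.
Qed.

End frak_transform.

Theorem theorem2p9 (R : realType) (M : set (hardy R)) :
  GRing.submod_closed [in M] -> closed M -> finite_codim M ->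
  (forall f, M f -> M (cesaro_op f)) <->
  exists (L : set R[i]) (n : R[i] -> nat),
    [/\ finite_set L,
        L `<=` right_half_plane &
        L2_classes weight (frakF @` hardy_orth M) =
        L2_classes weight (linear_span
          (\bigcup_(l in L) [set exp_monomial l k | k in [set k | (k <= n l)%N]]))].
Proof.
move=> sM cM fM; have lM : lin_closed M.
  by case: sM => h0 h; split=> [|a x y Mx My]; [move: h0|have := h a x y]; rewrite !inE //; apply.
rewrite (cesaro_invariantP lM cM fM); split=> -[L [n [fL LA E]]]; exists L, n; split => //.
  exact/(L2_classes_frakF _ n LA).
exact/(L2_classes_frakF _ n LA).
Qed.
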